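(* Let $(\mathrm L,\mathcal X')$ be compatible, with order $\alpha$, Schwartz-Banach space $\mathcal X$ and universal biorthogonal system $(\boldsymbol\phi,\boldsymbol p)$ as in the context, and let $\mathcal X_{\mathrm L}=\mathcal U\oplus\mathcal N_{\boldsymbol\phi}$, $\mathcal U=\mathrm L^\ast(\mathcal X)$, be the pre-native space. The continuous dual of $\mathcal X_{\mathrm L}$ is the native Banach space $$\mathcal X'_{\mathrm L}=\mathcal U'\oplus\mathcal N_{\boldsymbol p}=\mathrm L_{\boldsymbol\phi}^{-1}(\mathcal X')\oplus\mathcal N_{\boldsymbol p}=\{\mathrm L_{\boldsymbol\phi}^{-1}w+p:w\in\mathcal X',\ p\in\mathcal N_{\boldsymbol p}\},$$ which is isometrically isomorphic to $\mathcal X'\times\mathcal N_{\boldsymbol p}$ equipped with the composite norm $\|w\|_{\mathcal X'}+\|\boldsymbol\phi(p)\|_2$. In other words, for any $f\in\mathcal X'_{\mathrm L}$ there is a unique such pair, namely $w=\mathrm Lf\in\mathcal X'$ and $p=\mathrm{Proj}_{\mathcal N_{\boldsymbol p}}\{f\}=\sum_{n=1}^{N_0}\langle\phi_n,f\rangle p_n\in\mathcal N_{\boldsymbol p}$, with the finite-dimensional space $\mathcal N_{\boldsymbol p}=\mathrm{span}\{p_n\}_{n=1}^{N_0}$ being the null space of the continuous operator $\mathrm L:\mathcal X'_{\mathrm L}\to\mathcal X'$. The continuous operator $\mathrm L_{\boldsymbol\phi}^{-1}:\mathcal X'\to\mathcal X'_{\mathrm L}$, which is the adjoint of $\mathrm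 L_{\boldsymbol\phi}^{-1\ast}:\mathcal X_{\mathrm L}\to\mathcal X$, has the following properties: 1. Effective range: $\mathcal U'=\mathrm L_{\boldsymbol\phi}^{-1}(\mathcal X')=\{s=\mathrm L_{\boldsymbol\phi}^{-1}w:w\in\mathcal X'\}$. 2. Annihilator: $\mathcal N_{\boldsymbol\phi}=\{g\in\mathcal X_{\mathrm L}:\langle\mathrm L_{\boldsymbol\phi}^{-1}w,g\rangle=0\text{ for all }w\in\mathcal X'\}$. 3. Right inverse of $\mathrm L$: $\mathrm L\mathrm L_{\boldsymbol\phi}^{-1}w=w$ for any $w\in\mathcal X'$. 4. Left pseudo-inverse: $\mathrm L_{\boldsymbol\phi}^{-1}\mathrm Lf=(\mathrm{Id}-\mathrm{Proj}_{\mathcal N_{\boldsymbol p}})\{f\}$ for any $f\in\mathcal X'_{\mathrm L}$. Moreover, there are continuous embeddings $\mathcal S(\mathbb R^d)\hookrightarrow\mathcal X'_{\mathrm L}\hookrightarrow L_{\infty,\alpha}(\mathbb R^d)\hookrightarrow\mathcal S'(\mathbb R^d)$, the last one being dense. Finally, if $\mathcal X$ is reflexive, then $\mathcal X'_{\mathrm L}$ is reflexive as well and the embedding $\mathcal S(\mathbb R^d)\hookrightarrow\mathcal X'_{\mathrm L}$ is dense.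
   Context: All functions and spaces are real. $\mathcal S(\mathbb R^d)$ is the Schwartz space, $\mathcal S'(\mathbb R^d)$ the space of tempered distributions, $\langle\cdot,\cdot\rangle$ the duality product. Schwartz-Banach space: a normed space $(\mathcal X,\|\cdot\|_{\mathcal X})\subseteq\mathcal S'(\mathbb R^d)$ that is a Banach space with $\mathcal S(\mathbb R^d)\subseteq\mathcal X\subseteq\mathcal S'(\mathbb R^d)$, both inclusions being continuous with dense range (equivalently, $\mathcal X$ is the completion of $\mathcal S(\mathbb R^d)$ in the norm $\|\cdot\|_{\mathcal X}$). Its dual $\mathcal X'$ is viewed as a subspace of $\mathcal S'(\mathbb R^d)$ by restricting functionals to $\mathcal S(\mathbb R^d)$. Weighted spaces: for $\alpha\in\mathbb R$, $L_{\infty,\alpha}(\mathbb R^d)$ is the space of measurable $f$ with $\|f\|_{\infty,\alpha}=\operatorname{ess\,sup}_x(1+\|x\|)^{-\alpha}|f(x)|<\infty$; it is the dual of $L_{1,-\alpha}(\mathbb R^d)$, which has norm $\|g\|_{1,-\alpha}=\int_{\mathbb R^d}(1+\|x\|)^{\alpha}|g(x)|\,dx$. Spline-admissible operator: a linear operator $\mathrm L:\mathcal S(\mathbb R^d)\to\mathcal S'(\mathbb R^d)$ is spline-admissible with order $\alpha\in\mathbb R$ if there exist an operator $\mathrm L^{-1}$ and a finite-dimensional space $\mathcal N_{\boldsymbol p}=\mathrm{span}\{p_n\}_{n=1}^{N_0}$ (dimension $N_0$) such that: (1) $\mathrm L$ and its adjoint $\mathrm L^\ast$ map $\mathcal S(\mathbb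 R^d)\to L_{1,-\alpha}(\mathbb R^d)$ continuously; (2) $\mathrm L^{-1}$ and its adjoint $\mathrm L^{-1\ast}$ map $L_{1,-\alpha}(\mathbb R^d)\to L_{\infty,\alpha}(\mathbb R^d)$ continuously; (3) $\mathrm L^{-1\ast}\mathrm L^\ast\varphi=\varphi$ and $\mathrm L^{-1}\mathrm L\varphi=\varphi$ for all $\varphi\in\mathcal S(\mathbb R^d)$; (4) $\mathcal N_{\boldsymbol p}=\mathcal N_{\mathrm L}:=\{p\in L_{\infty,\alpha}(\mathbb R^d):\mathrm L\{p\}=0\}$, where $\mathrm L$ is extended to $L_{\infty,\alpha}(\mathbb R^d)\to\mathcal S'(\mathbb R^d)$ by $\langle\mathrm Lf,\varphi\rangle=\langle f,\mathrm L^\ast\varphi\rangle$, $\varphi\in\mathcal S(\mathbb R^d)$. Universal biorthogonal system: a pair $(\boldsymbol\phi,\boldsymbol p)$, $\boldsymbol p=(p_1,\dots,p_{N_0})$ a basis of $\mathcal N_{\mathrm L}$, $\boldsymbol\phi=(\phi_1,\dots,\phi_{N_0})\in\mathcal S(\mathbb R^d)^{N_0}$, with $\langle\phi_m,p_n\rangle=\delta_{m,n}$. Put $\mathcal N_{\boldsymbol\phi}=\mathrm{span}\{\phi_n\}$, $\boldsymbol p(g)=(\langle p_1,g\rangle,\dots,\langle p_{N_0},g\rangle)$, $\boldsymbol\phi(f)=(\langle\phi_1,f\rangle,\dots,\langle\phi_{N_0},f\rangle)$; norm $\mathcal N_{\boldsymbol\phi}$ by $\|\boldsymbol p(\phi)\|_2$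 and $\mathcal N_{\boldsymbol p}$ by $\|\boldsymbol\phi(p)\|_2$. Define on $L_{1,-\alpha}(\mathbb R^d)$ $$\mathrm{Proj}_{\mathcal N_{\boldsymbol\phi}}\{g\}=\sum_{n=1}^{N_0}\langle p_n,g\rangle\phi_n,\qquad \mathrm L_{\boldsymbol\phi}^{-1\ast}=\mathrm L^{-1\ast}(\mathrm{Id}-\mathrm{Proj}_{\mathcal N_{\boldsymbol\phi}}):L_{1,-\alpha}(\mathbb R^d)\to L_{\infty,\alpha}(\mathbb R^d).$$ Compatibility: $(\mathrm L,\mathcal Y)$, with $\mathcal Y$ a Banach subspace of $\mathcal S'(\mathbb R^d)$, is compatible if (1) $\mathcal Y=\mathcal X'$ for some Schwartz-Banach space $\mathcal X$; (2) $\mathrm L$ is spline-admissible with order $\alpha$; (3) $\mathrm L^\ast$ is (extends to) a continuous and injective operator $\mathcal X\to\mathcal S'(\mathbb R^d)$; (4) ($\mathcal X$-stability) there is a universal biorthogonal system $(\boldsymbol\phi,\boldsymbol p)$ of $\mathcal N_{\mathrm L}$ such that $\mathrm L_{\boldsymbol\phi}^{-1\ast}$ maps $L_{1,-\alpha}(\mathbb R^d)\to\mathcal X$ continuously. This system is fixed. Pre-native space: $\mathcal X_{\mathrm L}$ is the completion of $\mathcal P_{\mathrm L}=\{\mathrm L^\ast\varphi+\phi:\varphi\in\mathcal S(\mathbb R^d),\ \phi\in\mathcal N_{\boldsymbol\phi}\}\subseteq L_{1,-\alpha}(\mathbb R^d)$ in the norm $\|g\|_{\mathcal X_{\mathrm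 L}}=\max\big(\|\mathrm L_{\boldsymbol\phi}^{-1\ast}g\|_{\mathcal X},\|\boldsymbol p(\mathrm{Proj}_{\mathcal N_{\boldsymbol\phi}}\{g\})\|_2\big)$. It is identified with the Schwartz-Banach space $\mathrm L^\ast(\mathcal X)\oplus\mathcal N_{\boldsymbol\phi}$ (norm of $\mathrm L^\ast v+\phi$ equal to $\max(\|v\|_{\mathcal X},\|\boldsymbol p(\phi)\|_2)$), and $\mathrm L_{\boldsymbol\phi}^{-1\ast}$, $\mathrm{Proj}_{\mathcal N_{\boldsymbol\phi}}$ are extended by continuity to $\mathcal X_{\mathrm L}\to\mathcal X$ and $\mathcal X_{\mathrm L}\to\mathcal N_{\boldsymbol\phi}$. $\mathcal U=\mathrm L^\ast(\mathcal X)$ has norm $\|\mathrm L^\ast v\|_{\mathcal U}=\|v\|_{\mathcal X}$. The dual $\mathcal X'_{\mathrm L}$ is viewed in $\mathcal S'(\mathbb R^d)$; $\mathcal U'$ is identified with the functionals in $\mathcal X'_{\mathrm L}$ vanishing on $\mathcal N_{\boldsymbol\phi}$, and $\mathcal N_{\boldsymbol\phi}'$ with $\mathcal N_{\boldsymbol p}$ (the elements $p_n$ acting on $\mathcal X_{\mathrm L}$ by their continuous extensions). $\mathrm L:\mathcal X'_{\mathrm L}\to\mathcal X'$ is the adjoint of $\mathrm L^\ast:\mathcal X\to\mathcal X_{\mathrm L}$, and $\mathrm{Proj}_{\mathcal N_{\boldsymbol p}}$ is the adjoint of $\mathrm{Proj}_{\mathcal N_{\boldsymbol\phi}}:\mathcal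 X_{\mathrm L}\to\mathcal X_{\mathrm L}$. *)

(* Defs.v *)
From HB Require Import structures.
From mathcomp Require Import all_boot all_order all_algebra generic_quotient ring_quotient.
From mathcomp Require Import all_classical all_reals all_analysis measurable_realfun ess_sup_inf.
Set Implicit Arguments.
Unset Strict Implicit.
Unset Printing Implicit Defensive.
Import Order.TTheory GRing.Theory Num.Theory.
Import numFieldNormedType.Exports numFieldTopology.Exports.
Local Open Scope classical_set_scope.
Local Open Scope ring_scope.

Lemma ae_eq_Lnorm d (T : measurableType d) (R : realType)
    (mu : {measure set T -> \bar R}) p (f g : T -> \bar R) :
  measurable_fun setT f -> measurable_fun setT g ->
  f = g %[ae mu] -> Lnorm mu p f = Lnorm mu p g.
Proof.
move=> mf mg fg; rewrite unlock; case: p => [r| |] /=.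
- have mp (h : T -> \bar R) : measurable_fun setT h ->
    measurable_fun setT (fun x => (`|h x| `^ r)%E).
    move=> mh; apply: (@measurableT_comp _ _ _ _ _ _ (fun x => (x `^ r)%E)).
      exact: measurable_poweR.
    exact: measurableT_comp.
  congr (_ `^ _)%E; apply: ge0_ae_eq_integral => //; try exact: mp.
  - by move=> x _; exact: poweR_ge0.
  - by move=> x _; exact: poweR_ge0.
  - by apply: filterS fg => x /[apply] ->.
- case: ifPn => // _; apply: eq_ess_sup.
  by apply: filterS fg => x /(_ Logic.I) /= ->.
- case: ifPn => // _; apply: eq_ess_inf.
  by apply: filterS fg => x /(_ Logic.I) /= ->.
Qed.

Definition rV_display : measure_display.
Proof. exact: default_measure_display. Qed.

Section borel_rV.
Context (R : realType) (d : nat).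

Definition rV_coord (i : 'I_d) (x : 'rV[R]_d) : measurableTypeR R := x ord0 i.

Let rV_set0 : g_sigma_preimage rV_coord set0.
Proof. exact: sigma_algebra0. Qed.

Let rV_setC A : g_sigma_preimage rV_coord A -> g_sigma_preimage rV_coord (~` A).
Proof. exact: sigma_algebraC. Qed.

Let rV_bigcup (F : _^nat) : (forall i, g_sigma_preimage rV_coord (F i)) ->
  g_sigma_preimage rV_coord (\bigcup_i (F i)).
Proof. exact: sigma_algebra_bigcup. Qed.

(* Borel sets of R^d, generated by the coordinates. *)
HB.instance Definition _ := @isMeasurable.Build rV_display
  'rV[R]_d (g_sigma_preimage rV_coord) rV_set0 rV_setC rV_bigcup.

Lemma measurable_rV_coord i : measurable_fun setT (rV_coord i).
Proof.
move=> _ Y mY; rewrite setTI; apply: sub_sigma_algebra => /=.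
rewrite -bigcup_seq/=; exists i => /=; first by rewrite mem_index_enum.
by exists Y => //; rewrite setTI.
Qed.

Lemma measurable_rVP d1 (T : measurableType d1) (f : T -> 'rV[R]_d) :
  (forall i, measurable_fun setT (rV_coord i \o f)) -> measurable_fun setT f.
Proof.
move=> mf.
suff : g_sigma_preimage (fun i => rV_coord i \o f) `<=` measurable.
  rewrite g_sigma_preimage_comp => prefS _ A mA.
  by apply: prefS; exists A.
apply: smallest_sub; first exact: sigma_algebra_measurable.
by rewrite -bigcup_seq; apply: bigcup_sub => i _ A [B mB <-]; exact: mf.
Qed.

End borel_rV.

Section lebesgue_rV.
Context (R : realType).

Definition rV_cons d (z : measurableTypeR R * 'rV[R]_d) : 'rV[R]_d.+1 :=
  row_mx (z.1)%:M z.2 : 'rV_(1 + d).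

Lemma measurable_rV_cons d : measurable_fun setT (@rV_cons d).
Proof.
apply: measurable_rVP => i.
case: (split_ordP (i : 'I_(1 + d))) => j ->.
  rewrite (_ : _ \o _ = fst); first exact: measurable_fst.
  apply/funext => z /=; rewrite /rV_coord /rV_cons [LHS](row_mxEl (z.1)%:M z.2).
  by rewrite mxE (ord1 j) eqxx mulr1n.
rewrite (_ : _ \o _ = rV_coord j \o snd).
  by apply: measurableT_comp => //; exact: measurable_rV_coord.
by apply/funext => z /=; rewrite /rV_coord /rV_cons [LHS](row_mxEr (z.1)%:M z.2).
Qed.

Section step.
Context (d : nat) (mu : {sigma_finite_measure set 'rV[R]_d -> \bar R}).

Definition lebesgue_rVS : set 'rV[R]_d.+1 -> \bar R :=
  pushforward (lebesgue_measure \x mu)%E (@rV_cons d).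

Let lebesgue_rVS0 : lebesgue_rVS set0 = 0%E.
Proof. by rewrite /lebesgue_rVS /pushforward preimage_set0 measure0. Qed.

Let lebesgue_rVS_ge0 A : (0 <= lebesgue_rVS A)%E.
Proof. by rewrite /lebesgue_rVS /pushforward measure_ge0. Qed.

Let lebesgue_rVS_sigma_additive : semi_sigma_additive lebesgue_rVS.
Proof.
move=> F mF tF mUF; rewrite /lebesgue_rVS /pushforward preimage_bigcup.
apply: measure_semi_sigma_additive.
- by move=> n; rewrite -[X in measurable X]setTI; exact: measurable_rV_cons.
- by apply/trivIsetP => i j _ _ ij; rewrite -preimage_setI;
    move/trivIsetP : tF => /(_ i j Logic.I Logic.I ij) ->; rewrite preimage_set0.
- rewrite -preimage_bigcup -[X in measurable X]setTI.
  exact: measurable_rV_cons.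
Qed.

HB.instance Definition _ := isMeasure.Build _ _ _ lebesgue_rVS
  lebesgue_rVS0 lebesgue_rVS_ge0 lebesgue_rVS_sigma_additive.

Let lebesgue_rVS_sigma_finite : sigma_finite setT lebesgue_rVS.
Proof.
have /sigma_finiteP[F [FT ndF mF]] := sigma_finiteT (@lebesgue_measure R).
have /sigma_finiteP[G [GT ndG mG]] := sigma_finiteT mu.
pose h (x : 'rV[R]_d.+1) : measurableTypeR R * 'rV[R]_d :=
  (x ord0 ord0, rsubmx (x : 'rV[R]_(1 + d))).
have hK : cancel (@rV_cons d) h.
  case=> a v; rewrite /h /rV_cons /= row_mxKr; congr pair.
  have -> : (ord0 : 'I_d.+1) = lshift d (ord0 : 'I_1) by exact/val_inj.
  by rewrite [LHS](row_mxEl a%:M v) mxE eqxx mulr1n.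
have mh : measurable_fun setT h.
  apply: measurable_fun_pair => /=; first exact: (@measurable_rV_coord R d.+1 ord0).
  apply: measurable_rVP => i.
  rewrite (_ : _ \o _ = @rV_coord R d.+1 (rshift 1 i)); first exact: measurable_rV_coord.
  by apply/funext => x /=; rewrite /rV_coord mxE.
exists (fun n => h @^-1` (F n `*` G n)).
  apply/esym; rewrite -preimage_bigcup -subTset => x _.
  have [m _ Fm] : (\bigcup_n F n) (h x).1 by rewrite -FT.
  have [n _ Gn] : (\bigcup_n G n) (h x).2 by rewrite -GT.
  exists (maxn m n) => //; split.
    by have /subsetPset := ndF _ _ (leq_maxl m n); apply.
  by have /subsetPset := ndG _ _ (leq_maxr m n); apply.
move=> n; have [mFn Fny] := mF n; have [mGn Gny] := mG n; split.
  by rewrite -[X in measurable X]setTI; apply: mh => //; exact: measurableX.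
rewrite /lebesgue_rVS /pushforward -comp_preimage.
rewrite (_ : h \o _ = id) ?preimage_id; last by rewrite funeqE => z; exact: hK.
by rewrite product_measure1E// lte_mul_pinfty// ge0_fin_numE.
Qed.

HB.instance Definition _ := Measure_isSigmaFinite.Build _ _ _ lebesgue_rVS
  lebesgue_rVS_sigma_finite.
End step.

(* Lebesgue measure on R^d, by the identification R^(d+1) = R * R^d. *)
Fixpoint lebesgue_rV (d : nat) : {sigma_finite_measure set 'rV[R]_d -> \bar R} :=
  if d is d'.+1 then lebesgue_rVS (lebesgue_rV d') else dirac (0 : 'rV[R]_0).

End lebesgue_rV.

Section schwartz.
Context (R : realType) (d : nat).
Local Notation E := 'rV[R]_d.

(* The norm carried by 'rV[R]_d in the library is the sup norm; the weights use
   the Euclidean one. *)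
Definition enorm (x : E) : R := Num.sqrt (\sum_(i < d) x ord0 i ^+ 2).

Definition pderiv (s : seq 'I_d) (f : E -> R) : E -> R :=
  foldr (fun i g => 'D_(delta_mx ord0 i) g) f s.

(* Differentiability of all iterated partial derivatives is C^oo smoothness. *)
Definition is_schwartz (f : E -> R) :=
  (forall s x, differentiable (pderiv s f) x) /\
  (forall k s, exists M, forall x, (1 + enorm x) ^+ k * `|pderiv s f x| <= M).

Definition schwartz_pred : {pred E -> R} := [pred f | `[< is_schwartz f >]].

Lemma pderiv0 s : pderiv s (0 : E -> R) = 0.
Proof.
elim: s => //= i s ->; apply/funext => x.
exact: (@derive_cst _ _ _ 0).
Qed.

Lemma pderivD s a (f g : E -> R) :
  (forall s x, differentiable (pderiv s f) x) ->
  (forall s x, differentiable (pderiv s g) x) ->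
  pderiv s (a *: f + g) = a *: pderiv s f + pderiv s g.
Proof.
move=> df dg; elim: s => //= i s ->; apply/funext => x.
have hf := diff_derivable (v := delta_mx ord0 i) (df s x).
have hg := diff_derivable (v := delta_mx ord0 i) (dg s x).
by rewrite deriveD ?deriveZ//; exact: derivableZ.
Qed.

Lemma enorm_ge0 x : 0 <= enorm x. Proof. exact: sqrtr_ge0. Qed.

Lemma schwartz_submod_closed : submod_closed schwartz_pred.
Proof.
split.
  apply/asboolP; split => [s x|k s]; first by rewrite pderiv0; exact: differentiable_cst.
  by exists 0 => x; rewrite pderiv0 normr0 mulr0.
move=> a f g /asboolP[df bf] /asboolP[dg bg]; apply/asboolP; split => [s x|k s].
  rewrite pderivD//; apply: differentiableD; last exact: dg.
  by apply: differentiableZ; exact: df.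
have [M fM] := bf k s; have [N gN] := bg k s.
exists (`|a| * M + N) => x; rewrite pderivD//=.
rewrite (le_trans (ler_wpM2l _ (ler_normD _ _)))//.
  by rewrite exprn_ge0// addr_ge0// enorm_ge0.
rewrite mulrDr lerD// normrM mulrCA.
by rewrite ler_wpM2l.
Qed.

HB.instance Definition _ := GRing.isSubmodClosed.Build _ _ schwartz_pred
  schwartz_submod_closed.

Record schwartz := Schwartz {
  schwartz_fun :> E -> R ; _ : schwartz_fun \in schwartz_pred }.

HB.instance Definition _ := [isSub for schwartz_fun].
HB.instance Definition _ := [Choice of schwartz by <:].
HB.instance Definition _ := [SubChoice_isSubLmodule of schwartz by <:].

(* The initial topology for this map is the Frechet topology of the seminorms
   sup_x (1 + |x|)^k |D^s f(x)|. *)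
Definition schwartz_jet (f : schwartz) :
    prod_topology (fun _ : nat * seq 'I_d => {uniform E -> R}) :=
  fun ks x => (1 + enorm x) ^+ ks.1 * pderiv ks.2 f x.

HB.instance Definition _ := Topological.copy schwartz (initial_topology schwartz_jet).

End schwartz.

Section cdual.
Context (R : realType) (E : preTopologicalLmodType R).

Definition cdual_pred : {pred E -> R} :=
  [pred f | `[< linear (f : E -> R^o) /\ continuous (f : E -> R) >]].

Lemma cdual_submod_closed : submod_closed cdual_pred.
Proof.
split.
  apply/asboolP; split => [a x y|]; last exact: cst_continuous.
  by rewrite scaler0 addr0.
move=> a f g /asboolP[lf cf] /asboolP[lg cg]; apply/asboolP; split.
  move=> b x y; rewrite !fctE lf lg.
  by rewrite !scalerDr addrACA !scalerA (mulrC a b).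
move=> x; apply: cvgD; last exact: cg.
by apply: cvgZr; exact: cf.
Qed.

HB.instance Definition _ := GRing.isSubmodClosed.Build _ _ cdual_pred
  cdual_submod_closed.

Record cdual := CDual { cdual_fun :> E -> R ; _ : cdual_fun \in cdual_pred }.

HB.instance Definition _ := [isSub for cdual_fun].
HB.instance Definition _ := [Choice of cdual by <:].
HB.instance Definition _ := [SubChoice_isSubLmodule of cdual by <:].

Lemma cdual_linear (f : cdual) : linear (f : E -> R^o).
Proof. by case: f => f /= /asboolP[]. Qed.

Lemma cdual_continuous (f : cdual) : continuous (f : E -> R).
Proof. by case: f => f /= /asboolP[]. Qed.

HB.instance Definition _ (f : cdual) :=
  GRing.isLinear.Build R E R^o *:%R (cdual_fun f) (cdual_linear f).
End cdual.

(* Tempered distributions, with the weak-* topology. *)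
Definition tempered (R : realType) (d : nat) := cdual (schwartz R d).
HB.instance Definition _ (R : realType) (d : nat) :=
  GRing.Lmodule.on (tempered R d).
HB.instance Definition _ (R : realType) (d : nat) :=
  Topological.copy (tempered R d)
    (initial_topology (fun f : tempered R d => (f : {ptws schwartz R d -> R}))).

Section ndual.
Context (R : realType) (X : normedModType R).

(* Dual of a normed space, with the operator norm. *)
Definition ndual := cdual X.

HB.instance Definition _ := GRing.Lmodule.on ndual.

Definition ndual_norm (f : ndual) : R :=
  sup [set `|cdual_fun f x| | x in [set x : X | `|x| <= 1]].

Let S (f : ndual) := [set `|cdual_fun f x| | x in [set x : X | `|x| <= 1]].

Let S_sup f : has_sup (S f).
Proof.
split; first by exists `|cdual_fun f 0|, 0 => //=; rewrite normr0.
pose g : {linear X -> R^o} := cdual_fun f.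
have /linear_boundedP[M [Mr fM]] :=
  @continuous_linear_bounded _ _ _ 0 g (@cdual_continuous R X f 0).
pose N := `|M| + 1.
have /fM {}fM : M < N by rewrite ltr_pwDr// ler_norm.
have N0 : 0 <= N by rewrite addr_ge0.
exists N => _ [x /= x1 <-]; rewrite (le_trans (fM x))//.
by rewrite ler_piMr.
Qed.

Let norm_ub f x : `|x| <= 1 -> `|cdual_fun f x| <= ndual_norm f.
Proof. by move=> x1; apply: ub_le_sup; [exact: (S_sup f).2|exists x]. Qed.

Let norm_le f c : (forall x, `|x| <= 1 -> `|cdual_fun f x| <= c) -> ndual_norm f <= c.
Proof.
move=> fc; apply: ge_sup; first exact: (S_sup f).1.
by move=> _ [x x1 <-]; exact: fc.
Qed.

Let ndual_normD f g : ndual_norm (f + g) <= ndual_norm f + ndual_norm g.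
Proof.
apply: norm_le => x x1.
by rewrite (le_trans (ler_normD _ _))// lerD// norm_ub.
Qed.

Let ndual_normZ (a : R) f : ndual_norm (a *: f) = `|a| * ndual_norm f.
Proof.
have le b h : ndual_norm (b *: h) <= `|b| * ndual_norm h.
  apply: norm_le => x x1.
  by rewrite [X in X <= _]normrM ler_wpM2l// norm_ub.
apply/eqP; rewrite eq_le le/=.
have [->|a0] := eqVneq a 0.
  rewrite normr0 mul0r.
  by rewrite (le_trans (normr_ge0 (cdual_fun (0 *: f) 0)))// norm_ub// normr0.
rewrite -ler_pdivlMl ?normr_gt0// -normfV.
by rewrite -[in leLHS](scalerK a0 f).
Qed.

Let ndual_norm0_eq0 f : ndual_norm f = 0 -> f = 0.
Proof.
move=> f0; apply/val_inj/funext => x /=.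
have [->|x0] := eqVneq x 0; first exact: (linear0 (cdual_fun f)).
have nx0 : `|x| != 0 by rewrite normr_eq0.
have : `|cdual_fun f (`|x|^-1 *: x)| <= 0.
  by rewrite -f0 norm_ub// normrZ normfV normr_id mulVf.
rewrite linearZ/= normr_le0 mulf_eq0 invr_eq0 (negbTE nx0)/=.
by move=> /eqP.
Qed.

HB.instance Definition _ := Lmodule_isNormed.Build R ndual
  ndual_normD ndual_normZ ndual_norm0_eq0.

End ndual.

(* The space L_{p,a}(R^d): a.e.-classes of measurable f such that
   (1 + |x|)^(-a) f(x) is in L^p, normed by the L^p norm of that product. *)
Section weighted_Lp.
Context (R : realType) (d : nat) (p : \bar R) (p1 : (1 <= p)%E) (a : R).
Local Notation E := 'rV[R]_d.
Local Notation mu := (lebesgue_rV R d).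

Definition wt (x : E) : R := (1 + enorm x) `^ (- a).

Lemma wt_gt0 x : 0 < wt x.
Proof. by rewrite powR_gt0// ltr_pwDl// enorm_ge0. Qed.

Lemma measurable_wt : measurable_fun setT wt.
Proof.
apply: (@measurableT_comp _ _ _ _ _ _ (@powR R ^~ (- a))) => //.
apply: measurable_funD => //.
apply: (@measurableT_comp _ _ _ _ _ _ (@Num.sqrt R)).
  by apply: continuous_measurable_fun; exact: sqrt_continuous.
apply: measurable_sum => i; apply: measurable_funX.
exact: measurable_rV_coord.
Qed.

Definition wLfun_pred : {pred E -> R} :=
  [pred f | (f \in mfun) && ((fun x => wt x * f x) \in Lfun mu p)].

Lemma wLfun_submod_closed : submod_closed wLfun_pred.
Proof.
split.
  apply/andP; split; first exact: rpred0.
  rewrite (_ : (fun _ => _) = (0 : E -> R)); first exact: (Lfun_submod_closed mu p1).1.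
  by apply/funext => x; rewrite mulr0.
move=> b f g /andP[mf lf] /andP[mg lg]; apply/andP; split.
  by rewrite rpredD// rpredZ.
rewrite (_ : (fun _ => _) = b *: (fun x => wt x * f x) + (fun x => wt x * g x)).
  exact: (Lfun_submod_closed mu p1).2.
by apply/funext => x; rewrite !fctE mulrDr [in RHS]/GRing.scale/= mulrCA.
Qed.

HB.instance Definition _ := GRing.isSubmodClosed.Build _ _ wLfun_pred
  wLfun_submod_closed.

Record wLfun := WLfun { wLfun_fun :> E -> R ; _ : wLfun_fun \in wLfun_pred }.

HB.instance Definition _ := [isSub for wLfun_fun].
HB.instance Definition _ := [Choice of wLfun by <:].
HB.instance Definition _ := [SubChoice_isSubLmodule of wLfun by <:].

Definition wLnull : {pred wLfun} := [pred f : wLfun | `[< wLfun_fun f = cst 0 %[ae mu] >]].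

Lemma wLnull_submod_closed : submod_closed wLnull.
Proof.
split; first by apply/asboolP; exact: ae_eq_refl.
move=> b f g /asboolP f0 /asboolP g0; apply/asboolP.
apply: filterS2 f0 g0 => x f0 g0 xT /=.
by rewrite !fctE f0// g0// [X in X + _]mulr0 addr0.
Qed.

HB.instance Definition _ := GRing.isSubmodClosed.Build _ _ wLnull
  wLnull_submod_closed.

Local Open Scope quotient_scope.

Definition wLp := Quotient.quot wLnull.

HB.instance Definition _ := GRing.Zmodule.on wLp.
HB.instance Definition _ := EqQuotient.on wLp.

Definition wLp_fun (f : wLp) : E -> R := wLfun_fun (repr f).

Lemma wLp_eqP (f g : wLfun) :
  (\pi_wLp f = \pi_wLp g) <-> wLfun_fun f = wLfun_fun g %[ae mu].
Proof.
have E1 : (\pi_wLp f = \pi_wLp g) <-> (f - g \in wLnull).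
  by rewrite (rwP eqP) -Quotient.idealrBE.
rewrite E1; split => [/asboolP|] fg; last apply/asboolP.
  by apply: filterS fg => x /[apply] /= /eqP; rewrite !fctE subr_eq0 => /eqP.
by apply: filterS fg => x /[apply] /= fgx; rewrite !fctE fgx subrr.
Qed.

Lemma wLp_reprK (f : wLfun) : wLp_fun (\pi_wLp f) = wLfun_fun f %[ae mu].
Proof. by apply/wLp_eqP; rewrite reprK. Qed.

Lemma wLp_eq (f g : wLp) : wLp_fun f = wLp_fun g %[ae mu] -> f = g.
Proof. by move=> /wLp_eqP; rewrite !reprK. Qed.

Definition wLp_scale (b : R) (f : wLp) : wLp := \pi_wLp (b *: repr f).

Let scaleE b f : wLp_scale b (\pi_wLp f) = \pi_wLp (b *: f).
Proof.
apply/wLp_eqP; apply: filterS (wLp_reprK f) => x /[apply] /= fx.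
exact: (congr1 ( *%R b) fx).
Qed.

Let addE f g : \pi_wLp f + \pi_wLp g = \pi_wLp (f + g).
Proof. by apply: esym; exact: (Quotient.pi_add wLnull f g). Qed.

Let wLp_scalerA b c f : wLp_scale b (wLp_scale c f) = wLp_scale (b * c) f.
Proof. by rewrite -(reprK f); move: (repr f) => {}f; rewrite (scaleE c) !scaleE scalerA. Qed.

Let wLp_scale1r : left_id 1 wLp_scale.
Proof. by move=> f; rewrite -(reprK f); move: (repr f) => {}f; rewrite scaleE scale1r. Qed.

Let wLp_scalerDr : right_distributive wLp_scale +%R.
Proof. by move=> b f g; rewrite -(reprK f) -(reprK g); move: (repr f) (repr g) => {}f {}g; rewrite addE !scaleE scalerDr addE. Qed.

Let wLp_scalerDl f : {morph wLp_scale^~ f : b c / b + c}.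
Proof. by move=> b c; rewrite -(reprK f); move: (repr f) => {}f; rewrite !scaleE scalerDl addE. Qed.

HB.instance Definition _ := GRing.Zmodule_isLmodule.Build R wLp
  wLp_scalerA wLp_scale1r wLp_scalerDr wLp_scalerDl.

Lemma wLp_piD f g : \pi_wLp (f + g) = \pi_wLp f + \pi_wLp g.
Proof. by rewrite addE. Qed.

Lemma wLp_piZ b f : \pi_wLp (b *: f) = b *: \pi_wLp f.
Proof. by rewrite -scaleE. Qed.

Definition wLfun_norm (f : E -> R) : R :=
  fine 'N[mu]_p[EFin \o (fun x => wt x * f x)].

Definition wLp_norm (f : wLp) : R := wLfun_norm (wLp_fun f).

Let Lfun_wt (f : wLfun) : (fun x => wt x * f x) \in Lfun mu p.
Proof. by case: f => f /= /andP[]. Qed.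

Let normE (f : wLfun) : wLp_norm (\pi_wLp f) = wLfun_norm f.
Proof.
rewrite /wLp_norm /wLfun_norm.
have := wLp_reprK f; rewrite /wLp_fun; move: (repr _) => g gf.
have mw (h : wLfun) : measurable_fun setT (fun x => wt x * h x).
  by have /andP[] := Lfun_wt h; rewrite inE.
congr fine; apply: ae_eq_Lnorm; [exact/measurable_EFinP|exact/measurable_EFinP|].
by apply: filterS gf => x /[apply] /= ->.
Qed.

Let normD (f g : wLp) : wLp_norm (f + g) <= wLp_norm f + wLp_norm g.
Proof.
rewrite -(reprK f) -(reprK g); move: (repr f) (repr g) => {}f {}g; rewrite -wLp_piD !normE.
have := @ler_LnormD _ _ _ mu p p1 (Lfun_Sub p1 (Lfun_wt f))
  (Lfun_Sub p1 (Lfun_wt g)).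
apply: le_trans; rewrite le_eqVlt; apply/orP; left; apply/eqP.
by congr (fine _); apply: eq_Lnorm => x /=; rewrite mulrDr.
Qed.

Let normZ b (f : wLp) : wLp_norm (b *: f) = `|b| * wLp_norm f.
Proof.
rewrite -(reprK f); move: (repr f) => {}f; rewrite -wLp_piZ !normE.
have := LnormZ (Lfun_Sub p1 (Lfun_wt f)) b.
rewrite -(finite_norm_fine (Lfun_Sub p1 (Lfun_wt f))) => /(congr1 fine) /= <-.
congr (fine _); apply: eq_Lnorm => x /=.
by rewrite [in RHS]/GRing.scale/= mulrCA.
Qed.

Let norm0_eq0 (f : wLp) : wLp_norm f = 0 -> f = 0.
Proof.
move=> f0; apply: wLp_eq.
have /(@fine_Lnormr_eq0 _ _ _ mu p p1 (Lfun_Sub p1 (Lfun_wt (repr f)))) : wLp_norm f = 0 by [].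
move=> wf0.
have z0 : wLp_fun 0 = cst 0 %[ae mu].
  have -> : (0 : wLp) = \pi_wLp 0 by rewrite -[0 in LHS](scale0r 0) -[in LHS](reprK 0) -wLp_piZ scale0r.
  exact: wLp_reprK.
apply: filterS2 wf0 z0 => x + /[swap] xT /(_ xT) ->.
move=> /(_ xT)/= /eqP; rewrite mulf_eq0 gt_eqF ?wt_gt0//= => /eqP.
exact.
Qed.

HB.instance Definition _ := Lmodule_isNormed.Build R wLp normD normZ norm0_eq0.

(* The class of f; 0 when f is not measurable or its norm is infinite. *)
Definition to_wLp (f : E -> R) : wLp := \pi_wLp (insubd (0 : wLfun) f).

End weighted_Lp.

Section adjoint.
Context (R : realType) (E F : preTopologicalLmodType R).
Variables (A : {linear E -> F}) (cA : continuous A).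

Lemma adjoint_subproof (w : cdual F) : (fun x => w (A x)) \in @cdual_pred R E.
Proof.
apply/asboolP; split => [a x y|x]; first by rewrite !linearP.
by apply: continuous_comp; [exact: cA|exact: cdual_continuous].
Qed.

Definition adjoint (w : cdual F) : cdual E := CDual (adjoint_subproof w).

Lemma adjoint_linear : linear adjoint.
Proof. by move=> a v w; apply/val_inj. Qed.

HB.instance Definition _ :=
  GRing.isLinear.Build R (cdual F) (cdual E) *:%R adjoint adjoint_linear.

End adjoint.

Section linear_algebra.
Context (R : realType).

Definition span_of (V : lmodType R) n (e : 'I_n -> V) : set V :=
  [set \sum_(i < n) c i *: e i | c in [set: 'I_n -> R]].

Definition is_basis (V : lmodType R) n (e : 'I_n -> V) (A : set V) : Prop :=
  (forall c : 'I_n -> R, \sum_(i < n) c i *: e i = 0 -> forall i, c i = 0) /\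
  A = span_of e.

Definition direct_sum (V : lmodType R) (A B : set V) : Prop :=
  forall x, exists! ab : V * V, [/\ A ab.1, B ab.2 & x = ab.1 + ab.2].

Definition norm2 n (c : 'I_n -> R) : R := Num.sqrt (\sum_(i < n) c i ^+ 2).

Definition reflexive_space (V : normedModType R) : Prop :=
  forall Phi : ndual (ndual V), exists x : V, forall w : ndual V, Phi w = w x.

End linear_algebra.

Coercion wLp_fun : wLp >-> Funclass.

(* 'L1_(R, d, a) is L_{1,-a}(R^d), the predual of 'Loo_(R, d, a) = L_{oo,a}(R^d). *)
Notation "''L1_' ( R , d , a )" := (@wLp R d 1%:E (@lexx _ _ 1%:E) (- a))
  (at level 8, format "''L1_' ( R ,  d ,  a )").
Notation "''Loo_' ( R , d , a )" := (@wLp R d +oo%E (leey 1%:E) a)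
  (at level 8, format "''Loo_' ( R ,  d ,  a )").

Section distributions.
Context (R : realType) (d : nat).

Definition pairing (f g : 'rV[R]_d -> R) : R :=
  \int[lebesgue_rV R d]_x (f x * g x).

Definition represents (T : tempered R d) (f : 'rV[R]_d -> R) : Prop :=
  forall phi : schwartz R d, T phi = pairing f phi.

(* A Banach space X with S <= X <= S'; both inclusions are explicit linear maps,
   and sb_inK says that their composite is the canonical inclusion of S in S'. *)
Record schwartz_banach := SchwartzBanach {
  sb_space :> completeNormedModType R ;
  sb_emb : {linear sb_space -> tempered R d} ;
  sb_emb_inj : injective sb_emb ;
  sb_emb_continuous : continuous sb_emb ;
  sb_emb_dense : dense (range sb_emb) ;
  sb_in : {linear schwartz R d -> sb_space} ;
  sb_in_continuous : continuous sb_in ;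
  sb_in_dense : dense (range sb_in) ;
  sb_inK : forall phi, represents (sb_emb (sb_in phi)) phi }.

(* X' as a space of tempered distributions. *)
Definition dual_restrict (X : schwartz_banach) (w : ndual X) : tempered R d :=
  adjoint (@sb_in_continuous X) w.

Section operators.
Variables (L : {linear schwartz R d -> tempered R d}) (a : R).
Local Notation S := (schwartz R d).
Local Notation S' := (tempered R d).
Local Notation L1 := 'L1_(R, d, a).
Local Notation Loo := 'Loo_(R, d, a).

(* Null space of the extension of L to L_{oo,a}: <L f, phi> = <f, L^* phi>. *)
Definition null_space (Lstar1 : S -> L1) : set Loo :=
  [set f : Loo | forall phi : S, pairing f (wLp_fun (Lstar1 phi)) = 0].

(* sa_L1 and sa_Lstar1 are L and L^* seen as maps into L_{1,-a}. *)
Record spline_admissible := SplineAdmissible {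
  sa_Lstar : {linear S -> S'} ;
  sa_LstarE : forall phi psi, L phi psi = sa_Lstar psi phi ;
  sa_L1 : {linear S -> L1} ;
  sa_L1E : forall phi, represents (L phi) (wLp_fun (sa_L1 phi)) ;
  sa_L1_continuous : continuous sa_L1 ;
  sa_Lstar1 : {linear S -> L1} ;
  sa_Lstar1E : forall phi, represents (sa_Lstar phi) (wLp_fun (sa_Lstar1 phi)) ;
  sa_Lstar1_continuous : continuous sa_Lstar1 ;
  sa_Linv : {linear L1 -> Loo} ;
  sa_Linv_continuous : continuous sa_Linv ;
  sa_Linvstar : {linear L1 -> Loo} ;
  sa_Linvstar_continuous : continuous sa_Linvstar ;
  sa_LinvstarE : forall f g : L1, pairing (wLp_fun (sa_Linv f)) g = pairing f (wLp_fun (sa_Linvstar g)) ;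
  sa_LinvK : forall phi, sa_Linv (sa_L1 phi) = to_wLp _ _ phi ;
  sa_LinvstarK : forall phi, sa_Linvstar (sa_Lstar1 phi) = to_wLp _ _ phi ;
  sa_dim : nat ;
  sa_null : 'I_sa_dim -> Loo ;
  sa_nullP : is_basis sa_null (null_space sa_Lstar1) }.

Record biorthogonal_system (H : spline_admissible) := BiorthogonalSystem {
  bs_p : 'I_(sa_dim H) -> Loo ;
  bs_phi : 'I_(sa_dim H) -> S ;
  bs_p_basis : is_basis bs_p (null_space (sa_Lstar1 H)) ;
  bs_biorth : forall m n, pairing (bs_phi m) (bs_p n) = (m == n)%:R }.

Definition Proj_phi (H : spline_admissible) (B : biorthogonal_system H)
    (g : L1) : S :=
  \sum_(n < sa_dim H) pairing (bs_p B n) g *: bs_phi B n.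

Definition Linvstar_phi (H : spline_admissible) (B : biorthogonal_system H)
    (g : L1) : Loo :=
  sa_Linvstar H (g - to_wLp _ _ (Proj_phi B g)).

Record compatible (X : schwartz_banach) := Compatible {
  cp_sa : spline_admissible ;
  cp_Lstar : {linear X -> S'} ;
  cp_Lstar_ext : forall phi : S, cp_Lstar (sb_in X phi) = sa_Lstar cp_sa phi ;
  cp_Lstar_continuous : continuous cp_Lstar ;
  cp_Lstar_inj : injective cp_Lstar ;
  cp_bs : biorthogonal_system cp_sa ;
  cp_stable : {linear L1 -> X} ;
  cp_stable_continuous : continuous cp_stable ;
  cp_stableE : forall g, represents (sb_emb X (cp_stable g)) (Linvstar_phi cp_bs g) }.

Section prenative.
Variables (X : schwartz_banach) (C : compatible X).
Local Notation N0 := (sa_dim (cp_sa C)).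
Local Notation p := (bs_p (cp_bs C)).
Local Notation phi := (bs_phi (cp_bs C)).

Definition pvec (g : 'rV[R]_d -> R) : 'I_N0 -> R := fun n => pairing (p n) g.

Definition P_L : set L1 :=
  [set sa_Lstar1 (cp_sa C) psi + to_wLp _ _ u | psi in [set: S] & u in span_of phi].

Definition prenative_norm (g : L1) : R :=
  Num.max `|cp_stable C g| (norm2 (pvec (Proj_phi (cp_bs C) g))).

(* XL is the completion of (P_L, prenative_norm), realized as a Schwartz-Banach
   space: the elements of P_L are found in XL with their norm, and are dense. *)
Definition is_prenative (XL : schwartz_banach) : Prop :=
  (forall g, P_L g ->
    exists x : XL, represents (sb_emb XL x) g /\ `|x| = prenative_norm g) /\
  dense [set x : XL | exists2 g, P_L g & represents (sb_emb XL x) g].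

(* no_Lstar is L^* : X -> XL; the other operators are the continuous extensions
   from P_L to XL of L_phi^{-1*}, Proj_{N_phi} and the functionals <p_n, .>.
   Each is uniquely determined. *)
Record native_operators (XL : schwartz_banach) := NativeOperators {
  no_Lstar : {linear X -> XL} ;
  no_Lstar_continuous : continuous no_Lstar ;
  no_LstarE : forall v, sb_emb XL (no_Lstar v) = cp_Lstar C v ;
  no_Linvstar : {linear XL -> X} ;
  no_Linvstar_continuous : continuous no_Linvstar ;
  no_LinvstarE : forall x g, P_L g -> represents (sb_emb XL x) g ->
    no_Linvstar x = cp_stable C g ;
  no_Proj : {linear XL -> XL} ;
  no_Proj_continuous : continuous no_Proj ;
  no_ProjE : forall x g, P_L g -> represents (sb_emb XL x) g ->
    no_Proj x = sb_in XL (Proj_phi (cp_bs C) g) ;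
  no_p : 'I_N0 -> ndual XL ;
  no_pE : forall n x g, P_L g -> represents (sb_emb XL x) g ->
    no_p n x = pairing (p n) g }.

Variables (XL : schwartz_banach) (O : native_operators XL).

Definition native_L : {linear ndual XL -> ndual X} :=
  adjoint (@no_Lstar_continuous XL O).

Definition native_Linv : {linear ndual X -> ndual XL} :=
  adjoint (@no_Linvstar_continuous XL O).

Definition native_Proj : {linear ndual XL -> ndual XL} :=
  adjoint (@no_Proj_continuous XL O).

Definition phivec (f : ndual XL) : 'I_N0 -> R := fun n => f (sb_in XL (phi n)).

Definition N_phi : set XL := span_of (fun n => sb_in XL (phi n)).

Definition N_p : set (ndual XL) := span_of (no_p O).

(* U' as a subspace of the dual of XL. *)
Definition U_dual : set (ndual XL) :=
  [set f | forall u : XL, N_phi u -> f u = 0].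

End prenative.
End operators.
End distributions.
Arguments N_phi {R d L a X} C XL.
Arguments U_dual {R d L a X} C XL.
Arguments phivec {R d L a X} C {XL} f n.

(* Main.v *)
Require Import Defs.
From HB Require Import structures.
From mathcomp Require Import all_boot all_order all_algebra generic_quotient ring_quotient.
From mathcomp Require Import all_classical all_reals all_analysis measurable_realfun ess_sup_inf.
From mathcomp Require Import ring lra.
Set Implicit Arguments.
Unset Strict Implicit.
Unset Printing Implicit Defensive.
Import Order.TTheory GRing.Theory Num.Theory.
Import numFieldNormedType.Exports numFieldTopology.Exports.
Local Open Scope classical_set_scope.
Local Open Scope ring_scope.

(* Every x in X_L is x = L^* v + phi with v = L_phi^{-1*} x and phi = Proj x, and
   |x| = max(|v|, |p(phi)|): this holds on the dense subspace P_L by definition of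
   the norm and passes to the completion.  Dualizing this max-decomposition yields
   the decomposition of X_L' with the sum norm (the lower bound comes from testing
   against L^* v + phi with |v| <= 1 and |p(phi)| <= 1).

   For the embeddings, g |-> L^*(L_phi^{-1*} g) + Proj g maps L_{1,-a} continuously
   into X_L and agrees there with the identity of S': both sides are the same on
   P_L, and P_L is total in L_{1,-a} because a function of L_{oo,a} annihilating it
   lies in N_L and is orthogonal to phi.  Transposing this map and using that L_{oo,a}
   is the dual of L_{1,-a} embeds X_L' in L_{oo,a}.  Continuity of S -> X_L' is a
   uniform boundedness (Baire) argument on X_L.  Reflexivity passes from X to X_L, hence to
   X_L', and density of S in X_L' then follows from Hahn-Banach. *)


(** * Hahn-Banach and duals of normed spaces *)

(** Two weak hypotheses shape the proof. The inclusion of a Schwartz-Banach space in S' is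
    continuous only for the weak-* topology, so each test function gives a bounded functional on
    X_L, but without uniformity in the test function; Baire supplies one neighbourhood of 0 in S
    that serves the whole space. Likewise L^* on X is known only as a continuous extension from S,
    so L^* L_phi^{-1*} g = g - Proj g cannot be computed directly for general g in L_{1,-a}. Fixing
    a test function turns both sides into continuous functionals of g, hence into functions of
    L_{oo,a}, and these are compared on P_L. So every bounded functional on L_{1,-a} must be a
    function of L_{oo,a}, and such a function must be determined by Schwartz test functions. The
    former comes from Radon-Nikodym: multiplying indicators by a fixed positive element of L_{1,-a}
    turns a functional into a finite charge. The latter comes from products of logistic functions,
    which converge pointwise to indicators of orthants. *)

Section hahn_banach.
Context (R : realType) (V : normedModType R).

(* [G] is the graph of a partial linear functional dominated by the norm;
   univaluedness follows from the domination. *)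
Definition dominated_graph (G : set (V * R^o)) : Prop :=
  (forall (a : R) u v, G u -> G v -> G (a *: u + v)) /\
  (forall u, G u -> u.2 <= `|u.1|).

(** The admissible values at [x1] are those between all [u.2 - |u.1 - x1|] and all
    [|v.1 + x1| - v.2]. Domination at u + v and the triangle inequality make this interval nonempty,
    and c is its left end. A general multiple t of [x1] reduces to t = 1 or t = -1 by
    homogeneity. *)
Lemma dominated_graph_extend (G : set (V * R^o)) (x1 : V) :
  dominated_graph G -> G 0 ->
  exists c : R, dominated_graph
    [set z : V * R^o | exists u (t : R), G u /\ z = u + t *: (x1, c : R^o)].
Proof.
move=> [lG dG] G0.
pose A := [set u.2 - `|u.1 - x1| | u in G].
have AB u v : G u -> G v -> u.2 - `|u.1 - x1| <= `|v.1 + x1| - v.2.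
  move=> Gu Gv; have := dG _ (lG 1 u v Gu Gv); rewrite scale1r /= => uv.
  rewrite lerBlDr addrAC lerBrDr (le_trans uv)// addrC.
  by rewrite (le_trans _ (ler_normD _ _))// addrACA addNr addr0 addrC.
have A0 : A !=set0 by exists (0 - `|0 - x1|), 0.
have ubA v : G v -> ubound A (`|v.1 + x1| - v.2).
  by move=> Gv _ [u Gu <-]; exact: AB.
pose c := sup A.
have cl u : G u -> u.2 - `|u.1 - x1| <= c.
  by move=> Gu; apply: ub_le_sup; [exists (`|0 + x1| - 0); exact: (ubA 0)|exists u].
have cr v : G v -> c <= `|v.1 + x1| - v.2 by move=> Gv; apply: ge_sup => //; exact: ubA.
exists c; split.
  move=> a _ _ [u [t [Gu ->]]] [v [s [Gv ->]]].
  exists (a *: u + v), (a * t + s); split; first exact: lG.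
  by rewrite scalerDr scalerDl scalerA addrACA.
move=> _ [u [t [Gu ->]]] /=.
have GZ b : G (b *: u) by rewrite -[_ *: _]addr0; exact: lG.
have [t0|t0|->] := ltgtP t 0; last by rewrite !scale0r !addr0; exact: dG.
- have := cl _ (GZ (- t)^-1); rewrite /= => h.
  have {}h : (- t) * ((- t)^-1 *: u.2 - `|(- t)^-1 *: u.1 - x1|) <= (- t) * c.
    by rewrite ler_wpM2l// oppr_ge0 ltW.
  have t0' : 0 < - t by rewrite oppr_gt0.
  move: h; rewrite mulrBr [X in X - _]mulrA mulfV ?gt_eqF// mul1r.
  rewrite -[X in X * `|_|](gtr0_norm t0') -normrZ scalerBr scalerA mulfV ?gt_eqF//.
  rewrite scale1r scaleNr opprK mulNr => h.
  by move: h; rewrite lerBlDr [X in _ <= X]addrC lerBrDr.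
- have := cr _ (GZ t^-1); rewrite /= => h.
  have {}h : t * c <= t * (`|t^-1 *: u.1 + x1| - (t^-1 *: u.2)).
    by rewrite ler_wpM2l// ltW.
  move: h; rewrite mulrBr [X in _ - X]mulrA mulfV ?gt_eqF// mul1r.
  rewrite -[X in X * `|_|](gtr0_norm t0) -normrZ scalerDr scalerA mulfV ?gt_eqF//.
  by rewrite scale1r lerBrDl.
Qed.

Lemma hahn_banach (G0 : set (V * R^o)) : dominated_graph G0 -> G0 0 ->
  exists f : ndual V, forall u, G0 u -> f u.1 = u.2.
Proof.
move=> dG0 G00.
(* Zorn is also applied to the empty chain, whose union is empty; joining [G0] inside P keeps that
   case valid. The same case explains the extra member [set0] of F' below. *)
pose P (A : set (V * R^o)) := dominated_graph (A `|` G0).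
have [A [PA maxA]] : exists A, P A /\ forall B, A `<` B -> ~ P B.
  apply: Zorn_bigcup => F FP tF; split.
  - move=> a u v; pose F' X := F X \/ X = set0.
    have F'P X : F' X -> P X by move=> [/FP//|->]; rewrite /P set0U.
    have tF' X Y : F' X -> F' Y -> (X `<=` Y) \/ (Y `<=` X).
      move=> [FX|->]; last by left.
      by move=> [FY|->]; [exact: tF|right].
    have h w : ((\bigcup_(X in F) X) `|` G0) w -> exists X, F' X /\ (X `|` G0) w.
      case=> [[X FX Xw]|]; first by exists X; split; [left|left].
      by exists set0; split; [right|right].
    move=> /h[X [FX Xu]] /h[Y [FY Yv]].
    have [Z [FZ Zu Zv]] : exists Z, [/\ F' Z, (Z `|` G0) u & (Z `|` G0) v].
      case: (tF' _ _ FX FY) => XY; [exists Y|exists X]; split => //.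
        exact: setSU Xu.
      exact: setSU Yv.
    have [/(_ a _ _ Zu Zv)[Za|G0a] _] := F'P _ FZ; last by right.
    left; case: FZ => [FZ|Z0]; last by rewrite Z0 in Za.
    by exists Z.
  - move=> u [[X FX Xu]|G0u]; last exact: dG0.2.
    by apply: (FP _ FX).2; left.
set G := A `|` G0 in PA.
have {}PA : dominated_graph G by [].
have GA0 : G 0 by right.
have total x : exists r, G (x, r).
  apply: contrapT => nx.
  have [c dG'] := dominated_graph_extend x PA GA0.
  set G' := (X in dominated_graph X) in dG'.
  have GG' : G `<=` G' by move=> u Gu; exists u, 0; rewrite scale0r addr0.
  have G'x : G' (x, c) by exists 0, 1; rewrite scale1r add0r.
  apply: (maxA G').
    split; first by move=> u Au; apply: GG'; left.
    by move=> /(_ _ G'x) Ax; apply: nx; exists c; left.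
  by rewrite /P setUidl// => u G0u; apply: GG'; right.
have le0 r : G (0, r) -> r <= 0 by move=> /PA.2; rewrite /= normr0.
have GZ b u : G u -> G (b *: u) by move=> Gu; rewrite -[_ *: _]addr0; exact: PA.1.
have uniq x r s : G (x, r) -> G (x, s) -> r = s.
  have w r' s' : G (x, r') -> G (x, s') -> r' <= s'.
    move=> Gr Gs; rewrite -subr_le0; apply: le0.
    have := PA.1 (-1) _ _ Gs Gr.
    suff -> : (-1) *: (x, s' : R^o) + (x, r' : R^o) = (0, r' - s') by [].
    by congr pair; rewrite /= scaleN1r addrC ?subrr.
  by move=> Gr Gs; apply/eqP; rewrite eq_le !w.
have [f Gf] := choice total.
have lf : linear (f : V -> R^o).
  move=> b x y; apply: (uniq (b *: x + y)); first exact: Gf.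
  exact: (PA.1 b _ _ (Gf x) (Gf y)).
pose lfT : {linear V -> R^o} := HB.pack f (GRing.isLinear.Build _ _ _ _ _ lf).
have nf x : `|f x| <= `|x|.
  rewrite ler_norml (PA.2 _ (Gf x)) andbT lerNl -normrN.
  rewrite (_ : - f x = f (- x)); first exact: (PA.2 _ (Gf (- x))).
  by rewrite -[f]/(lfT : V -> R) linearN.
have cf : continuous (f : V -> R).
  apply: (@bounded_linear_continuous _ _ _ lfT).
  apply/linear_boundedP; exists 1; split; first exact: num_real.
  move=> M M1 x; rewrite (le_trans (nf x))// ler_peMl//; exact: ltW.
have cP : f \in @cdual_pred R V by apply/asboolP.
by exists (CDual cP) => -[x r] G0x /=; apply: (uniq x) => //; right.
Qed.

(** Extend the functional t x0 + w |-> t e, where e > 0 bounds from below the distance from x0 to W.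
    For t > 0 its domination by the norm is e <= |x0 - w'| with w' = - w / t; for t <= 0 it is a
    matter of sign. *)
Lemma hahn_banach_separation (W : set V) (x0 : V) :
  W 0 -> (forall (b : R) u v, W u -> W v -> W (b *: u + v)) ->
  ~ closure W x0 ->
  exists2 f : ndual V, f x0 != 0 & forall w, W w -> f w = 0.
Proof.
move=> W0 lW nW.
have [e e0 We] : exists2 e : R, 0 < e & forall w, W w -> e <= `|x0 - w|.
  apply: contrapT => ne; apply: nW => B /nbhs_ballP[e /= e0 eB].
  apply: contrapT => WB; apply: ne; exists e => // w Ww.
  rewrite leNgt; apply/negP => xw; apply: WB; exists w; split => //; apply: eB.
  by rewrite -ball_normE.
have WZ b w : W w -> W (b *: w) by move=> Ww; rewrite -[_ *: _]addr0; exact: lW.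
pose G0 := [set z : V * R^o | exists t w, W w /\ z = (t *: x0 + w, t * e)].
have [||f fG] := @hahn_banach G0.
- split.
    move=> b _ _ [t [w [Ww ->]]] [s [v [Wv ->]]].
    exists (b * t + s), (b *: w + v); split; first exact: lW.
    congr pair => /=; first by rewrite scalerDr scalerDl scalerA addrACA.
    by rewrite mulrDl -mulrA.
  move=> _ [t [w [Ww ->]]] /=.
  have [t0|t0|->] := ltgtP t 0.
  - by rewrite (le_trans _ (normr_ge0 _))// nmulr_rle0// ltW.
  - have := We _ (WZ (- t^-1) _ Ww); rewrite -(ler_pM2l t0) => /le_trans; apply.
    rewrite -[X in X * _](gtr0_norm t0) -normrZ scalerBr scaleNr scalerN opprK scalerA mulfV ?gt_eqF//.
    by rewrite scale1r.
  - by rewrite mul0r.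
- by exists 0, 0; split => //; rewrite scale0r addr0 mul0r.
exists f.
  have /fG/= -> : G0 (x0, e) by exists 1, 0; rewrite scale1r addr0 mul1r.
  by rewrite gt_eqF.
move=> w Ww; have /fG//= : G0 (w, 0).
by exists 0, w; split => //; rewrite scale0r add0r mul0r.
Qed.
End hahn_banach.

(** * Extension and comparison of continuous maps on dense subspaces *)

Section dense_extension.
Context (R : realType).

Lemma dense_normP (V : normedModType R) (D : set V) :
  dense D <-> forall x (e : R), 0 < e -> exists2 u, D u & `|x - u| < e.
Proof.
split=> [dD x e e0|h O [x Ox] oO].
  have [||u [xu Du]] := dD (ball x e).
  - by exists x; exact: ballxx.
  - exact: ball_open.
  - by exists u => //; move: xu; rewrite -ball_normE.
move: oO; rewrite openE => /(_ _ Ox)/nbhs_ballP[e /= e0 eO].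
have [u Du xu] := h x e e0.
by exists u; split => //; apply: eO; rewrite -ball_normE.
Qed.

Lemma dense_eqfun (V : topologicalType) (D : set V) (f g : V -> R) :
  dense D -> continuous f -> continuous g -> (forall u, D u -> f u = g u) -> f =1 g.
Proof.
move=> dD cf cg fg x; apply/eqP; rewrite -subr_eq0; apply: contrapT => /negP fx.
have cfg : continuous (fun y => f y - g y).
  by move=> y; apply: continuousB; [exact: cf|exact: cg].
have oO : open ((fun y => f y - g y) @^-1` [set z | z != 0]).
  by move/continuousP : cfg; apply; exact: open_neq.
have [|u [/= + Du]] := dD _ _ oO; first by exists x.
by rewrite fg// subrr eqxx.
Qed.

Lemma linear_lipschitz_continuous (V W : normedModType R) (f : {linear V -> W}) (c : R) :
  (forall x, `|f x| <= c * `|x|) -> continuous f.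
Proof.
move=> fc; apply: bounded_linear_continuous; apply/linear_boundedP.
exists `|c|; split; first exact: num_real.
move=> M M1 x; rewrite (le_trans (fc x))// ler_wpM2r// (le_trans _ (ltW M1))//.
exact: ler_norm.
Qed.

Lemma continuous_linear_lipschitz (V W : normedModType R) (f : {linear V -> W}) :
  continuous f -> exists2 c : R, 0 < c & forall x, `|f x| <= c * `|x|.
Proof.
move=> cf; have /linear_boundedP[M [Mr fM]] :=
  @continuous_linear_bounded _ _ _ 0 f (cf 0).
exists (`|M| + 1); first by rewrite ltr_wpDl.
by apply: fM; rewrite ltr_pwDr// ler_norm.
Qed.

(** The value at x is the limit of [T0] along the points of D close to x; the Lipschitz bound makes
    this filter Cauchy. *)
Lemma dense_extension (V : normedModType R) (W : completeNormedModType R)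
    (D : set V) (T0 : V -> W) (c : R) :
  dense D -> (forall (b : R) u v, D u -> D v -> D (b *: u + v)) ->
  (forall (b : R) u v, D u -> D v -> T0 (b *: u + v) = b *: T0 u + T0 v) ->
  (forall u, D u -> `|T0 u| <= c * `|u|) ->
  exists T : {linear V -> W}, continuous T /\ forall u, D u -> T u = T0 u.
Proof.
move=> /dense_normP dD lD lT bT.
have DB u v : D u -> D v -> D (u - v).
  by move=> Du Dv; rewrite addrC -scaleN1r; exact: lD.
have TB u v : D u -> D v -> T0 (u - v) = T0 u - T0 v.
  by move=> Du Dv; rewrite addrC -scaleN1r lT// scaleN1r addrC.
(* The given c may be zero or negative, while the estimates below divide by the constant. *)
pose C : R := `|c| + 1.
have C0 : 0 < C by rewrite ltr_wpDl.
have bT' u : D u -> `|T0 u| <= C * `|u|.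
  move=> Du; rewrite (le_trans (bT _ Du))// ler_wpM2r//.
  by rewrite (le_trans (ler_norm c))// lerDl.
(* The pair (x, w) is in the closure of the graph of [T0] on D. Linearity and the norm bound pass to
   this closure, and the bound makes it univalued. *)
pose P x w := forall e : R, 0 < e -> exists u, [/\ D u, `|x - u| < e & `|w - T0 u| < e].
have exP x : exists w, P x w.
  pose F := T0 @ within D (nbhs x).
  have FF : ProperFilter F.
    apply: fmap_proper_filter; apply: Build_ProperFilter_ex => A /nbhs_ballP[e /= e0 eA].
    have [u Du xu] := dD x e e0; exists u; apply: eA => //.
    by rewrite -ball_normE.
  have Fc : cauchy F.
    apply: cauchy_exP => e e0; pose d := e / (2 * C).
    have d0 : 0 < d by rewrite divr_gt0// mulr_gt0.
    have [u Du xu] := dD x d d0; exists (T0 u).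
    apply/nbhs_ballP; exists d => //= v.
    rewrite -ball_normE /= => xv Dv.
    rewrite -ball_normE /= -TB// (le_lt_trans (bT' _ (DB _ _ Du Dv)))//.
    have -> : e = C * (2 * d) by rewrite /d; field; rewrite gt_eqF.
    rewrite ltr_pM2l// mulr_natl mulr2n (le_lt_trans (ler_distD x _ _))//.
    by rewrite distrC ltrD.
  have Fl : F --> lim F := @cauchy_cvg W F FF Fc.
  exists (lim F) => e e0.
  have [/(_ Fl e e0)/nbhs_ballP[r /= r0 rP] _] := @cvgrPdist_lt _ _ _ (within D (nbhs x)) _ T0 (lim F).
  have re0 : 0 < Num.min r e by rewrite lt_min r0.
  have [u Du] := dD x _ re0.
  rewrite lt_min => /andP[xr xe]; exists u; split => //.
  by apply: rP => //; rewrite -ball_normE.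
have PD u : D u -> P u (T0 u).
  by move=> Du e e0; exists u; rewrite !subrr !normr0.
have lP b x y v w : P x v -> P y w -> P (b *: x + y) (b *: v + w).
  move=> Pv Pw e e0; pose d := e / (`|b| + 1).
  have b1 : 0 < `|b| + 1 by rewrite ltr_wpDl.
  have d0 : 0 < d by rewrite divr_gt0.
  have ed : `|b| * d + d = e by rewrite /d; field; rewrite gt_eqF.
  have [p [Dp xp vp]] := Pv _ d0; have [q [Dq yq wq]] := Pw _ d0.
  exists (b *: p + q); split; first exact: lD.
    rewrite opprD addrACA -scalerBr (le_lt_trans (ler_normD _ _))//.
    by rewrite normrZ -ed ler_ltD// ler_wpM2l// ltW.
  rewrite lT// opprD addrACA -scalerBr (le_lt_trans (ler_normD _ _))//.
  by rewrite normrZ -ed ler_ltD// ler_wpM2l// ltW.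
have nP x w : P x w -> `|w| <= C * `|x|.
  move=> Pw; apply/ler_addgt0Pr => e e0; pose d := e / (C + 1).
  have C1 : 0 < C + 1 by rewrite ltr_wpDl// ltW.
  have d0 : 0 < d by rewrite divr_gt0.
  have ed : C * d + d = e by rewrite /d; field; rewrite gt_eqF.
  have [u [Du xu wu]] := Pw _ d0.
  have nu : `|u| <= `|x| + d.
    by rewrite -[X in `|X| <= _](subKr x u) (le_trans (ler_normB _ _))// lerD2l ltW.
  rewrite -[w](subrK (T0 u)) (le_trans (ler_normD _ _))//.
  have h : `|T0 u| <= C * `|x| + C * d.
    by rewrite (le_trans (bT' _ Du))// -mulrDr ler_pM2l.
  by rewrite -ed [leRHS]addrA [leLHS]addrC lerD// ltW.
have uP x v w : P x v -> P x w -> v = w.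
  move=> Pv Pw; have := nP _ _ (lP (-1) _ _ _ _ Pv Pw).
  by rewrite !scaleN1r addNr normr0 mulr0 normr_le0 addrC subr_eq0 => /eqP.
have [T PT] := choice exP.
have lTT : linear T by move=> b x y; apply: uP (PT _) _; exact: lP.
pose TT : {linear V -> W} := HB.pack T (GRing.isLinear.Build _ _ _ _ _ lTT).
exists TT; split; last by move=> u Du; apply: uP (PT _) _; exact: PD.
by apply: (@linear_lipschitz_continuous _ _ TT C) => x; exact: nP.
Qed.
End dense_extension.

(** * The operator norm of the dual and its completeness *)

Section ndual_theory.
Context (R : realType) (X : normedModType R).

Lemma ndual_norm_has_sup (f : ndual X) :
  has_sup [set `|cdual_fun f x| | x in [set x : X | `|x| <= 1]].
Proof.
split; first by exists `|cdual_fun f 0|, 0 => //=; rewrite normr0.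
have [c c0 fc] := @continuous_linear_lipschitz R X R^o f (@cdual_continuous R X f).
exists c => _ [x /= x1 <-]; rewrite (le_trans (fc x))//.
by rewrite ler_piMr// ltW.
Qed.

Lemma ndual_ler_norm (f : ndual X) x : `|f x| <= `|f| * `|x|.
Proof.
have [->|x0] := eqVneq x 0; first by rewrite linear0 !normr0 mulr0.
have nx0 : 0 < `|x| by rewrite normr_gt0.
rewrite -ler_pdivrMr// mulrC.
have -> : `|x|^-1 * `|f x| = `|f (`|x|^-1 *: x)|.
  by rewrite linearZ [RHS]normrM gtr0_norm// invr_gt0.
apply: ub_le_sup; first exact: (ndual_norm_has_sup f).2.
by eexists; last by []; rewrite /= normrZ normfV normr_id mulVf// gt_eqF.
Qed.

Lemma ndual_norm_le (f : ndual X) (c : R) : 0 <= c ->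
  (forall x, `|f x| <= c * `|x|) -> `|f| <= c.
Proof.
move=> c0 fc; apply: ge_sup; first exact: (ndual_norm_has_sup f).1.
by move=> _ [x /= x1 <-]; rewrite (le_trans (fc x))// ler_piMr.
Qed.

Lemma ndual_norm_approx (f : ndual X) (e : R) : 0 < e ->
  exists2 x, `|x| <= 1 & `|f| - e < f x.
Proof.
move=> e0; have [_ [x /= x1 <-] xe] := sup_adherent e0 (ndual_norm_has_sup f).
have [fx|fx] := leP 0 (f x); first by exists x => //; rewrite -(ger0_norm fx).
exists (- x); first by rewrite normrN.
by rewrite linearN -[X in _ < X](gtr0_norm (_ : 0 < - f x)) ?oppr_gt0// normrN.
Qed.

Lemma mk_ndual (f : X -> R) (c : R) : linear (f : X -> R^o) ->
  (forall x, `|f x| <= c * `|x|) -> exists g : ndual X, forall x, g x = f x.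
Proof.
move=> lf fc.
pose F : {linear X -> R^o} := HB.pack f (GRing.isLinear.Build _ _ _ _ _ lf).
have cF := @linear_lipschitz_continuous _ _ _ F c fc.
have fP : f \in @cdual_pred R X by apply/asboolP.
by exists (CDual fP).
Qed.

Lemma ndual_complete (F : set_system (ndual X)) :
  ProperFilter F -> cauchy F -> cvg F.
Proof.
move=> FF Fc.
have {}Fc (e : R) : 0 < e -> exists g : ndual X, F [set h | `|g - h| < e].
  move=> e0; have [_] := @cauchyP R (ndual X) F FF; have [+ _] := @cauchyP R (ndual X) F FF.
  move=> /(_ Fc) /(_ e e0)[g Fg] _; exists g; apply: filterS Fg => h.
  by rewrite -ball_normE.
pose Fx x := (fun f : ndual X => f x : R) @ F.
have PFx x : ProperFilter (Fx x) by exact: fmap_proper_filter.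
have cx x : Fx x --> lim (Fx x).
  apply: cauchy_cvg; apply: cauchy_exP => e e0.
  have e1 : 0 < e / (`|x| + 1) by rewrite divr_gt0// ltr_wpDl.
  have [g Fg] := Fc _ e1; exists (g x); rewrite /Fx /=.
  apply: filterS Fg => h /= gh; rewrite -ball_normE /=.
  rewrite (le_lt_trans (ndual_ler_norm (g - h) x))//.
  have [->|x0] := eqVneq x 0; first by rewrite normr0 mulr0.
  rewrite (@lt_trans _ _ (e / (`|x| + 1) * `|x|))//.
    by rewrite ltr_pM2r// normr_gt0.
  by rewrite mulrAC ltr_pdivrMr ?ltr_wpDl// ltr_pM2l// ltrDl.
pose l x := lim (Fx x).
(* The Cauchy estimate survives the pointwise limit with a constant independent of x; it yields both
   the boundedness of l and the convergence in norm. *)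
have ln (g : ndual X) (e : R) : F [set h | `|g - h| < e] -> forall x, `|g x - l x| <= e * `|x|.
  move=> Fg x.
  have : (fun f : ndual X => `|g x - f x|) @ F --> `|g x - l x|.
    by apply: cvg_norm; apply: cvgB; [exact: cvg_cst|exact: cx].
  move=> h; apply: (cvgr_to_le h); apply: filterS Fg => f /= gf.
  rewrite (le_trans (ndual_ler_norm (g - f) x))// ler_wpM2r//; exact: ltW.
have ll : linear (l : X -> R^o).
  move=> b x y; apply: (@cvg_lim R^o) => //.
  have -> : (fun f : ndual X => f (b *: x + y) : R) = (fun f : ndual X => b * f x + f y).
    by apply/funext => f; rewrite linearP.
  apply: cvgD; last exact: cx.
  by apply: cvgZr; exact: cx.
have [g0 Fg0] := Fc _ ltr01.
have [g gl] : exists g : ndual X, forall x, g x = l x.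
  apply: (@mk_ndual _ (`|g0| + 1)) => // x.
  rewrite -[l x](subKr (g0 x)) (le_trans (ler_normB _ _))// mulrDl lerD//.
    exact: ndual_ler_norm.
  exact: ln.
apply/cvg_ex; exists g; apply/(@cvgrPdist_le _ (ndual X)) => e e0.
have e2 : 0 < e / 2 by rewrite divr_gt0.
have [h Fh] := Fc _ e2; apply: filterS (Fh) => f /= hf.
rewrite -[g](subrK h) -addrA (le_trans (ler_normD _ _))// [leRHS]splitr lerD//; last exact: ltW.
apply: ndual_norm_le => [|x]; first exact: ltW.
rewrite (_ : (g - h) x = g x - h x)// gl distrC; exact: ln Fh x.
Qed.
End ndual_theory.

(** * Weighted Lebesgue spaces on R^d *)

Section borel_rV_facts.
Context (R : realType).

(** The sigma-algebra is generated by the coordinates, so A is written as a countable union of boxes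
    with rational centres and radii 1/(n+1). Balls of row vectors are boxes, which makes these boxes
    a base. *)
Lemma open_measurable_rV (d : nat) (A : set 'rV[R]_d) : open A -> measurable A.
Proof.
move=> oA.
pose B (i : 'rV[rat]_d * nat) : set 'rV[R]_d :=
  \bigcap_(j in [set: 'I_d])
    (@rV_coord R d j @^-1` ball (ratr (i.1 ord0 j) : R) (i.2.+1%:R^-1)).
have mB i : measurable (B i).
  apply: fin_bigcap_measurable => // j _.
  rewrite -[X in measurable X]setTI; apply: measurable_rV_coord => //.
  by rewrite ball_itv; exact: measurable_itv.
(* Boxes that leave A are replaced by the empty set, so that the union runs over the whole countable
   index type. *)
have -> : A = \bigcup_i (if `[< B i `<=` A >] then B i else set0).
  apply/seteqP; split=> [x Ax|x [i _]]; last by case: asboolP => // BA /BA.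
  move: oA; rewrite openE => /(_ _ Ax)/nbhs_ballP[e /= e0 eA].
  (* Both x and any other point of the box are within 1/(n+1) of the rational centre, hence the
     factor 2. *)
  have [n ne] : exists n, n.+1%:R^-1 < e / 2.
    exists (Num.truncn (e / 2)^-1); rewrite -ltf_pV2 ?posrE ?invr_gt0 ?divr_gt0//.
    by rewrite invrK truncnS_gt.
  have /choice[q qP] : forall j : 'I_d, exists q : rat, ball (ratr q : R) n.+1%:R^-1 (x ord0 j).
    move=> j; have [||y [/= xr [q _ qr]]] := @dense_rat R (ball (x ord0 j) n.+1%:R^-1).
    - by exists (x ord0 j); apply: ballxx; rewrite invr_gt0.
    - exact: ball_open.
    - by exists q; rewrite qr; exact/ball_sym.
  exists (\row_j q j, n) => //.
  have Bx : B (\row_j q j, n) x by move=> j _; rewrite /= mxE; exact: qP.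
  case: asboolP => // nBA; exfalso; apply: nBA => y By; apply: eA; split=> // i j.
  rewrite (ord1 i).
  have := qP j; have := By j Logic.I; rewrite /rV_coord /= mxE -!ball_normE /= => yq xq.
  rewrite -(subrK (ratr (q j)) (x ord0 j)) -addrA (le_lt_trans (ler_normD _ _))//.
  rewrite [ltRHS]splitr ltrD// (lt_trans _ ne)//.
  by rewrite distrC.
apply: countable_bigcupT_measurable => [|i]; first exact: countableP.
by case: asboolP.
Qed.

Lemma continuous_measurable_rV (d : nat) (f : 'rV[R]_d -> R) :
  continuous f -> measurable_fun setT f.
Proof.
move=> /continuousP cf; apply: (measurability _ (RGenOpens.measurableE R)).
move=> _ [_ [x [y ->]] <-]; rewrite setTI; apply: open_measurable_rV.
by apply: cf; exact: interval_open.
Qed.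

Lemma measurable_rV_prod (d : nat) (h : 'I_d -> R -> R) :
  (forall i, measurable_fun setT (h i)) ->
  measurable_fun setT (fun x : 'rV[R]_d => \prod_(i < d) h i (x ord0 i)).
Proof.
move=> mh; apply: measurable_prod => i _.
apply: (@measurableT_comp _ _ _ _ _ _ (h i)) => //; exact: measurable_rV_coord.
Qed.

Local Open Scope ereal_scope.

(** Tonelli along R^(d+1) = R * R^d, the recursion that defines the measure. It gives both the
    finite integral of [rVbump] and the positive measure of boxes. *)
Lemma integral_rV_prod (d : nat) (k : 'I_d -> R -> R) :
  (forall i t, 0 <= k i t)%R -> (forall i, measurable_fun setT (k i)) ->
  \int[lebesgue_rV R d]_x ((\prod_(i < d) k i (x ord0 i))%R)%:E =
  \prod_(i < d) \int[@lebesgue_measure R]_t (k i t)%:E.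
Proof.
elim: d k => [|d IH] k k0 mk.
  rewrite big_ord0 /= integral_dirac//.
    by rewrite diracT mul1e big_ord0.
  apply/measurable_EFinP; rewrite (_ : (fun _ => _) = cst 1%R)//.
  by apply/funext => x; rewrite big_ord0.
rewrite [X in \int[X]_x _]/= ge0_integral_pushforward//=; last 3 first.
- exact: measurable_rV_cons.
- by apply/measurable_EFinP; exact: measurable_rV_prod.
- by move=> x _; rewrite lee_fin prodr_ge0.
rewrite preimage_setT.
have E z : (\prod_(i < d.+1) k i (rV_cons z ord0 i))%R =
    (k ord0 z.1 * \prod_(i < d) k (lift ord0 i) (z.2 ord0 i))%R.
  rewrite big_ord_recl; congr (_ * _)%R.
    congr (k _ _); rewrite /rV_cons (_ : ord0 = lshift d (ord0 : 'I_1)); last exact/val_inj.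
    by rewrite [LHS](row_mxEl (z.1)%:M z.2) mxE eqxx mulr1n.
  apply: eq_bigr => i _; congr (k _ _).
  rewrite /rV_cons (_ : lift ord0 i = rshift 1 i); last exact/val_inj.
  by rewrite [LHS](row_mxEr (z.1)%:M z.2).
under eq_integral do rewrite /= E EFinM.
rewrite (@fubini_tonelli1 _ _ _ _ _ _ _
   (fun z : measurableTypeR R * 'rV[R]_d => (k ord0 z.1)%:E *
   (\prod_(i < d) k (lift ord0 i) (z.2 ord0 i))%:E)); last 2 first.
- apply: emeasurable_funM; apply/measurable_EFinP.
    apply: (@measurableT_comp _ _ _ _ _ _ (k ord0 : measurableTypeR R -> R)); first exact: mk.
    exact: measurable_fst.
  apply: (@measurableT_comp _ _ _ _ _ _
    (fun x : 'rV[R]_d => \prod_(i < d) k (lift ord0 i) (x ord0 i))%R).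
    exact: (@measurable_rV_prod d (fun i => k (lift ord0 i))).
  exact: measurable_snd.
- by move=> z; rewrite mule_ge0// lee_fin ?prodr_ge0.
rewrite /fubini_F big_ord_recl /=.
under eq_integral => x _.
  rewrite ge0_integralZl//; last 3 first.
  - by apply/measurable_EFinP; exact: (@measurable_rV_prod d (fun i => k (lift ord0 i))).
  - by move=> y _; rewrite lee_fin prodr_ge0.
  - by rewrite lee_fin.
  rewrite (IH (fun i => k (lift ord0 i)))// muleC.
  over.
rewrite ge0_integralZl//; last 3 first.
- by apply/measurable_EFinP; exact: mk.
- by move=> x _; rewrite lee_fin.
- by apply: prode_ge0 => i _; apply: integral_ge0 => t _; rewrite lee_fin.
by rewrite muleC.
Qed.

(** A positive integrable reference function, of integral pi^d and of only polynomial decay: it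
    dominates weighted Schwartz functions and is the density of the finite measure behind the
    duality of L_{1,-a} and L_{oo,a}. *)
Definition rVbump (d : nat) (x : 'rV[R]_d) : R := (\prod_(i < d) (oneDsqr (x ord0 i))^-1)%R.

Lemma rVbump_gt0 d (x : 'rV[R]_d) : (0 < rVbump x)%R.
Proof. by apply: prodr_gt0 => i _; rewrite invr_gt0. Qed.

Lemma measurable_oneDsqrV : measurable_fun setT (fun t : R => (oneDsqr t)^-1)%R.
Proof. by apply: continuous_measurable_fun; exact: continuous_oneDsqrV. Qed.

Lemma measurable_rVbump d : measurable_fun setT (@rVbump d).
Proof.
apply: measurable_prod => i _.
apply: (@measurableT_comp _ _ _ _ _ _ (fun t : R => (oneDsqr t)^-1)%R).
  exact: measurable_oneDsqrV.
exact: measurable_rV_coord.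
Qed.

Lemma integral_rVbump_lty d : \int[lebesgue_rV R d]_x (rVbump x)%:E < +oo.
Proof.
rewrite /rVbump (integral_rV_prod (k := fun _ t => (oneDsqr t)^-1%R)); last 2 first.
- by move=> i t; rewrite invr_ge0 (le_trans _ (oneDsqr_ge1 t)).
- by move=> i; exact: measurable_oneDsqrV.
have h : \int[@lebesgue_measure R]_t ((oneDsqr t)^-1)%:E = pi%:E.
  rewrite ge0_symfun_integralT//; last 2 first.
  - exact: continuous_oneDsqrV.
  - by move=> x /=; rewrite /oneDsqr sqrrN.
  have -> : [set x : R | (0 <= x)%R] = `[0%R, +oo[%classic.
    by apply/seteqP; split => x /=; rewrite in_itv/= andbT.
  by rewrite integral0y_oneDsqr -EFinM mulrC divfK.
by under eq_bigr do rewrite h; rewrite prodEFin ltry.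
Qed.

Lemma integrable_rVbump d : (lebesgue_rV R d).-integrable setT (EFin \o @rVbump d).
Proof.
apply/integrableP; split; first by apply/measurable_EFinP; exact: measurable_rVbump.
under eq_integral do rewrite /= ger0_norm ?(ltW (rVbump_gt0 _))//.
exact: integral_rVbump_lty.
Qed.

Lemma open_gt0_rV (d : nat) (A : set 'rV[R]_d) : open A -> A !=set0 ->
  0 < lebesgue_rV R d A.
Proof.
move=> oA [x Ax]; have mA := open_measurable_rV oA.
move: oA; rewrite openE => /(_ _ Ax)/nbhs_ballP[e /= e0 eA].
pose I i := ball (x ord0 i) e : set R.
have mI i : measurable (I i : set (measurableTypeR R)).
  by rewrite /I ball_itv; exact: measurable_itv.
apply: (@lt_le_trans _ _ (\int[lebesgue_rV R d]_y (\prod_(i < d) \1_(I i) (y ord0 i))%R%:E)).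
  rewrite (integral_rV_prod (k := fun i => \1_(I i)))//; last first.
    by move=> i; exact: measurable_indic (mI i).
  have E i : \int[@lebesgue_measure R]_t (\1_(I i) t)%:E = (e + e)%:E.
    rewrite integral_indic; [|exact: measurableT|exact: (mI i)].
    by rewrite setIT -mulr2n; exact: (lebesgue_measure_ball _ (ltW e0)).
  rewrite (eq_bigr _ (fun i _ => E i)).
  by rewrite prodEFin lte_fin prodr_gt0// => i _; rewrite addr_gt0.
rewrite -(setIT A) -integral_indic//; apply: ge0_le_integral => //.
- by move=> y _; rewrite lee_fin prodr_ge0.
- apply/measurable_EFinP; apply: (@measurable_rV_prod _ (fun i => \1_(I i))) => i.
  exact: measurable_indic (mI i).
- by apply/measurable_EFinP; exact: measurable_indic.
move=> y _; rewrite lee_fin; have [yI|] := pselect (forall i, I i (y ord0 i)).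
  rewrite big1 => [|i _]; last by rewrite indicE mem_set.
  rewrite indicE mem_set//; apply: eA; split=> // i j; rewrite (ord1 i); exact: yI.
move=> /existsNP[i nI]; rewrite (bigD1 i)//= indicE memNset// mul0r.
by rewrite indicE.
Qed.

Lemma continuous_ae0 (d : nat) (f : 'rV[R]_d -> R) : continuous f ->
  {ae lebesgue_rV R d, forall x, f x = 0%R} -> f = cst 0%R.
Proof.
move=> cf f0; apply/funext => x; apply: contrapT => /eqP fx.
have oA : open (f @^-1` [set z | z != 0%R]) by move/continuousP: cf; apply; exact: open_neq.
have := open_gt0_rV oA (ex_intro _ x fx).
rewrite (_ : lebesgue_rV R d _ = 0) ?ltxx//.
have [N [mN N0 fN]] := f0.
apply: (subset_measure0 _ mN _ N0); first exact: open_measurable_rV.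
by move=> y /= /eqP fy; apply: fN.
Qed.

End borel_rV_facts.

(** * The pairing of L_{oo,a} with L_{1,-a}, and Schwartz functions in both spaces *)

Section weighted_spaces.
Context (R : realType) (d : nat).
Local Notation E := 'rV[R]_d.
Local Notation mu := (lebesgue_rV R d).

Lemma wt_mulN (a : R) (x : E) : wt a x * wt (- a) x = 1.
Proof.
have h : 0 < 1 + enorm x by rewrite ltr_pwDl// enorm_ge0.
by rewrite /wt -powRD opprK ?addNr ?powRr0 ?eqxx ?gt_eqF.
Qed.

Section wLp_facts.
Context (p : \bar R) (p1 : (1 <= p)%E) (a : R).
Local Notation V := (@wLp R d p p1 a).

Lemma measurable_wLp (f : V) : measurable_fun setT (wLp_fun f).
Proof.
rewrite /wLp_fun; case: (repr f) => g /= /andP[+ _].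
by rewrite inE.
Qed.

Lemma wLp_funE (f : E -> R) : f \in wLfun_pred p a ->
  wLp_fun (to_wLp p1 a f) = f %[ae mu].
Proof.
move=> fP; apply: ae_eq_trans (wLp_reprK p1 _) _.
have -> : wLfun_fun (insubd 0 f) = f := insubdK _ fP.
exact: ae_eq_refl.
Qed.

Lemma wLp_funP (b : R) (f g : V) :
  wLp_fun (b *: f + g) = (fun x => b * wLp_fun f x + wLp_fun g x) %[ae mu].
Proof.
have /(_ p1) := wLp_reprK p1 (b *: repr f + repr g).
by rewrite (wLp_piD (p1 := p1)) wLp_piZ !reprK.
Qed.

Lemma to_wLpP (b : R) (f g : E -> R) : f \in wLfun_pred p a -> g \in wLfun_pred p a ->
  to_wLp p1 a (b *: f + g) = b *: to_wLp p1 a f + to_wLp p1 a g.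
Proof.
move=> fP gP; apply: wLp_eq; apply: ae_eq_trans (ae_eq_sym (wLp_funP _ _ _)).
have fgP : b *: f + g \in wLfun_pred p a by exact: (wLfun_submod_closed d p1 a).2.
apply: ae_eq_trans (wLp_funE fgP) _.
have := wLp_funE fP; have := wLp_funE gP.
by apply: filterS2 => x gx fx xT; rewrite gx// fx.
Qed.

Lemma to_wLp0 : to_wLp p1 a 0 = 0 :> V.
Proof.
have P0 := (wLfun_submod_closed d p1 a).1.
by have := to_wLpP (-1) P0 P0; rewrite scaler0 addr0 scaleN1r addNr.
Qed.

Lemma wLp_fun0 : wLp_fun (0 : V) = cst 0 %[ae mu].
Proof. by rewrite -to_wLp0; exact: wLp_funE (wLfun_submod_closed d p1 a).1. Qed.
End wLp_facts.

Section duality_pairing.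
Context (a : R).
Local Notation L1 := 'L1_(R, d, a).
Local Notation Loo := 'Loo_(R, d, a).

Lemma L1_fun_integrable (g : L1) : mu.-integrable setT (fun x => (wt (- a) x * g x)%:E).
Proof.
rewrite /wLp_fun; case: (repr g) => h /= /andP[_ hL].
exact/Lfun1_integrable.
Qed.

Lemma L1_normE (g : L1) : `|g|%:E = (\int[mu]_x `|wt (- a) x * g x|%:E)%E.
Proof.
rewrite [in LHS]/Num.norm/= /wLp_norm /wLfun_norm Lnorm1 fineK//.
have /integrableP[_ h] := L1_fun_integrable g.
by rewrite ge0_fin_numE// integral_ge0.
Qed.

Lemma mem_L1 (g : E -> R) : measurable_fun setT g ->
  mu.-integrable setT (fun x => (wt (- a) x * g x)%:E) -> g \in wLfun_pred 1%:E (- a).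
Proof.
move=> mg ig; apply/andP; split; first by rewrite inE.
by apply/Lfun1_integrable.
Qed.

Lemma mem_Loo (f : E -> R) (M : R) : measurable_fun setT f ->
  {ae mu, forall x, `|wt a x * f x| <= M} -> f \in wLfun_pred +oo%E a.
Proof.
move=> mf fM; apply/andP; split; first by rewrite inE.
apply/andP; rewrite !inE; split.
  by rewrite /=; apply: measurable_funM => //; exact: measurable_wt.
rewrite /= /finite_norm unlock /=; case: ifPn => // _.
apply: le_lt_trans (ltry M); apply/ess_supP.
by apply: filterS fM => x /=; rewrite lee_fin.
Qed.

Lemma rV_measure_gt0 : (0 < mu setT)%E.
Proof. by apply: open_gt0_rV; [exact: openT|exists 0]. Qed.

Lemma Loo_ae_le (f : Loo) : {ae mu, forall x, `|wt a x * f x| <= `|f|}.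
Proof.
have : (ess_sup mu (abse \o (EFin \o (fun x => wt a x * wLp_fun f x)%R)) <= `|f|%:E)%E.
  have fin : ('N[mu]_+oo[EFin \o (fun x => wt a x * wLp_fun f x)%R] < +oo)%E.
    by rewrite /wLp_fun; case: (repr f) => h /= /andP[_ /andP[_]]; rewrite inE.
  rewrite /Num.norm/= /wLp_norm /wLfun_norm fineK; last first.
    by rewrite ge0_fin_numE//; exact: Lnorm_ge0.
  by rewrite unlock /= rV_measure_gt0.
by move/ess_supP; apply: filterS => x /=; rewrite lee_fin.
Qed.

Lemma Loo_norm_le (f : Loo) (M : R) : 0 <= M ->
  {ae mu, forall x, `|wt a x * f x| <= M} -> `|f| <= M.
Proof.
move=> M0 fM; rewrite [in leLHS]/Num.norm/= /wLp_norm /wLfun_norm.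
have : ('N[mu]_+oo[EFin \o (fun x => wt a x * wLp_fun f x)%R] <= M%:E)%E.
  rewrite unlock /= rV_measure_gt0; apply/ess_supP.
  by apply: filterS fM => x /=; rewrite lee_fin.
move=> h; rewrite -lee_fin fineK// ge0_fin_numE; first exact: le_lt_trans h (ltry _).
exact: Lnorm_ge0.
Qed.

Lemma pairingC (f g : E -> R) : pairing f g = pairing g f.
Proof. by apply: eq_Rintegral => x _; rewrite mulrC. Qed.

Lemma pairing_ae (f f' g g' : E -> R) :
  measurable_fun setT f -> measurable_fun setT f' ->
  measurable_fun setT g -> measurable_fun setT g' ->
  f = f' %[ae mu] -> g = g' %[ae mu] -> pairing f g = pairing f' g'.
Proof.
move=> mf mf' mg mg' ff gg; congr fine; apply: ae_eq_integral => //.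
- by apply/measurable_EFinP; exact: measurable_funM.
- by apply/measurable_EFinP; exact: measurable_funM.
by apply: filterS2 ff gg => x fx gx xT; rewrite fx// gx.
Qed.

Lemma pairing_dominated (f : Loo) (g : L1) :
  {ae mu, forall x, `|f x * g x| <= `|f| * `|wt (- a) x * g x|}.
Proof.
apply: filterS (Loo_ae_le f) => x fx.
have -> : f x * g x = (wt a x * f x) * (wt (- a) x * g x).
  by rewrite mulrACA wt_mulN mul1r.
by rewrite normrM ler_wpM2r.
Qed.

Lemma pairing_integrable (f : Loo) (g : L1) :
  mu.-integrable setT (fun x => (f x * g x)%:E).
Proof.
have mfg : measurable_fun setT (fun x => f x * g x).
  by apply: measurable_funM; exact: measurable_wLp.
have ig := L1_fun_integrable g.
have := integrableZl measurableT `|f| (integrable_abse ig).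
move=> /integrableP[mG G].
apply/integrableP; split; first exact/measurable_EFinP.
apply: le_lt_trans G; apply: ae_ge0_le_integral => //.
- by apply/measurable_EFinP; exact: measurableT_comp.
- by apply: measurableT_comp.
apply: filterS (pairing_dominated f g) => x h _ /=.
by rewrite lee_fin [leRHS]ger0_norm// mulr_ge0.
Qed.

Lemma pairing_le (f : Loo) (g : L1) : `|pairing f g| <= `|f| * `|g|.
Proof.
have ig := L1_fun_integrable g; have ifg := pairing_integrable f g.
rewrite -lee_fin EFinM L1_normE.
apply: le_trans (_ : (\int[mu]_x `|f x * g x|%:E <= _)%E).
  rewrite /pairing /Rintegral -abse_EFin fineK; last exact: integrable_fin_num.
  by apply: (le_abse_integral _ measurableT); exact: measurable_int ifg.
rewrite -ge0_integralZl//; last first.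
  exact: (measurable_int _ (integrable_abse ig)).
apply: ae_ge0_le_integral => //.
- exact: (measurable_int _ (integrable_abse ifg)).
- apply: emeasurable_funM => //; exact: (measurable_int _ (integrable_abse ig)).
by apply: filterS (pairing_dominated f g) => x h _; rewrite -EFinM lee_fin.
Qed.

Lemma pairing_linearr (f : Loo) (b : R) (g h : L1) :
  pairing f (b *: g + h : L1) = b * pairing f g + pairing f h.
Proof.
have ig := pairing_integrable f g; have ih := pairing_integrable f h.
transitivity (pairing f (fun x => b * g x + h x)).
  apply: pairing_ae => //; try exact: measurable_wLp.
    by apply: measurable_funD; [apply: measurable_funM => //|]; exact: measurable_wLp.
  - exact: ae_eq_refl.
  - exact: wLp_funP.
rewrite /pairing -RintegralZl//= -RintegralD//; last exact: (integrableZl measurableT b ig).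
by apply: eq_Rintegral => x _; ring.
Qed.

Lemma pairing_linearl (b : R) (f h : Loo) (g : L1) :
  pairing (b *: f + h : Loo) g = b * pairing f g + pairing h g.
Proof.
have ig := pairing_integrable f g; have ih := pairing_integrable h g.
transitivity (pairing (fun x => b * f x + h x) g).
  apply: pairing_ae => //; try exact: measurable_wLp.
    by apply: measurable_funD; [apply: measurable_funM => //|]; exact: measurable_wLp.
  - exact: wLp_funP.
  - exact: ae_eq_refl.
rewrite /pairing -RintegralZl//= -RintegralD//; last exact: (integrableZl measurableT b ig).
by apply: eq_Rintegral => x _; ring.
Qed.

End duality_pairing.

Section schwartz_in_Lp.
Context (a : R).

Lemma le_enorm_coord (x : E) i : `|x ord0 i| <= enorm x.
Proof.
rewrite -sqrtr_sqr ler_wsqrtr// (bigD1 i)//= lerDl sumr_ge0// => j _; exact: sqr_ge0.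
Qed.

(** Each coordinate satisfies 1 + x_i^2 <= (1 + |x|)^2. Thus 2d additional powers of decay buy
    integrability, which is the exponent added in [wt_decay]. *)
Lemma rVbump_ge (x : E) : 1 <= rVbump x * (1 + enorm x) ^+ (2 * d).
Proof.
have -> : (1 + enorm x) ^+ (2 * d) = \prod_(i < d) (1 + enorm x) ^+ 2.
  by rewrite prodr_const card_ord exprM.
rewrite /rVbump -big_split/= [leLHS](_ : 1 = \prod_(i < d) 1); last by rewrite big1.
apply: ler_prod => i _; rewrite ler01/= mulrC ler_pdivlMr ?mul1r; last first.
  by rewrite (lt_le_trans _ (oneDsqr_ge1 _)).
rewrite /oneDsqr sqrrD expr1n -[X in X + _ <= _]addr0 -addrA -[leRHS]addrA lerD2l.
rewrite lerD ?mulrn_wge0 ?mul1r ?enorm_ge0//.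
by rewrite -[leLHS]real_normK ?num_real// ler_sqr ?nnegrE ?enorm_ge0// le_enorm_coord.
Qed.

Lemma wt_le_expr (b : R) : exists N : nat, forall x : E, wt b x <= (1 + enorm x) ^+ N.
Proof.
exists (Num.truncn `|b|).+1 => x; have h : 1 <= 1 + enorm x by rewrite lerDl enorm_ge0.
rewrite /wt -powR_mulrn; last exact: le_trans ler01 h.
apply: ler_powR => //; rewrite (le_trans _ (ltW (truncnS_gt _)))//.
by rewrite -normrN ler_norm.
Qed.

Lemma schwartz_decay (phi : schwartz R d) (N : nat) :
  exists2 M : R, 0 <= M & forall x, (1 + enorm x) ^+ N * `|phi x| <= M.
Proof.
case: phi => phi /= /asboolP[_ /(_ N [::])[M hM]]; exists `|M| => // x.
exact: le_trans (hM x) (ler_norm _).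
Qed.

(** N is chosen before f and M: a single seminorm controls all functions, as the continuity of S ->
    L_{1,-a} requires. *)
Lemma wt_decay (b : R) : exists N : nat, forall (f : E -> R) (M : R),
  (forall x, (1 + enorm x) ^+ N * `|f x| <= M) -> forall x, `|wt b x * f x| <= M * rVbump x.
Proof.
have [N hN] := wt_le_expr b.
exists (N + 2 * d)%N => f M hM x; rewrite normrM gtr0_norm ?wt_gt0//.
have h0 : 0 <= 1 + enorm x by rewrite addr_ge0// enorm_ge0.
apply: le_trans (_ : (1 + enorm x) ^+ N * `|f x| * 1 <= _).
  by rewrite mulr1 ler_wpM2r.
apply: le_trans (ler_wpM2l _ (rVbump_ge x)) _; first by rewrite mulr_ge0// exprn_ge0.
rewrite [leLHS](_ : _ = (1 + enorm x) ^+ (N + 2 * d) * `|f x| * rVbump x).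
  by rewrite ler_wpM2r// ltW// rVbump_gt0.
by rewrite exprD; ring.
Qed.

Lemma schwartz_wt_decay (phi : schwartz R d) (b : R) :
  exists2 M : R, 0 <= M & forall x, `|wt b x * phi x| <= M * rVbump x.
Proof.
have [N hN] := wt_decay b; have [M M0 hM] := schwartz_decay phi N.
by exists M => //; exact: hN.
Qed.

Lemma schwartz_continuous (phi : schwartz R d) : continuous phi.
Proof.
case: phi => phi /= /asboolP[dphi _] x.
exact: (differentiable_continuous (dphi [::] x)).
Qed.

Lemma measurable_schwartz (phi : schwartz R d) : measurable_fun setT phi.
Proof. by apply: continuous_measurable_rV; exact: schwartz_continuous. Qed.

Lemma rVbump_le1 (x : E) : rVbump x <= 1.
Proof.
rewrite /rVbump [leRHS](_ : 1 = \prod_(i < d) 1); last by rewrite big1.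
by apply: ler_prod => i _; rewrite oneDsqrV_le1 invr_ge0 (le_trans _ (oneDsqr_ge1 _)).
Qed.

Lemma schwartz_Loo (phi : schwartz R d) : (phi : E -> R) \in wLfun_pred +oo%E a.
Proof.
have [M M0 hM] := schwartz_wt_decay phi a.
apply: (@mem_Loo a _ M); first exact: measurable_schwartz.
by apply: aeW => x; rewrite (le_trans (hM x))// ler_piMr// rVbump_le1.
Qed.

Lemma schwartz_L1 (phi : schwartz R d) : (phi : E -> R) \in wLfun_pred 1%:E (- a).
Proof.
have [M M0 hM] := schwartz_wt_decay phi (- a).
apply: mem_L1; first exact: measurable_schwartz.
apply: (@le_integrable _ _ _ mu setT _ _ (fun x => (M * rVbump x)%:E)) => //.
- apply/measurable_EFinP; apply: measurable_funM; first exact: measurable_wt.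
  exact: measurable_schwartz.
- by move=> x _; rewrite /= lee_fin (le_trans (hM x))// ler_norm.
- exact: (integrableZl measurableT M (integrable_rVbump R d)).
Qed.

Definition schwartz_toL1 (phi : schwartz R d) : 'L1_(R, d, a) := to_wLp _ _ phi.
Definition schwartz_toLoo (phi : schwartz R d) : 'Loo_(R, d, a) := to_wLp _ _ phi.

Lemma schwartz_toL1E phi : wLp_fun (schwartz_toL1 phi) = (phi : E -> R) %[ae mu].
Proof. by apply: wLp_funE; exact: schwartz_L1. Qed.

Lemma schwartz_toLooE phi : wLp_fun (schwartz_toLoo phi) = (phi : E -> R) %[ae mu].
Proof. by apply: wLp_funE; exact: schwartz_Loo. Qed.

Lemma schwartz_toL1P b f g :
  schwartz_toL1 (b *: f + g) = b *: schwartz_toL1 f + schwartz_toL1 g.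
Proof. by apply: to_wLpP; exact: schwartz_L1. Qed.

Lemma schwartz_toLooP b f g :
  schwartz_toLoo (b *: f + g) = b *: schwartz_toLoo f + schwartz_toLoo g.
Proof. by apply: to_wLpP; exact: schwartz_Loo. Qed.

Lemma pairing_toL1 (f : 'Loo_(R, d, a)) phi : pairing f (schwartz_toL1 phi) = pairing f phi.
Proof.
apply: pairing_ae; try exact: measurable_wLp; try exact: measurable_schwartz.
  exact: ae_eq_refl.
exact: schwartz_toL1E.
Qed.

Lemma pairing_toLoo phi (g : 'L1_(R, d, a)) : pairing (schwartz_toLoo phi) g = pairing phi g.
Proof.
apply: pairing_ae; try exact: measurable_wLp; try exact: measurable_schwartz.
  exact: schwartz_toLooE.
exact: ae_eq_refl.
Qed.

Lemma pairing_schwartz phi psi :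
  pairing (schwartz_toLoo phi) (schwartz_toL1 psi) = pairing phi psi.
Proof.
rewrite pairing_toLoo; apply: pairing_ae; try exact: measurable_schwartz; try exact: measurable_wLp.
  exact: ae_eq_refl.
exact: schwartz_toL1E.
Qed.

End schwartz_in_Lp.
End weighted_spaces.

(** * The fundamental lemma of the calculus of variations in L_{oo,a} *)

Section logistic.
Context (R : realType).

Definition logistic (t : R) : R := (1 + expR (- t))^-1.

Lemma logistic_den_gt0 (t : R) : 0 < 1 + expR (- t).
Proof. by rewrite addr_gt0// expR_gt0. Qed.

Lemma logistic_ge0 t : 0 <= logistic t.
Proof. by rewrite invr_ge0 ltW// logistic_den_gt0. Qed.

Lemma logistic_le1 t : logistic t <= 1.
Proof. by rewrite invf_le1 ?logistic_den_gt0// lerDl expR_ge0. Qed.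

Lemma is_derive_logistic (t : R) :
  is_derive t 1 logistic (logistic t * (1 - logistic t)).
Proof.
have h0 : 1 + expR (- t) != 0 by rewrite gt_eqF// logistic_den_gt0.
have : is_derive t 1 logistic (- (1 + expR (- t)) ^- 2 *: (0 + expR (- t) * -1)).
  by apply: is_deriveV => //; apply: is_deriveD.
move/is_derive_eq; apply.
by rewrite /logistic /GRing.scale/=; field.
Qed.

Lemma logistic_mulC (t : R) :
  logistic t * (1 - logistic t) = ((1 + expR (- t)) * (1 + expR t))^-1.
Proof.
have h0 : 1 + expR (- t) != 0 by rewrite gt_eqF// logistic_den_gt0.
rewrite /logistic expRN; have := expR_gt0 t; have := expRN t => e1 e2.
by field; rewrite ?gt_eqF// ?addr_gt0// ?expR_gt0 -?expRN.
Qed.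

Lemma logistic_ge_gt0 (t : R) : 0 <= t -> 1 - logistic t <= (1 + t)^-1.
Proof.
move=> t0.
have -> : 1 - logistic t = (1 + expR t)^-1.
  have := expR_gt0 t => e0; rewrite /logistic expRN.
  by field; rewrite !gt_eqF// addr_gt0.
have t1 : 0 < 1 + t by rewrite ltr_pwDl.
rewrite lef_pV2 ?posrE//.
by rewrite (le_trans (expR_ge1Dx t))// lerDr.
Qed.

Lemma logistic_le_lt0 (t : R) : 0 <= t -> logistic (- t) <= (1 + t)^-1.
Proof.
move=> t0; have t1 : 0 < 1 + t by rewrite ltr_pwDl.
rewrite /logistic opprK lef_pV2 ?posrE//.
by rewrite (le_trans (expR_ge1Dx t))// lerDr.
Qed.

Lemma cvg_logistic_step (u : R) :
  logistic (n%:R ^+ 2 * u - n%:R) @[n --> \oo] --> (if 0 < u then 1 else 0 : R).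
Proof.
apply/cvgrPdist_le => e e0.
have [N Ne] : exists N : nat, (1 + N%:R)^-1 <= e.
  exists (Num.truncn e^-1); rewrite -[leRHS]invrK lef_pV2 ?posrE ?invr_gt0//.
  by rewrite addrC natr1 ltW// truncnS_gt.
have le n (t : R) : (N <= n)%N -> n%:R <= t -> (1 + t)^-1 <= e.
  move=> Nn nt; apply: le_trans Ne.
  have tN : N%:R <= t by apply: le_trans nt; rewrite ler_nat.
  by rewrite lef_pV2 ?posrE ?ltr_pwDl// ?lerD2l// (le_trans _ tN).
have [u0|u0] := ltP 0 u.
(* Beyond 2 / u one has n u >= 2, hence n^2 u - n >= n. *)
- exists (maxn N (Num.truncn (2 / u)).+1) => // n /=; rewrite geq_max => /andP[Nn un].
  have nu : 2 <= n%:R * u.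
    rewrite -ler_pdivrMr// ltW// (lt_le_trans (truncnS_gt _))// ler_nat//.
  have nn : (n%:R : R) <= n%:R ^+ 2 * u - n%:R.
    by rewrite lerBrDr expr2 -mulrA -mulr2n -[leLHS]mulr_natr ler_wpM2l.
  have t0 : 0 <= n%:R ^+ 2 * u - n%:R by apply: le_trans nn.
  rewrite ger0_norm; last by rewrite subr_ge0 logistic_le1.
  by rewrite (le_trans (logistic_ge_gt0 t0))// (le n).
- exists N => // n /= Nn; rewrite sub0r normrN ger0_norm ?logistic_ge0//.
  have nn : (n%:R : R) <= - (n%:R ^+ 2 * u - n%:R).
    by rewrite opprB lerBrDr gerDl mulr_ge0_le0// exprn_ge0.
  rewrite -[X in logistic X]opprK (le_trans (logistic_le_lt0 _))//.
    exact: le_trans nn.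
  exact: (le n).
Qed.

(** One term of the exponential series at 1 + |t| gives (1 + |t|)^(k+1) <= (k+1)! e exp|t|, while
    s(1 - s) is the inverse of (1 + exp(-t))(1 + exp t), which is at least exp|t|. *)
Lemma logistic_weight_bound (k : nat) : exists2 C : R, 0 <= C &
  forall t, (1 + `|t|) ^+ k * (logistic t * (1 - logistic t)) <= C.
Proof.
exists (k.+1`!%:R * expR 1); first by rewrite mulr_ge0// expR_ge0.
move=> t; have h1 : 1 <= 1 + `|t| by rewrite lerDl.
have h : (1 + `|t|) ^+ k <= k.+1`!%:R * (expR 1 * expR `|t|).
  apply: (@le_trans _ _ ((1 + `|t|) ^+ k.+1)); first by rewrite ler_weXn2l.
  have := expR_ge1Dxn k (le_trans ler01 h1).
  rewrite expRD => /(le_trans _) h.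
  rewrite mulrC -ler_pdivrMr ?ltr0n ?fact_gt0//; apply: h.
  by rewrite lerDr.
rewrite logistic_mulC ler_pdivrMr; last by rewrite mulr_gt0// addr_gt0// expR_gt0.
apply: le_trans h _; rewrite -mulrA ler_wpM2l// ler_wpM2l ?expR_ge0//.
rewrite mulrDl mul1r mulrDr mulr1.
have e1 := expR_ge0 t; have e2 := expR_ge0 (- t).
have e3 : 0 <= expR (- t) * expR t by rewrite mulr_ge0.
by case: (ger0P t) => _; lra.
Qed.
End logistic.

Section test_functions.
Context (R : realType) (d : nat).
Local Notation E := 'rV[R]_d.
Local Notation "'d_ i" := (delta_mx ord0 i : E) (at level 8, format "''d_' i").

(* Schwartz functions are produced without compactly supported bumps: the algebra
   generated by x |-> s(c x_i + e), s the logistic function, is stable under partial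
   derivatives since s' = s(1 - s), and it consists of bounded functions; multiplying it
   by the exponentially decaying weight prod_i s(x_i)(1 - s(x_i)) gives Schwartz
   functions. *)
Inductive logi_alg : (E -> R) -> Prop :=
| logi_cst c : logi_alg (cst c)
| logi_sig i c e : logi_alg (fun x => logistic (c * x ord0 i + e))
| logi_add f g : logi_alg f -> logi_alg g -> logi_alg (f + g)
| logi_mul f g : logi_alg f -> logi_alg g -> logi_alg (f * g).

Lemma is_derive_coord (x v : E) i : is_derive x v (fun y : E => y ord0 i : R) (v ord0 i).
Proof.
have lf : linear (fun y : E => y ord0 i : R^o) by move=> b u w; rewrite !mxE.
pose f : {linear E -> R^o} := HB.pack (fun y : E => y ord0 i : R^o)
  (GRing.isLinear.Build R E R^o *:%R _ lf).
have cf : continuous f by move=> y; exact: coord_continuous.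
have df : differentiable f x by exact: linear_differentiable.
apply: DeriveDef; first exact: (diff_derivable df).
by rewrite (deriveE v df) diff_lin.
Qed.

Lemma is_derive_logistic_coord (x v : E) i c e :
  is_derive x v (fun y : E => logistic (c * y ord0 i + e))
    (c * v ord0 i * (logistic (c * x ord0 i + e) * (1 - logistic (c * x ord0 i + e)))).
Proof.
pose h (y : E) : R := c * y ord0 i + e.
have dh : differentiable h x.
  apply: differentiableD; last exact: differentiable_cst.
  by apply: (@differentiableZ _ _ _ (fun y : E => y ord0 i : R^o)); exact: differentiable_coord.
have hv : 'd h x v = c * v ord0 i.
  rewrite -deriveE//; have := is_derive_coord x v i => ?.
  have : is_derive x v h (c *: v ord0 i + 0).
    by apply: is_deriveD; apply: is_deriveZ.
  by move=> /@derive_val ->; rewrite addr0.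
have ld := is_derive_logistic (h x).
have dl : differentiable (@logistic R) (h x) by apply/derivable1_diffP; case: ld.
have dc : differentiable (@logistic R \o h) x by exact: differentiable_comp.
apply: DeriveDef; first exact: (diff_derivable dc).
rewrite (deriveE v dc) diff_comp//= hv diff1E// derive1E.
by have /@derive_val -> := ld.
Qed.

Lemma logi_alg_differentiable f : logi_alg f -> forall x, differentiable f x.
Proof.
elim=> [c x|i c e x|{}f g _ IHf _ IHg x|{}f g _ IHf _ IHg x].
- exact: differentiable_cst.
- have dl : differentiable (@logistic R) (c * x ord0 i + e).
    by apply/derivable1_diffP; case: (is_derive_logistic (c * x ord0 i + e)).
  apply: (@differentiable_comp _ _ _ _ (fun y : E => c * y ord0 i + e) (@logistic R)) => //.
  apply: differentiableD; last exact: differentiable_cst.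
  by apply: (@differentiableZ _ _ _ (fun y : E => y ord0 i : R^o)); exact: differentiable_coord.
- by apply: differentiableD; [exact: IHf|exact: IHg].
- by apply: differentiableM; [exact: IHf|exact: IHg].
Qed.

Lemma logi_alg_bounded f : logi_alg f -> exists2 M, 0 <= M & forall x, `|f x| <= M.
Proof.
elim=> [c|i c e|{}f g _ [M M0 hM] _ [N N0 hN]|{}f g _ [M M0 hM] _ [N N0 hN]].
- by exists `|c|.
- by exists 1 => // x; rewrite ger0_norm ?logistic_ge0 ?logistic_le1.
- exists (M + N) => [|x]; first exact: addr_ge0.
  by rewrite (le_trans (ler_normD _ _))// lerD.
- exists (M * N) => [|x]; first exact: mulr_ge0.
  by rewrite [leLHS]normrM ler_pM.
Qed.

Lemma logi_alg_pderiv f v : logi_alg f -> logi_alg ('D_v f).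
Proof.
elim=> [c|i c e|{}f g af IHf ag IHg|{}f g af IHf ag IHg].
- have -> : 'D_v (cst c : E -> R) = cst 0 by apply/funext => x; exact: derive_cst.
  exact: logi_cst.
- have -> : 'D_v (fun x : E => logistic (c * x ord0 i + e)) =
    cst (c * v ord0 i) * ((fun x : E => logistic (c * x ord0 i + e)) *
     (cst 1 + cst (-1) * (fun x : E => logistic (c * x ord0 i + e)))).
    apply/funext => x; have /@derive_val -> := is_derive_logistic_coord x v i c e.
    by rewrite !fctE mulN1r.
  apply: logi_mul; first exact: logi_cst.
  apply: logi_mul; first exact: logi_sig.
  apply: logi_add; first exact: logi_cst.
  by apply: logi_mul; [exact: logi_cst|exact: logi_sig].
- have -> : 'D_v (f + g) = 'D_v f + 'D_v g.
    apply/funext => x; rewrite deriveD//; apply: diff_derivable;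
      exact: logi_alg_differentiable.
  exact: logi_add.
- have -> : 'D_v (f * g) = f * 'D_v g + g * 'D_v f.
    apply/funext => x; rewrite deriveM//; apply: diff_derivable;
      exact: logi_alg_differentiable.
  by apply: logi_add; exact: logi_mul.
Qed.

Definition logi_factor (i : 'I_d) (x : E) : R :=
  logistic (x ord0 i) * (1 - logistic (x ord0 i)).

Definition logi_weight (x : E) : R := \prod_(i < d) logi_factor i x.

Definition logi_test (f : E -> R) : Prop :=
  exists2 g, logi_alg g & f = logi_weight * g.

Lemma logi_alg_factor i : logi_alg (logi_factor i).
Proof.
have -> : logi_factor i = (fun x : E => logistic (1 * x ord0 i + 0)) *
    (cst 1 + cst (-1) * (fun x : E => logistic (1 * x ord0 i + 0))).
  by apply/funext => x; rewrite !fctE mulN1r mul1r addr0.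
apply: logi_mul; first exact: logi_sig.
apply: logi_add; first exact: logi_cst.
by apply: logi_mul; [exact: logi_cst|exact: logi_sig].
Qed.

(** The derivative of s(1 - s) is s(1 - s)(1 - 2s). The decaying factor thus survives
    differentiation, which makes [logi_test] stable under derivatives. *)
Lemma logi_factor_pderiv i v : exists2 g, logi_alg g & 'D_v (logi_factor i) = logi_factor i * g.
Proof.
exists (cst (v ord0 i) * (cst 1 + cst (-2) * (fun x : E => logistic (1 * x ord0 i + 0)))).
  apply: logi_mul; first exact: logi_cst.
  apply: logi_add; first exact: logi_cst.
  by apply: logi_mul; [exact: logi_cst|exact: logi_sig].
have fE : logi_factor i = (fun x : E => logistic (1 * x ord0 i + 0)) *
    (cst 1 - (fun x : E => logistic (1 * x ord0 i + 0))).
  by apply/funext => x; rewrite !fctE mul1r addr0.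
apply/funext => x; rewrite [in LHS]fE.
have ds := is_derive_logistic_coord x v i 1 0.
have -> : 'D_v ((fun x : E => logistic (1 * x ord0 i + 0)) *
    (cst 1 - (fun x : E => logistic (1 * x ord0 i + 0)))) x =
  logistic (1 * x ord0 i + 0) *: (0 - 1 * v ord0 i *
     (logistic (1 * x ord0 i + 0) * (1 - logistic (1 * x ord0 i + 0)))) +
  (1 - logistic (1 * x ord0 i + 0)) *: (1 * v ord0 i *
     (logistic (1 * x ord0 i + 0) * (1 - logistic (1 * x ord0 i + 0)))).
  have db : is_derive x v (cst 1 - (fun x : E => logistic (1 * x ord0 i + 0)))
    (0 - 1 * v ord0 i * (logistic (1 * x ord0 i + 0) * (1 - logistic (1 * x ord0 i + 0)))).
    by apply: is_deriveB.
  by rewrite deriveM// !derive_val.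
rewrite !fctE /logi_factor !mul1r !addr0 /GRing.scale/=; ring.
Qed.

Lemma logi_prodE (s : seq 'I_d) :
  exists2 f, logi_alg f /\ (forall v, exists2 g, logi_alg g & 'D_v f = f * g)
    & forall x, f x = \prod_(i <- s) logi_factor i x.
Proof.
elim: s => [|i s [f [af df] fE]].
  exists (cst 1); last by move=> x; rewrite big_nil.
  split=> [|v]; first exact: logi_cst.
  exists (cst 0); first exact: logi_cst.
  by apply/funext => x; rewrite !fctE mulr0; exact: derive_cst.
exists (logi_factor i * f); last by move=> x; rewrite big_cons !fctE fE.
split=> [|v]; first by apply: logi_mul => //; exact: logi_alg_factor.
have [g ag dg] := df v; have [h ah dh] := logi_factor_pderiv i v.
exists (g + h); first exact: logi_add.
apply/funext => x; rewrite deriveM; last 2 first.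
- by apply: diff_derivable; apply: logi_alg_differentiable; exact: logi_alg_factor.
- by apply: diff_derivable; exact: logi_alg_differentiable.
have -> : 'D_v f x = (f * g) x by rewrite -dg.
have -> : 'D_v (logi_factor i) x = (logi_factor i * h) x by rewrite -dh.
by rewrite !fctE /GRing.scale/=; ring.
Qed.

Lemma logi_weightE : exists2 f, logi_alg f /\
  (forall v, exists2 g, logi_alg g & 'D_v f = f * g) & logi_weight = f.
Proof.
have [f fP fE] := logi_prodE (index_enum 'I_d); exists f => //.
by apply/funext => x; rewrite fE.
Qed.

Lemma logi_test_differentiable f : logi_test f -> forall x, differentiable f x.
Proof.
move=> [g ag ->]; have [w [aw _] ->] := logi_weightE.
by apply: logi_alg_differentiable; exact: logi_mul.
Qed.

Lemma logi_test_pderiv f v : logi_test f -> logi_test ('D_v f).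
Proof.
move=> [g ag ->]; rewrite /logi_test; have [w [aw dw] ->] := logi_weightE.
have [h ah wh] := dw v.
exists (h * g + 'D_v g).
  by apply: logi_add; [exact: logi_mul|exact: logi_alg_pderiv].
apply/funext => x; rewrite deriveM; last 2 first.
- by apply: diff_derivable; exact: logi_alg_differentiable.
- by apply: diff_derivable; exact: logi_alg_differentiable.
have -> : 'D_v w x = (w * h) x by rewrite -wh.
by rewrite !fctE /GRing.scale/=; ring.
Qed.

Lemma logi_factor_gt0 i x : 0 < logi_factor i x.
Proof.
by rewrite /logi_factor logistic_mulC invr_gt0 mulr_gt0// addr_gt0// expR_gt0.
Qed.

Lemma logi_weight_gt0 x : 0 < logi_weight x.
Proof. by apply: prodr_gt0 => i _; exact: logi_factor_gt0. Qed.

(** Since [logi_weight] decays coordinate by coordinate, the Euclidean weight has to be dominated by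
    a product over coordinates. *)
Lemma enorm_prod (x : E) : 1 + enorm x <= \prod_(i < d) (1 + `|x ord0 i|).
Proof.
(* The norm is a square root, so squares are compared after subtracting 1. A new factor 1 + t raises
   (P - 1)^2 by at least (t P)^2, and P >= 1 makes this at least t^2. *)
have h (s : seq 'I_d) : 1 <= \prod_(i <- s) (1 + `|x ord0 i|) /\
    \sum_(i <- s) x ord0 i ^+ 2 <= (\prod_(i <- s) (1 + `|x ord0 i|) - 1) ^+ 2.
  elim: s => [|i s [P1 IH]]; first by rewrite !big_nil subrr expr0n.
  rewrite !big_cons; set P := \prod_(j <- s) _ in P1 IH *.
  have n0 : 0 <= `|x ord0 i| by [].
  split; first by rewrite -[leLHS]mulr1 ler_pM// lerDl.
  rewrite -[x ord0 i ^+ 2]real_normK ?num_real//.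
  set t := `|x ord0 i| in n0 *.
  have -> : ((1 + t) * P - 1) ^+ 2 = (P - 1) ^+ 2 + (t * P) ^+ 2 + 2 * ((P - 1) * (t * P)) by ring.
  have tP : t ^+ 2 <= (t * P) ^+ 2 by rewrite ler_sqr ?nnegrE ?ler_peMr// mulr_ge0// (le_trans ler01).
  have : 0 <= (P - 1) * (t * P) by rewrite !mulr_ge0 ?subr_ge0// (le_trans ler01).
  by move: IH tP; lra.
have [P1 hP] := h (index_enum 'I_d).
rewrite -lerBrDl -[leRHS]ger0_norm ?subr_ge0// -sqrtr_sqr ler_wsqrtr//.
Qed.

Lemma logi_weight_decay (k : nat) : exists2 C, 0 <= C & forall x : E, (1 + enorm x) ^+ k * logi_weight x <= C.
Proof.
have [C C0 hC] := logistic_weight_bound R k.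
exists (C ^+ d) => [|x]; first exact: exprn_ge0.
apply: (@le_trans _ _ ((\prod_(i < d) (1 + `|x ord0 i|)) ^+ k * logi_weight x)).
  rewrite ler_wpM2r ?(ltW (logi_weight_gt0 _))// lerXn2r ?nnegrE ?addr_ge0 ?enorm_ge0 ?enorm_prod//.
  by apply: prodr_ge0 => i _; rewrite addr_ge0.
rewrite -prodrXl -big_split/= -[X in _ <= _ ^+ X](card_ord d) -prodr_const.
apply: ler_prod => i _; rewrite mulr_ge0 ?exprn_ge0 ?addr_ge0 ?(ltW (logi_factor_gt0 _ _))//; exact: hC.
Qed.

Lemma logi_test_schwartz f : logi_test f -> f \in @schwartz_pred R d.
Proof.
move=> tf.
have ts s : logi_test (pderiv s f) by elim: s => //= i s; exact: logi_test_pderiv.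
apply/asboolP; split=> [s x|k s]; first exact: logi_test_differentiable.
have [g ag ->] := ts s; have [M M0 hM] := logi_alg_bounded ag.
have [C C0 hC] := logi_weight_decay k; exists (C * M) => x.
rewrite normrM (gtr0_norm (logi_weight_gt0 x)) mulrA ler_pM//.
by rewrite mulr_ge0 ?exprn_ge0 ?addr_ge0 ?enorm_ge0 ?ltW// logi_weight_gt0.
Qed.
End test_functions.

Section density_measure.
Context d (T : measurableType d) (R : realType) (mu : {measure set T -> \bar R}).
Context (f : T -> \bar R) (mf : measurable_fun setT f) (f0 : forall x, (0 <= f x)%E).

(** The two proofs are arguments, absent from the body, so that the measure instance below can be
    found from the term alone. *)
Definition density_measure of measurable_fun setT f & (forall x, (0 <= f x)%E) :=
  fun A : set T => (\int[mu]_(x in A) f x)%E.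
Local Notation nu := (density_measure mf f0).

Let nu0 : nu set0 = 0%E. Proof. exact: integral_set0. Qed.

Let nu_ge0 A : (0 <= nu A)%E. Proof. exact: integral_ge0. Qed.

HB.instance Definition _ := isMeasure.Build _ _ _ nu nu0 nu_ge0
  (@semi_sigma_additive_nng_induced _ _ _ mu _ mf f0).
End density_measure.

(** * Vanishing of a function that is orthogonal to all logistic test functions *)

Section du_bois_reymond.
Context (R : realType) (d : nat).
Local Notation E := 'rV[R]_d.
Local Notation mu := (lebesgue_rV R d).

Definition orthant (b : 'I_d -> R) : set E := [set x | forall i, x ord0 i < b i].

Lemma orthantI : setI_closed (range orthant).
Proof.
move=> _ _ [b _ <-] [c _ <-]; exists (fun i => Num.min (b i) (c i)) => //.
apply/seteqP; split=> [x xbc|x [xb xc] i].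
  by split=> i; have := xbc i; rewrite lt_min => /andP[].
by rewrite lt_min xb xc.
Qed.

Lemma orthant_cover : \bigcup_k orthant (fun=> k%:R) = setT.
Proof.
apply/seteqP; split=> // x _.
exists (Num.truncn (\sum_i `|x ord0 i|)).+1 => // i.
rewrite (le_lt_trans _ (truncnS_gt _))// (le_trans (ler_norm _))//.
by rewrite (bigD1 i)//= lerDl sumr_ge0.
Qed.

Lemma orthantE b : orthant b =
  \bigcap_(i in [set: 'I_d]) (@rV_coord R d i @^-1` `]-oo, b i[).
Proof.
apply/seteqP; split=> x xb i; first by move=> _; rewrite /= in_itv/=; exact: xb.
by have := xb i Logic.I; rewrite /= in_itv.
Qed.

Lemma measurable_orthant b : measurable (orthant b).
Proof.
rewrite orthantE; apply: fin_bigcap_measurable => // i _.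
rewrite -[X in measurable X]setTI; apply: measurable_rV_coord => //.
Qed.

(** A half-space x_i < c is the countable union of the orthants with i-th bound c and all other
    bounds m. With [orthantI], finite measures may therefore be compared on orthants. *)
Lemma measurable_rV_orthant : @measurable _ E = <<s range orthant >>.
Proof.
apply/seteqP; split; last first.
  apply: smallest_sub; first exact: sigma_algebra_measurable.
  by move=> _ [b _ <-]; exact: measurable_orthant.
pose T := g_sigma_algebraType (range orthant).
have mc i : measurable_fun setT (@rV_coord R d i : T -> R).
  apply: (measurability _ (RGenInftyO.measurableE R)) => _ [_ [c ->] <-].
  rewrite setTI.
  pose b (m : nat) (j : 'I_d) : R := if j == i then c else m%:R.
  rewrite (_ : _ @^-1` _ = \bigcup_m orthant (b m)); last first.
    apply/seteqP; split=> [x /=|x [m _ xb]]; last first.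
      by have := xb i; rewrite /b eqxx /= in_itv.
    rewrite in_itv/= => xc.
    have [m _ xm] : (\bigcup_k orthant (fun=> k%:R)) x by rewrite orthant_cover.
    by exists m => // j; rewrite /b; case: eqVneq => [->//|_]; exact: xm.
  apply: (@bigcupT_measurable _ T) => m; apply: sub_sigma_algebra.
  by exists (b m).
apply: smallest_sub; first exact: smallest_sigma_algebra.
rewrite -bigcup_seq; apply: bigcup_sub => i _ A [B mB <-].
exact: (mc i measurableT B mB).
Qed.

(* Pointwise limit, as n grows, is the indicator of [orthant b]; the shift by n makes
   the limit 0 on the boundary. *)
Definition orthant_step (b : 'I_d -> R) (n : nat) (x : E) : R :=
  \prod_(i < d) logistic (- n%:R ^+ 2 * x ord0 i + (n%:R ^+ 2 * b i - n%:R)).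

Lemma logi_alg_prod (f : 'I_d -> E -> R) : (forall i, logi_alg (f i)) ->
  logi_alg (fun x => \prod_(i < d) f i x).
Proof.
move=> af; have h (s : seq 'I_d) : logi_alg (fun x => \prod_(i <- s) f i x).
  elim: s => [|i s IH].
    rewrite (_ : (fun _ => _) = cst 1); first exact: logi_cst.
    by apply/funext => x; rewrite big_nil.
  rewrite (_ : (fun _ => _) = f i * (fun x => \prod_(i <- s) f i x)).
    exact: logi_mul.
  by apply/funext => x; rewrite big_cons.
exact: h.
Qed.

Lemma logi_alg_orthant_step b n : logi_alg (orthant_step b n).
Proof. by apply: logi_alg_prod => i; exact: logi_sig. Qed.

Lemma orthant_step_ge0 b n x : 0 <= orthant_step b n x.
Proof. by apply: prodr_ge0 => i _; exact: logistic_ge0. Qed.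

Lemma orthant_step_le1 b n x : orthant_step b n x <= 1.
Proof.
rewrite /orthant_step [leRHS](_ : 1 = \prod_(i < d) 1); last by rewrite big1.
by apply: ler_prod => i _; rewrite logistic_ge0 logistic_le1.
Qed.

Lemma cvg_orthant_step b x : orthant_step b n x @[n --> \oo] --> (\1_(orthant b) x : R).
Proof.
have -> : \1_(orthant b) x = \prod_(i < d) (if 0 < b i - x ord0 i then 1 else 0) :> R.
  rewrite indicE; have [xb|] := pselect (orthant b x).
    by rewrite mem_set// big1// => i _; rewrite subr_gt0 xb.
  move=> nxb; rewrite memNset//; have /existsNP[i /negP xi] := nxb.
  by rewrite (bigD1 i)//= subr_gt0 (negbTE xi) mul0r.
have h (s : seq 'I_d) : \prod_(i <- s) logistic (- n%:R ^+ 2 * x ord0 i + (n%:R ^+ 2 * b i - n%:R))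
    @[n --> \oo] --> (\prod_(i <- s) (if 0 < b i - x ord0 i then 1 else 0) : R).
  elim: s => [|i s IH].
    by rewrite big_nil; under eq_fun do rewrite big_nil; exact: cvg_cst.
  rewrite big_cons; under eq_fun do rewrite big_cons.
  apply: cvgM IH; have := @cvg_logistic_step R (b i - x ord0 i).
  by under eq_fun => n do rewrite mulrBr [n%:R ^+ 2 * b i - _]addrC -mulNr -addrA.
exact: h.
Qed.

(** Each [orthant_step] times [logi_weight] is a test function, so its pairing with f vanishes. The
    steps stay in [0, 1] and tend to the indicator, and f times the weight dominates. *)
Lemma integral_orthant_eq0 (f : E -> R) :
  measurable_fun setT f ->
  mu.-integrable setT (fun x => (f x * logi_weight x)%:E) ->
  (forall phi, logi_test phi -> pairing f phi = 0) ->
  forall b, (\int[mu]_(x in orthant b) (f x * logi_weight x)%:E = 0)%E.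
Proof.
move=> mf iF f0 b; rewrite integral_mkcond.
pose F x := f x * logi_weight x.
have mF : measurable_fun setT F by apply/measurable_EFinP; exact: measurable_int iF.
have mg n : measurable_fun setT (orthant_step b n).
  apply: continuous_measurable_rV => x; apply: differentiable_continuous.
  exact/logi_alg_differentiable/logi_alg_orthant_step.
pose g n x := (F x * orthant_step b n x)%:E.
have mgn n : measurable_fun setT (g n) by apply/measurable_EFinP; exact: measurable_funM.
have le n x : (`|g n x| <= `|(F x)%:E|)%E.
  rewrite /g /= lee_fin normrM ler_piMr// ger0_norm ?orthant_step_ge0//.
  exact: orthant_step_le1.
have ig n : mu.-integrable setT (g n).
  by apply: le_integrable iF => // x _; exact: le.
have [] := @dominated_convergence _ _ _ mu setT measurableT g
  ((fun x => (F x)%:E) \_ (orthant b)) (fun x => `|(F x)%:E|%E).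
- exact: mgn.
- apply/(measurable_restrictT _ _).1; first exact: measurable_orthant.
  by apply: measurable_funTS; exact/measurable_EFinP.
- apply: aeW => x _; rewrite patchE.
  have -> : (if x \in orthant b then (F x)%:E else point) = (F x * \1_(orthant b) x)%:E.
    by rewrite indicE; case: ifP => _; rewrite ?mulr1 ?mulr0.
  apply: cvg_EFin; first by apply: nearW => n.
  by apply: cvgM; [exact: cvg_cst|exact: cvg_orthant_step].
- exact: integrable_abse.
- by apply: aeW => x n _; exact: le.
move=> _ _ h; apply/esym; have /cvg_lim <- // := h.
apply/esym/cvg_lim => //.
have -> : [sequence (\int[mu]_x g n x)%E]_n = cst 0%E.
  apply/funext => n /=.
  have := f0 (@logi_weight R d * orthant_step b n) (ex_intro2 _ _ _ (logi_alg_orthant_step b n) erefl).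
  rewrite /pairing /Rintegral => h0; rewrite -[RHS]/(0%R)%:E -h0 fineK.
    by apply: eq_integral => x _; rewrite /g /F mulrA.
  have := integrable_fin_num measurableT (ig n); congr (_ \is a fin_num).
  by apply: eq_integral => x _; rewrite /g /F mulrA.
exact: cvg_cst.
Qed.

(** The positive and negative parts of f times the weight are densities of two finite measures that
    agree on orthants, hence everywhere. So the product vanishes almost everywhere, and the weight
    is positive. *)
Lemma du_bois_reymond (f : E -> R) :
  measurable_fun setT f ->
  mu.-integrable setT (fun x => (f x * logi_weight x)%:E) ->
  (forall phi, logi_test phi -> pairing f phi = 0) ->
  {ae mu, forall x, f x = 0}.
Proof.
move=> mf iF f0; have O0 := integral_orthant_eq0 mf iF f0.
pose F x := (f x * logi_weight x)%:E.
have mF : measurable_fun setT F by exact: measurable_int iF.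
pose m1 := density_measure mu (measurable_funepos mF) (funepos_ge0 F).
pose m2 := density_measure mu (measurable_funeneg mF) (funeneg_ge0 F).
have fin1 A : measurable A -> m1 A \is a fin_num.
  move=> mA; apply: integrable_fin_num => //; apply: integrableS (integrable_funepos measurableT iF) => //.
have fin2 A : measurable A -> m2 A \is a fin_num.
  move=> mA; apply: integrable_fin_num => //; apply: integrableS (integrable_funeneg measurableT iF) => //.
have m12 A : measurable A -> m1 A = m2 A.
  apply: (measure_unique (range orthant) (fun k => orthant (fun=> k%:R))).
  - exact: measurable_rV_orthant.
  - exact: orthantI.
  - by move=> i; exists (fun=> i%:R).
  - exact: orthant_cover.
  - move=> _ [b _ <-]; have mb := measurable_orthant b.
    suff : m1 (orthant b) = m2 (orthant b) by [].
    have : (m1 (orthant b) - m2 (orthant b) = 0)%E.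
      by rewrite /m1 /m2 /density_measure -integralE O0.
    rewrite -(fineK (fin1 _ mb)) -(fineK (fin2 _ mb)) -EFinB => -[/eqP].
    by rewrite subr_eq0 => /eqP ->.
  - by move=> k; rewrite ltey_eq fin1//; exact: measurable_orthant.
have : ae_eq mu setT F (cst 0%E).
  apply: integral_ae_eq => // A _ mA.
  rewrite integral0 integralE.
  have -> : (\int[mu]_(x in A) F^\+ x = \int[mu]_(x in A) F^\- x)%E := m12 A mA.
  by rewrite subee//; exact: fin2.
apply: filterS => x /(_ Logic.I) /eqP; rewrite eqe mulf_eq0 => /orP[/eqP//|].
by rewrite gt_eqF// logi_weight_gt0.
Qed.
End du_bois_reymond.

Import HBSimple.
Import HBNNSimple.

Section ae_le.
Context d (T : measurableType d) (R : realType) (mu : {measure set T -> \bar R}).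

Lemma ae_le_of_integral (f g : T -> R) :
  mu.-integrable setT (EFin \o f) -> mu.-integrable setT (EFin \o g) ->
  (forall A, measurable A ->
    (\int[mu]_(x in A) (f x)%:E <= \int[mu]_(x in A) (g x)%:E)%E) ->
  {ae mu, forall x, f x <= g x}.
Proof.
move=> intf intg fg; pose h x := ((f x)%:E - (g x)%:E)%E.
have inth : mu.-integrable setT h by exact: integrableB.
have mh : measurable_fun setT h := measurable_int _ inth.
(* On this set the hypothesis bounds the integral of the positive part of f - g by 0. *)
pose A := [set x | (0 <= h x)%E].
have mA : measurable A by rewrite -[A]setTI; exact: emeasurable_fun_c_infty.
have : ae_eq mu setT (h^\+)%E (cst 0%E).
  apply/(ae_eq_integral_abs mu measurableT); first exact: measurable_funepos.
  under eq_integral do rewrite gee0_abs//.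
  apply/eqP; rewrite eq_le integral_ge0 ?andbT//.
  have -> : (h^\+)%E = h \_ A.
    apply/funext => x; rewrite patchE funeposE; case: ifPn => [|/negP] /[!inE].
      by move=> hx; apply/max_idPl.
    by move=> /negP; rewrite -ltNge => hx; apply/max_idPr/ltW.
  rewrite -integral_mkcond integralB//; [|exact: integrableS intf|exact: integrableS intg].
  have := fg A mA; rewrite -sube_le0; exact.
apply: filterS => x /(_ Logic.I) hx.
have {}hx : ((h^\+)%E x = 0)%E := hx.
have : (h x <= 0)%E by rewrite -[leRHS]hx funeposE le_max lexx.
by rewrite /h -EFinB lee_fin subr_le0.
Qed.

Lemma ae_eq_integrable (f g : T -> \bar R) : measurable_fun setT g ->
  ae_eq mu setT f g -> mu.-integrable setT f -> mu.-integrable setT g.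
Proof.
move=> mg fg /integrableP[mf fi]; apply/integrableP; split => //.
apply: le_lt_trans fi; rewrite le_eqVlt; apply/orP; left; apply/eqP.
apply: ae_eq_integral => //; try exact: measurableT_comp.
by apply: filterS fg => x /= /[apply] ->.
Qed.
End ae_le.

(** * Duality of L_{1,-a} and L_{oo,a} *)

Section L1_dual.
Context (R : realType) (d : nat) (a : R).
Local Notation E := 'rV[R]_d.
Local Notation mu := (lebesgue_rV R d).
Local Notation L1 := 'L1_(R, d, a).
Local Notation Loo := 'Loo_(R, d, a).

Lemma L1_norm_mk (g : E -> R) : g \in wLfun_pred 1%:E (- a) ->
  (`|to_wLp _ _ g : L1|%:E = \int[mu]_x `|wt (- a) x * g x|%:E)%E.
Proof.
move=> gP; rewrite L1_normE; apply: ae_eq_integral => //.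
- apply/measurable_EFinP; apply: measurableT_comp => //; apply: measurable_funM.
    exact: measurable_wt.
  exact: measurable_wLp.
- apply/measurable_EFinP; apply: measurableT_comp => //; apply: measurable_funM.
    exact: measurable_wt.
  by move: gP => /andP[]; rewrite inE.
by apply: filterS (wLp_funE (lexx 1%:E) gP) => x gx _; rewrite gx.
Qed.

(** The factor [wt a] cancels the weight of L_{1,-a} and leaves [rVbump], so indicators of all
    measurable sets, even of infinite measure, enter L_{1,-a} once multiplied by it. *)
Definition cell_weight (x : E) : R := wt a x * rVbump x.

Lemma cell_weight_gt0 x : 0 < cell_weight x.
Proof. by rewrite mulr_gt0 ?wt_gt0 ?rVbump_gt0. Qed.

Lemma measurable_cell_weight : measurable_fun setT cell_weight.
Proof. by apply: measurable_funM; [exact: measurable_wt|exact: measurable_rVbump]. Qed.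

Lemma wt_cell_weight x : wt (- a) x * cell_weight x = rVbump x.
Proof. by rewrite /cell_weight mulrA [_ * wt a x]mulrC wt_mulN mul1r. Qed.

Lemma measurable_cell_weightV : measurable_fun setT (fun x => (cell_weight x)^-1).
Proof.
rewrite (_ : (fun _ => _) = (fun x : E => wt (- a) x * \prod_(i < d) oneDsqr (x ord0 i))).
  apply: measurable_funM; first exact: measurable_wt.
  apply: (@measurable_rV_prod R d (fun=> @oneDsqr R)) => i.
  by apply: continuous_measurable_fun; exact: continuous_oneDsqr.
apply/funext => x; rewrite /cell_weight invfM; congr (_ * _).
  by rewrite -[LHS]mulr1 -(wt_mulN a x) mulKf// gt_eqF ?wt_gt0.
by rewrite /rVbump -prodfV; apply: eq_bigr => i _; rewrite invrK.
Qed.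

(* The weight makes A |-> l (cell A) a finite charge on R^d for l in the dual of
   L_{1,-a}; its Radon-Nikodym density divided by the weight represents l. *)
Definition cell (A : set E) : L1 := to_wLp _ _ (fun x => \1_A x * cell_weight x).

Lemma cell_mem (A : set E) : measurable A ->
  (fun x => \1_A x * cell_weight x) \in wLfun_pred 1%:E (- a).
Proof.
move=> mA; apply: mem_L1.
  by apply: measurable_funM; [exact: measurable_indic|exact: measurable_cell_weight].
under eq_fun do rewrite mulrCA wt_cell_weight.
apply: le_integrable (integrable_rVbump R d) => //.
  apply/measurable_EFinP; apply: measurable_funM; first exact: measurable_indic.
  exact: measurable_rVbump.
move=> x _; rewrite /= lee_fin normrM ler_piMl// ger0_norm// indicE; by case: (_ \in _).
Qed.

Let rVbump_measurable : measurable_fun setT (EFin \o @rVbump R d).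
Proof. by apply/measurable_EFinP; exact: measurable_rVbump. Qed.

Let rVbump_ge0 x : (0 <= (EFin \o @rVbump R d) x)%E.
Proof. by rewrite /= lee_fin ltW// rVbump_gt0. Qed.

Let m : {measure set E -> \bar R} := density_measure mu rVbump_measurable rVbump_ge0.

Let m_fin A : measurable A -> m A \is a fin_num.
Proof.
move=> mA; apply: integrable_fin_num => //.
exact: (integrableS measurableT mA _ (integrable_rVbump R d)).
Qed.

Lemma cell_norm A : measurable A -> (`|cell A|%:E = m A)%E.
Proof.
move=> mA; rewrite /cell L1_norm_mk; last exact: cell_mem.
rewrite /m /= /density_measure integral_mkcond; apply: eq_integral => x _.
rewrite mulrCA wt_cell_weight patchE indicE; case: ifP => _; last by rewrite mul0r normr0.
by rewrite mul1r gtr0_norm ?rVbump_gt0.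
Qed.

Lemma cellU A B : measurable A -> measurable B -> [disjoint A & B] ->
  cell (A `|` B) = cell A + cell B.
Proof.
move=> mA mB AB; rewrite -[X in X + _]scale1r.
rewrite -to_wLpP; [|exact: cell_mem..].
congr to_wLp; apply/funext => x; rewrite !fctE [1 *: _]mul1r -mulrDl; congr (_ * _).
rewrite !indicE in_setU.
case: (boolP (x \in A)) => xA; case: (boolP (x \in B)) => xB //=; rewrite ?addr0 ?add0r//.
move/disj_set2P : AB => AB; have : (A `&` B) x by split; exact: set_mem.
by rewrite AB.
Qed.

Section functional.
Context (l : ndual L1).

Let s (A : set E) : \bar R := (l (cell A))%:E.

Let s_le A : measurable A -> (`|s A| <= `|l|%:E * m A)%E.
Proof.
by move=> mA; rewrite -cell_norm// -EFinM lee_fin ndual_ler_norm.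
Qed.

Let s0 : s set0 = 0%E.
Proof.
apply/eqP; rewrite -abse_eq0 eq_le abse_ge0 andbT (le_trans (s_le _))//.
by rewrite measure0 mule0.
Qed.

Let sU A B : measurable A -> measurable B -> [disjoint A & B] ->
  s (A `|` B) = (s A + s B)%E.
Proof. by move=> mA mB AB; rewrite /s cellU// linearD EFinD. Qed.

Let s_additive (F : (set E)^nat) n : (forall i, measurable (F i)) -> trivIset setT F ->
  (\sum_(0 <= i < n) s (F i) = s (\big[setU/set0]_(i < n) F i))%E.
Proof.
move=> mF tF; elim: n => [|n IH]; first by rewrite big_nil big_ord0 s0.
rewrite big_nat_recr//= IH big_ord_recr/= sU//; first exact: bigsetU_measurable.
apply/disj_set2P; rewrite -bigcup_mkord setI_bigcupl bigcup0// => i /= ni.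
by have /trivIsetP := tF; apply => //; rewrite neq_ltn ni.
Qed.

(** The remainder of the series is the value of s on a tail set, at most |l| times its m-measure;
    that tends to 0 because m is finite. *)
Let s_sigma_additive : semi_sigma_additive s.
Proof.
move=> F mF tF mUF.
have mU n : measurable (\big[setU/set0]_(i < n) F i) by exact: bigsetU_measurable.
have UF n : \big[setU/set0]_(i < n) F i `<=` \bigcup_i F i.
  by rewrite -bigcup_mkord => x [i _ Fx]; exists i.
have sD n : (s (\bigcup_i F i) - \sum_(0 <= i < n) s (F i) =
    s ((\bigcup_i F i) `\` \big[setU/set0]_(i < n) F i))%E.
  rewrite s_additive// -[in LHS](setDUK (UF n)) sU//; last 2 first.
  - exact: measurableD.
  - by apply/disj_set2P; rewrite setDIK.
  by rewrite addeAC subee// add0e.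
have mD n : (m ((\bigcup_i F i) `\` \big[setU/set0]_(i < n) F i) =
    m (\bigcup_i F i) - \sum_(0 <= i < n) m (F i))%E.
  rewrite measureD//; last by rewrite ltey_eq m_fin.
  congr (_ - _)%E; rewrite setIidr//.
  by rewrite big_mkord; exact: measure_bigsetU.
have cm : (fun n => m (\bigcup_i F i) - \sum_(0 <= i < n) m (F i))%E @ \oo --> 0%E.
  rewrite -[X in _ --> X](subee (m_fin mUF)); apply: cvgeB => //.
    by rewrite fin_num_adde_defl// fin_numN m_fin.
  by apply: cvg_cst.
  exact: measure_semi_sigma_additive.
have le_s n : (`|\sum_(0 <= i < n) s (F i) - s (\bigcup_i F i)| <=
    `|l|%:E * (m (\bigcup_i F i) - \sum_(0 <= i < n) m (F i)))%E.
  rewrite -mD -abseN fin_num_oppeB// addeC sD; apply: s_le; exact: measurableD.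
apply/sube_cvg0; first by [].
apply/cvg_abse0P.
apply: (@squeeze_cvge _ _ _ _ (cst 0%E) _ (fun n => `|l|%:E *
   (m (\bigcup_i F i) - \sum_(0 <= i < n) m (F i)))%E).
- by apply: nearW => n; rewrite abse_ge0; exact: le_s.
- exact: cvg_cst.
- by rewrite -[X in _ --> X](mule0 `|l|%:E); apply: cvgeZl.
Qed.

HB.instance Definition _ := isCharge.Build _ _ _ s s0 (fun _ _ => erefl) s_sigma_additive.

(** The bound |s A| <= |l| m A gives absolute continuity, hence a Radon-Nikodym density. Applied to
    s and to -s on every measurable set, it also bounds the density pointwise. *)
Lemma L1_dual_density : exists f : E -> R,
  [/\ mu.-integrable setT (EFin \o f),
      forall A, measurable A -> ((l (cell A))%:E = \int[mu]_(x in A) (f x)%:E)%E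
    & {ae mu, forall x, `|f x| <= `|l| * rVbump x}].
Proof.
have smu : null_dominates mu s.
  move=> N N0 A mA AN; apply/eqP; rewrite -abse_eq0 eq_le abse_ge0 andbT (le_trans (s_le mA))//.
  rewrite (_ : m A = 0%E) ?mule0//; apply: null_set_integral; [exact: mA|exact: measurable_funTS|exact: (N0 A mA AN)].
pose F := Radon_Nikodym s mu.
have Ff x : F x = (fine (F x))%:E by rewrite fineK// Radon_Nikodym_fin_num.
have iF : mu.-integrable setT (EFin \o (fine \o F)).
  by apply: eq_integrable (Radon_Nikodym_integrable smu) => // x _; rewrite /= -Ff.
have sF A : measurable A -> (s A = \int[mu]_(x in A) (fine (F x))%:E)%E.
  by move=> mA; rewrite (Radon_Nikodym_integral smu mA); apply: eq_integral => x _; rewrite -Ff.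
have im : mu.-integrable setT (EFin \o (fun x => `|l| * rVbump x)).
  exact: (integrableZl measurableT `|l| (integrable_rVbump R d)).
have mE A : measurable A -> (\int[mu]_(x in A) (`|l| * rVbump x)%:E = `|l|%:E * m A)%E.
  move=> mA; under eq_integral do rewrite EFinM.
  rewrite ge0_integralZl//; [exact: measurable_funTS|by move=> x _; exact: rVbump_ge0].
exists (fine \o F); split => //.
have h1 : {ae mu, forall x, fine (F x) <= `|l| * rVbump x}.
  apply: ae_le_of_integral => // A mA; rewrite -sF// mE//.
  by rewrite (le_trans (lee_abs _))// s_le.
have h2 : {ae mu, forall x, - fine (F x) <= `|l| * rVbump x}.
  apply: (ae_le_of_integral (f := fun x => - fine (F x))) => //.
    have := integrableN iF; congr integrable.
  move=> A mA; under eq_integral do rewrite EFinN.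
  rewrite integralN//=; last first.
    apply: fin_num_adde_defl; rewrite fin_numN; apply: integrable_fin_num => //.
    apply: (integrableS measurableT) => //; exact: (integrable_funeneg measurableT iF).
  by rewrite -sF// mE// (le_trans (lee_abs _))// abseN s_le.
by apply: filterS2 h1 h2 => x h1 h2; rewrite /= ler_norml h1 lerNl h2.
Qed.

(** Combinations of cells are dense in L_{1,-a}: the difference D of the functionals is shown to
    vanish on weighted simple functions, then on nonnegative functions, then on differences of
    these. *)
Lemma continuous_eq_on_cells (l' : ndual L1) :
  (forall A, measurable A -> l (cell A) = l' (cell A)) -> l = l'.
Proof.
move=> ll'; apply/eqP; rewrite -subr_eq0; apply/eqP.
pose D := l - l'.
have DP c u v : D (c *: u + v) = c * D u + D v by exact: cdual_linear.
have D0 A : measurable A -> D (cell A) = 0.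
  by move=> mA; rewrite (_ : D _ = l (cell A) - l' (cell A))// ll'// subrr.
rewrite -/D; move: D DP D0 => D DP D0.
have simple (r : seq (R * set E)) : (forall z, z \in r -> measurable z.2) ->
    (fun x => (\sum_(z <- r) z.1 * \1_z.2 x) * cell_weight x) \in wLfun_pred 1%:E (- a) /\
    D (to_wLp _ _ (fun x => (\sum_(z <- r) z.1 * \1_z.2 x) * cell_weight x)) = 0.
  elim: r => [|[c A] r IH] mr.
    rewrite (_ : (fun _ => _) = 0).
      split; first exact: (wLfun_submod_closed d (lexx 1%:E) (- a)).1.
      by rewrite to_wLp0 linear0.
    by apply/funext => x; rewrite big_nil mul0r.
  have [|P1 D1] := IH; first by move=> z zr; apply: mr; rewrite inE zr orbT.
  have mA : measurable A by have := mr (c, A); apply; rewrite mem_head.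
  rewrite (_ : (fun _ => _) = c *: (fun x => \1_A x * cell_weight x) +
     (fun x => (\sum_(z <- r) z.1 * \1_z.2 x) * cell_weight x)); last first.
    by apply/funext => x; rewrite big_cons !fctE /= mulrDl -mulrA.
  split; first by apply: (wLfun_submod_closed d (lexx 1%:E) (- a)).2 => //; exact: cell_mem.
  by rewrite to_wLpP//; [rewrite DP D1 D0// mulr0 addr0|exact: cell_mem].
have nonneg (g : E -> R) : g \in wLfun_pred 1%:E (- a) -> (forall x, 0 <= g x) ->
    D (to_wLp _ _ g) = 0.
  (* Simple functions approximate g / [cell_weight] from below. Multiplied back by the weight they
     are combinations of cells lying below g, and dominated convergence gives convergence in
     norm. *)
  move=> gP g0; pose u x := (g x / cell_weight x)%:E.
  have mg : measurable_fun setT g by move: gP => /andP[]; rewrite inE.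
  have mu' : measurable_fun setT u.
    by apply/measurable_EFinP; apply: measurable_funM => //; exact: measurable_cell_weightV.
  have u0 x : (0 <= u x)%E by rewrite lee_fin divr_ge0// ltW// cell_weight_gt0.
  pose s_ n := nnsfun_approx measurableT mu' n.
  pose k n x := s_ n x * cell_weight x.
  have kP n : k n \in wLfun_pred 1%:E (- a) /\ D (to_wLp _ _ (k n)) = 0.
    pose r := [seq (y, s_ n @^-1` [set y]) | y <- finmap.enum_fset (fset_set (range (s_ n)))].
    have -> : k n = (fun x => (\sum_(z <- r) z.1 * \1_z.2 x) * cell_weight x).
      apply/funext => x; rewrite /k /r big_map; congr (_ * _).
      by rewrite fimfunE fsbig_finite.
    by apply: simple => z /mapP[y _ ->] /=; exact: measurable_sfunP.
  have le n x : k n x <= g x.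
    rewrite /k -ler_pdivlMr ?cell_weight_gt0// -lee_fin /s_ nnsfun_approxE.
    exact: le_approx.
  have k0 n x : 0 <= k n x by rewrite mulr_ge0// ltW// cell_weight_gt0.
  have kg x : k n x @[n --> \oo] --> g x.
    rewrite -[g x](@divfK _ (cell_weight x)) ?gt_eqF ?cell_weight_gt0//.
    apply: cvgM; last exact: cvg_cst.
    have := @cvg_approx _ _ _ setT u x (fun x _ => u0 x) Logic.I (ltry _).
    by rewrite /s_; under eq_fun do rewrite -nnsfun_approxE.
  have ig : mu.-integrable setT (fun x => (wt (- a) x * g x)%:E).
    by move: gP => /andP[_] /Lfun1_integrable.
  have mk n : measurable_fun setT (k n) by have [/andP[+ _] _] := kP n; rewrite inE.
  pose e n := -1 *: k n + g.
  have eP n : e n \in wLfun_pred 1%:E (- a).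
    by apply: (wLfun_submod_closed d (lexx 1%:E) (- a)).2 => //; case: (kP n).
  have eE n x : e n x = g x - k n x by rewrite /e !fctE [_ *: _]mulN1r addrC.
  have me n : measurable_fun setT (fun x => `|wt (- a) x * e n x|%:E).
    apply/measurable_EFinP; apply: measurableT_comp => //; apply: measurable_funM.
      exact: measurable_wt.
    by have /andP[+ _] := eP n; rewrite inE.
  have ce x : `|wt (- a) x * e n x|%:E @[n --> \oo] --> (0 : \bar R)%E.
    apply: cvg_EFin; first exact: nearW.
    have h : wt (- a) x * e n x @[n --> \oo] --> wt (- a) x * (g x - g x).
      by apply: cvgMl_tmp; under eq_fun do rewrite eE; apply: cvgB (kg x); exact: cvg_cst.
    rewrite subrr mulr0 in h; have := cvg_norm h; rewrite normr0 => hn.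
    exact: hn.
  have le_e n x : (`| `|wt (- a) x * e n x|%:E | <= (wt (- a) x * g x)%:E)%E.
    rewrite /= lee_fin normr_id normrM gtr0_norm ?wt_gt0//.
    rewrite (ler_wpM2l (ltW (wt_gt0 _ _)))//.
    by rewrite eE ger0_norm ?subr_ge0// gerBl.
  have [_ _] := @dominated_convergence _ _ _ mu setT measurableT _ (cst 0%E) _ me
     (measurable_cst _) (aeW _ (fun x _ => ce x)) ig (aeW _ (fun x n _ => le_e n x)).
  rewrite integral0 => h.
  have {}h : `|to_wLp (lexx 1%:E) (- a) (e n)| @[n --> \oo] --> (0 : R).
    rewrite (_ : (fun _ => _) = fine \o [sequence (\int[mu]_x `|wt (- a) x * e n x|%:E)%E]_n).
      exact: fine_cvg h.
    by apply/funext => n /=; rewrite -L1_norm_mk.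
  have Dle n : `|D (to_wLp _ _ g)| <= `|D| * `|to_wLp (lexx 1%:E) (- a) (e n)|.
    have -> : D (to_wLp _ _ g) = D (to_wLp _ _ (e n)).
      by have [P1 D1] := kP n; rewrite to_wLpP// DP D1 mulr0 add0r.
    exact: ndual_ler_norm.
  apply/eqP; rewrite -normr_le0 -(mulr0 `|D|).
  have hD : `|D| * `|to_wLp (lexx 1%:E) (- a) (e n)| @[n --> \oo] --> `|D| * (0 : R).
    exact: cvgMl_tmp h.
  by apply: (cvgr_to_ge hD); apply: nearW.
apply/val_inj/funext => f /=.
(* From here on a representative F of the class f is split into its positive part p and negative
   part q. *)
pose F := wLp_fun f.
have mF : measurable_fun setT F := measurable_wLp f.
have iF := L1_fun_integrable f.
pose p x := Num.max (F x) 0; pose q x := Num.max (- F x) 0.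
have mp : measurable_fun setT p by exact: measurable_maxr.
have mq : measurable_fun setT q by apply: measurable_maxr => //; exact: measurableT_comp.
have le (h : E -> R) : measurable_fun setT h -> (forall x, `|h x| <= `|F x|) ->
    h \in wLfun_pred 1%:E (- a).
  move=> mh hF; apply: mem_L1 => //; apply: le_integrable iF => //.
    by apply/measurable_EFinP; apply: measurable_funM => //; exact: measurable_wt.
  by move=> x _; rewrite /= lee_fin !normrM ler_wpM2l.
have pP : p \in wLfun_pred 1%:E (- a).
  by apply: le => // x; rewrite /p; case: (leP (F x) 0) => h; rewrite ?normr0.
have qP : q \in wLfun_pred 1%:E (- a).
  by apply: le => // x; rewrite /q; case: (leP (- F x) 0) => h; rewrite ?normr0 ?normrN.
have -> : f = to_wLp _ _ (-1 *: q + p).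
  apply: wLp_eq; apply: ae_eq_sym; apply: ae_eq_trans (wLp_funE _ _) _.
    exact: (wLfun_submod_closed d (lexx 1%:E) (- a)).2.
  rewrite (_ : _ + p = F); first exact: ae_eq_refl.
  apply/funext => x; rewrite !fctE [_ *: _]mulN1r /p /q.
  case: (leP (F x) 0) => h.
    have /max_idPl -> : 0 <= - F x by rewrite oppr_ge0.
    by rewrite opprK addr0.
  have /max_idPr -> : - F x <= 0 by rewrite oppr_le0 ltW.
  by rewrite oppr0 add0r.
rewrite to_wLpP// -[LHS]/(D _) DP !nonneg ?mulr0 ?addr0// => x.
  by rewrite /p le_max lexx orbT.
by rewrite /q le_max lexx orbT.
Qed.
End functional.

Lemma Loo_ndual (h : Loo) : exists l : ndual L1, forall g : L1, l g = pairing h g.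
Proof.
apply: (mk_ndual (c := `|h|)) => [b u v|g]; last exact: pairing_le.
exact: pairing_linearr.
Qed.

(** The function is the density of l divided by [cell_weight]. Multiplied by [wt a] it becomes the
    density over [rVbump], which is bounded by |l|. *)
Lemma L1_dual_Loo (l : ndual L1) :
  exists h : Loo, (forall g : L1, l g = pairing h g) /\ `|h| <= `|l|.
Proof.
have [f [intf fE fle]] := L1_dual_density l.
pose k x := f x / cell_weight x.
have mk : measurable_fun setT k.
  apply: measurable_funM; last exact: measurable_cell_weightV.
  by apply/measurable_EFinP; exact: measurable_int intf.
have kle : {ae mu, forall x, `|wt a x * k x| <= `|l|}.
  apply: filterS fle => x fx; rewrite /k /cell_weight mulrCA invfM mulVKf ?gt_eqF ?wt_gt0//.
  by rewrite normrM normfV (gtr0_norm (rVbump_gt0 _)) ler_pdivrMr ?rVbump_gt0.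
have kP := mem_Loo mk kle.
exists (to_wLp _ _ k).
have kE := wLp_funE (leey 1%:E) kP.
split; last first.
  by apply: Loo_norm_le => //; apply: filterS2 kle kE => x h /(_ Logic.I) ->.
have [l' l'E] := Loo_ndual (to_wLp _ _ k).
suff -> : l = l' by exact: l'E.
apply: continuous_eq_on_cells => A mA; rewrite l'E; apply: EFin_inj; rewrite fE//.
have cP := cell_mem mA.
transitivity (\int[mu]_x ((f x)%:E * (\1_A x)%:E))%E.
  by rewrite integral_mkcond; apply: eq_integral => x _; rewrite patchE indicE;
    case: ifP => _; rewrite ?mule1 ?mule0.
have ifA : mu.-integrable setT (fun x => (f x)%:E * (\1_A x)%:E)%E.
  apply: le_integrable (intf) => //.
    apply: emeasurable_funM; first exact: measurable_int intf.
    by apply/measurable_EFinP; exact: measurable_indic.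
  by move=> x _; rewrite /= lee_fin normrM ler_piMr// ger0_norm// indicE; case: (_ \in _).
rewrite /pairing /Rintegral fineK; last exact: (integrable_fin_num _ (pairing_integrable _ _)).
apply: ae_eq_integral => //.
- exact: measurable_int ifA.
- exact: measurable_int (pairing_integrable _ _).
apply: filterS2 kE (wLp_funE (lexx 1%:E) cP) => x kx cx xT.
rewrite kx// cx// -EFinM; congr EFin.
by rewrite [RHS]mulrCA /k divfK 1?mulrC// gt_eqF// cell_weight_gt0.
Qed.

Lemma Loo_eq0 (f : Loo) : (forall phi : schwartz R d, pairing f phi = 0) -> f = 0.
Proof.
move=> f0; apply: wLp_eq.
have ae0 : {ae mu, forall x, f x = 0}.
  apply: du_bois_reymond.
  - exact: measurable_wLp.
  (* The weight is itself a Schwartz function, so its product with f is integrable by the duality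
     pairing. *)
  - have [w tw wE] : exists2 w : schwartz R d, logi_test w & forall x, w x = logi_weight x.
      have t1 : logi_test (@logi_weight R d * cst 1) by exists (cst 1) => //; exact: logi_cst.
      exists (Schwartz (logi_test_schwartz t1)) => // x.
      by rewrite /= !fctE mulr1.
    apply: ae_eq_integrable (pairing_integrable f (schwartz_toL1 a w)).
      apply/measurable_EFinP; apply: measurable_funM; first exact: measurable_wLp.
      rewrite -(_ : (w : E -> R) = @logi_weight R d); first exact: measurable_schwartz.
      exact/funext.
    by apply: filterS (schwartz_toL1E a w) => x wx _; rewrite wx// wE.
  - by move=> phi tphi; exact: (f0 (Schwartz (logi_test_schwartz tphi))).
by apply: filterS2 ae0 (wLp_fun0 d (leey 1%:E) a) => x -> /[swap] xT ->.
Qed.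
End L1_dual.

Lemma cvg_initial (S : choiceType) (T : topologicalType) (f : S -> T)
    (F : set_system S) (s : S) : Filter F ->
  f @ F --> f s -> F --> (s : initial_topology f).
Proof.
by move=> FF Ff A [_ [[B Bop <-] Bs BA]]; apply: filterS BA _; apply: Ff; exact: open_nbhs_nbhs.
Qed.

(** * The topologies of S and S' *)

Section schwartz_topology.
Context (R : realType) (d : nat).
Local Notation E := 'rV[R]_d.
Local Notation S := (schwartz R d).
Local Notation S' := (tempered R d).

Lemma schwartz_jetP (b : R) (f g : S) ks x :
  schwartz_jet (b *: f + g) ks x = b * schwartz_jet f ks x + schwartz_jet g ks x.
Proof.
have /asboolP[df _] := valP f; have /asboolP[dg _] := valP g.
rewrite /schwartz_jet (_ : schwartz_fun (b *: f + g) = b *: schwartz_fun f + schwartz_fun g)//.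
rewrite pderivD//.
by rewrite !fctE mulrDr /GRing.scale/= mulrCA.
Qed.

Lemma schwartz_jetZ (b : R) (f : S) ks x :
  schwartz_jet (b *: f) ks x = b * schwartz_jet f ks x.
Proof.
have h0 : schwartz_jet (0 : S) ks x = 0.
  have := schwartz_jetP (-1) 0 0 ks x.
  by rewrite scaler0 addr0 mulN1r addNr.
by rewrite -[b *: f]addr0 schwartz_jetP h0 addr0.
Qed.

Lemma schwartz_jetB (f g : S) ks x :
  schwartz_jet (f - g) ks x = schwartz_jet f ks x - schwartz_jet g ks x.
Proof. by rewrite addrC -scaleN1r schwartz_jetP mulN1r addrC. Qed.

Lemma nbhs_schwartz_seminorm (f : S) ks (e : R) : 0 < e ->
  nbhs f [set g | forall x, `|schwartz_jet (f - g) ks x| < e].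
Proof.
move=> e0.
have ? : Filter (nbhs f) by exact: nbhs_filter.
have c1 : @schwartz_jet R d @ nbhs f --> schwartz_jet f by exact: initial_continuous.
have c2 := @proj_continuous _ (fun _ : nat * seq 'I_d => {uniform E -> R}) ks (schwartz_jet f).
have : nbhs (schwartz_jet f ks : {uniform E -> R})
    [set h | forall x, `|schwartz_jet f ks x - h x| < e].
  apply/uniform_nbhs; exists [set xy | ball xy.1 e xy.2].
  split; first by rewrite -entourage_ballE; exists e.
  by move=> h hx x; have := hx x Logic.I; rewrite /= -ball_normE.
move=> /c2 /c1 h; apply: (@filterS _ (nbhs f) _ _ _ _ h) => g gx x.
by rewrite schwartz_jetB; exact: gx.
Qed.

(** The index k bounds both the [pickle] codes of the seminorms involved and, through 1/(k+1), their
    size. The sets decrease and every neighbourhood of 0 contains one of them; countability is what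
    Baire needs. *)
Definition schwartz_base (k : nat) : set S :=
  [set f | forall ks, (pickle ks <= k)%N -> forall x, `|schwartz_jet f ks x| <= k.+1%:R^-1].

(** By homogeneity: if phi - psi divided by r = e / (|C| + 1) lies in the base set, then f moves by
    at most r C <= e. *)
Lemma schwartz_linear_continuous (V : normedModType R) (f : {linear S -> V}) (k : nat) (C : R) :
  (forall phi, schwartz_base k phi -> `|f phi| <= C) -> continuous f.
Proof.
move=> fC phi; apply/(@cvgrPdist_le _ V _ (nbhs phi)) => e e0.
have C0 : 0 < `|C| + 1 by rewrite ltr_wpDl.
pose r := e / (`|C| + 1); have r0 : 0 < r by rewrite divr_gt0.
have k0 : 0 < r / k.+1%:R by rewrite divr_gt0.
(* The finitely many seminorms are imposed together by letting j run through the codes up to k; a j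
   that codes nothing imposes no condition. *)
pose P (j : 'I_k.+1) (psi : S) := forall ks, unpickle j = Some ks ->
    forall x, `|schwartz_jet (phi - psi) ks x| < r / k.+1%:R.
have ? : Filter (nbhs phi) by exact: nbhs_filter.
have : \forall psi \near phi, forall j, P j psi.
  apply: (@filter_forall _ _ P (nbhs phi)) => j; rewrite /P; case: (unpickle j) => [ks|]; last exact: nearW.
  by apply: filterS (nbhs_schwartz_seminorm phi ks k0) => psi h _ [<-].
apply: filterS => psi h.
have : schwartz_base k (r^-1 *: (phi - psi)).
  move=> ks ksk x; rewrite schwartz_jetZ normrM normfV (gtr0_norm r0) ler_pdivrMl//.
  apply/ltW; apply: (h (Ordinal (ksk : (pickle ks < k.+1)%N))).
  by rewrite pickleK.
move=> /fC; rewrite linearZ linearB normrZ normfV (gtr0_norm r0) ler_pdivrMl// => /le_trans; apply.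
rewrite /r mulrAC ler_pdivrMr//; apply: ler_wpM2l; first exact: ltW.
by rewrite (le_trans (ler_norm C))// lerDl.
Qed.

(** Equivalently, the filter generated by the base sets converges to 0; the initial and product
    topologies reduce this to one seminorm at a time. *)
Lemma schwartz_nbhs0 (A : set S) : nbhs 0 A -> exists k, schwartz_base k `<=` A.
Proof.
pose F : set_system S := [set B | exists k, schwartz_base k `<=` B].
have Fbase k l : (k <= l)%N -> schwartz_base l `<=` schwartz_base k.
  move=> kl f fl ks ksk x; rewrite (le_trans (fl ks (leq_trans ksk kl) x))//.
  by rewrite lef_pV2 ?posrE// ler_nat.
have FF : Filter F.
  split; first by exists 0%N.
    move=> P Q [k kP] [l lQ]; exists (maxn k l) => f fkl; split.
      by apply: kP; apply: Fbase fkl; exact: leq_maxl.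
    by apply: lQ; apply: Fbase fkl; exact: leq_maxr.
  by move=> P Q PQ [k kP]; exists k; exact: subset_trans PQ.
suff : F --> (0 : S) by apply.
apply: cvg_initial; apply/cvg_sup => ks; apply: cvg_initial.
move=> B /uniform_nbhs[U []]; rewrite -entourage_ballE => -[e /= e0 eU] UB.
apply: filterS UB _.
have [n ne] : exists n, n.+1%:R^-1 < e.
  exists (Num.truncn e^-1); rewrite -ltf_pV2 ?posrE ?invr_gt0//.
  by rewrite invrK truncnS_gt.
exists (maxn (pickle ks) n) => f fb x _; apply: eU => /=.
rewrite -ball_normE /=.
have -> : schwartz_jet (0 : S) ks x = 0.
  by rewrite -(scale0r 0) schwartz_jetZ mul0r.
rewrite sub0r normrN (le_lt_trans (fb ks _ x)) ?leq_maxl// (le_lt_trans _ ne)//.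
by rewrite lef_pV2 ?posrE// ler_nat ltnS leq_maxr.
Qed.

Lemma tempered_eval_continuous (phi : S) : continuous (fun T : S' => T phi).
Proof.
move=> T.
have c1 : (fun f : S' => (f : {ptws S -> R})) @ nbhs T --> (T : {ptws S -> R}).
  exact: initial_continuous.
by have /pointwise_cvgP/(_ phi) := c1.
Qed.

Lemma tempered_continuous (V : topologicalType) (f : V -> S') :
  (forall phi, continuous (fun v => f v phi)) -> continuous f.
Proof.
move=> cf v; apply: cvg_initial; apply/pointwise_cvgP => phi.
exact: cf.
Qed.

(** The sets A k are closed, and they cover X because each g is a continuous functional on S, hence
    bounded by 1 on some base set. By Baire one of them contains a ball. *)
Lemma schwartz_banach_equicontinuous (X : schwartz_banach R d) :
  exists k (C : R), 0 <= C /\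
    forall phi, schwartz_base k phi -> forall g : X, `|sb_emb X g phi| <= C * `|g|.
Proof.
pose A k := [set g : X | forall phi, schwartz_base k phi -> `|sb_emb X g phi| <= 1].
have cE phi : continuous (fun g : X => sb_emb X g phi).
  move=> g; apply: (@continuous_comp _ _ _ (sb_emb X) (fun T : S' => T phi)).
    exact: sb_emb_continuous.
  exact: tempered_eval_continuous.
have clA k : closed (A k).
  rewrite (_ : A k = \bigcap_(phi in schwartz_base k)
     ((fun g : X => `|sb_emb X g phi|) @^-1` [set r | r <= 1])).
    apply: closed_bigI => phi _; apply: closed_comp; last exact: closed_le.
    move=> g _; apply: (@continuous_comp _ _ _ (fun g : X => sb_emb X g phi) Num.norm).
      exact: cE.
    exact: norm_continuous.
  by apply/seteqP; split=> g h phi; exact: h.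
have [k [g0 [r r0 rA]]] : exists k g0, exists2 r : R, 0 < r & ball (g0 : X) r `<=` A k.
  apply: contrapT => nA.
  have /(_ setT) : dense (\bigcap_k (~` A k)).
    apply: Baire => k; split; first by rewrite openC.
    move=> O [g Og] oO; apply: contrapT => nO; apply: nA.
    move: oO; rewrite openE => /(_ _ Og)/nbhs_ballP[r /= r0 rO].
    exists k, g; exists r => // h gh; apply: contrapT => nh; apply: nO.
    by exists h; split => //; exact: rO.
  case; [by exists 0|exact: openT|move=> g [_ gA]].
  have : nbhs (0 : S) [set phi | `|sb_emb X g phi| <= 1].
    have := @cdual_continuous _ _ (sb_emb X g) 0.
    move=> /cvgrPdist_le/(_ 1 ltr01); apply: filterS => phi /=.
    by rewrite linear0 sub0r normrN.
  move=> /schwartz_nbhs0[k kg]; apply: (gA k Logic.I) => phi; exact: kg.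
(* Moving the centre g0 by c g, of norm r / 2, stays in the ball, so c times the value at g is a
   difference of two numbers of modulus at most 1; and 2 / c = 4 |g| / r. *)
exists k, (4 / r); split; first by rewrite divr_ge0// ltW.
move=> phi kphi g.
have [->|gn] := eqVneq g 0.
  have -> : sb_emb X 0 phi = 0 by rewrite linear0.
  by rewrite !normr0 mulr0.
have ng : 0 < `|g| by rewrite normr_gt0.
pose c := r / (2 * `|g|); have c0 : 0 < c by rewrite divr_gt0// mulr_gt0.
have h1 : `|sb_emb X (g0 + c *: g) phi| <= 1.
  apply: rA => //; rewrite -ball_normE /= opprD addrA subrr sub0r normrN normrZ gtr0_norm//.
  by rewrite /c -mulrA invfM -mulrA mulVf ?gt_eqF// mulr1 ltr_pdivrMr// ltr_pMr// ltr1n.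
have h2 : `|sb_emb X g0 phi| <= 1 by apply: rA => //; exact: ballxx.
have h3 : c * `|sb_emb X g phi| <= 2.
  rewrite -(gtr0_norm c0) -normrM.
  have -> : c * sb_emb X g phi = sb_emb X (g0 + c *: g) phi - sb_emb X g0 phi.
    by rewrite linearD linearZ /= addrAC subrr add0r.
  by rewrite (le_trans (ler_normB _ _))// [leRHS](_ : 2 = 1 + 1)// lerD.
rewrite -(ler_pM2l c0) (le_trans h3)//.
by rewrite le_eqVlt; apply/orP; left; apply/eqP; rewrite /c; field; rewrite !gt_eqF.
Qed.

Lemma schwartz_eq0 (phi : S) : pairing phi phi = 0 -> phi = 0.
Proof.
move=> phi0; apply/val_inj; apply: continuous_ae0; first exact: schwartz_continuous.
have mphi := measurable_schwartz phi.
have ip : (lebesgue_rV R d).-integrable setT (fun x => (phi x * phi x)%:E).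
  apply: ae_eq_integrable (pairing_integrable (schwartz_toLoo 0 phi) (schwartz_toL1 0 phi)).
    by apply/measurable_EFinP; exact: measurable_funM.
  apply: filterS2 (schwartz_toLooE 0 phi) (schwartz_toL1E 0 phi) => x h1 h2 xT.
  by rewrite h1// h2.
have /(ae_eq_integral_abs _ measurableT) : (\int[lebesgue_rV R d]_x `|(phi x * phi x)%:E| = 0)%E.
  under eq_integral do rewrite gee0_abs ?lee_fin -?expr2 ?sqr_ge0//.
  have fI := integrable_fin_num measurableT ip.
  transitivity (\int[lebesgue_rV R d]_x (phi x * phi x)%:E)%E.
    by apply: eq_integral => x _; rewrite expr2.
  by rewrite -(fineK fI); congr EFin; exact: phi0.
move=> /(_ (measurable_int _ ip)); apply: filterS => x /(_ Logic.I) /eqP.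
by rewrite eqe mulf_eq0 orbb => /eqP.
Qed.

Lemma pairing_schwartzP (a : R) (f : 'Loo_(R, d, a)) (b : R) (phi psi : S) :
  pairing f (b *: phi + psi) = b * pairing f phi + pairing f psi.
Proof. by rewrite -!pairing_toL1 schwartz_toL1P pairing_linearr. Qed.

Lemma pairing_schwartz_linearl (b : R) (phi psi chi : S) :
  pairing (b *: phi + psi : S) chi = b * pairing phi chi + pairing psi chi.
Proof. by rewrite -!(pairing_schwartz 0) schwartz_toLooP pairing_linearl. Qed.

Lemma pairing_schwartz_linearr (b : R) (phi psi chi : S) :
  pairing chi (b *: phi + psi : S) = b * pairing chi phi + pairing chi psi.
Proof. by rewrite ![pairing chi _]pairingC pairing_schwartz_linearl. Qed.

(* [f] lies in the span of [r], expressed by duality: every linear functional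
   vanishing on [r] vanishes at [f]. *)
Definition in_span (r : seq S) (f : S) : Prop :=
  forall T : S -> R, linear (T : S -> R^o) -> (forall g, g \in r -> T g = 0) -> T f = 0.

(** Gram-Schmidt for the L^2 product on S: a functional restricted to a finite-dimensional subspace
    is the product with a vector of that subspace. *)
Lemma schwartz_interpolation (r : seq S) (T : S -> R) : linear (T : S -> R^o) ->
  exists2 f : S, in_span r f & forall g, g \in r -> pairing f g = T g.
Proof.
elim: r T => [|phi r IH] T lT.
  exists 0 => // U lU _.
  by have := lU (-1) 0 0; rewrite scaler0 addr0 scaleN1r addNr.
have [f sf fT] := IH T lT.
have lphi : linear (pairing phi : S -> R^o).
  by move=> b u v; exact: pairing_schwartz_linearr.
(* This psi is the orthogonal projection of phi on the span of r. *)
have [psi spsi psiE] := IH (fun g => pairing phi g) lphi.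
have sub g : in_span r g -> in_span (phi :: r) g.
  by move=> sg U lU U0; apply: sg => // h hr; apply: U0; rewrite inE hr orbT.
have hr g : in_span r g -> pairing (phi - psi) g = 0.
  move=> sg; have lh : linear (pairing (phi - psi : S) : S -> R^o).
    by move=> b u v; exact: pairing_schwartz_linearr.
  apply: (sg _ lh) => k kr; rewrite -[phi - psi]scale1r -[1 *: _]addr0.
  rewrite [phi - psi]addrC -scaleN1r scale1r addr0 pairing_schwartz_linearl.
  by rewrite psiE// mulN1r addNr.
have sphi : in_span (phi :: r) phi by move=> U _; apply; rewrite mem_head.
have memr g : g \in r -> in_span r g by move=> gr U _; exact.
have spanP (b : R) u v : in_span (phi :: r) u -> in_span (phi :: r) v -> in_span (phi :: r) (b *: u + v).
  by move=> su sv U lU U0; rewrite lU su// sv// addr0 scaler0.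
(* If the difference vanishes, phi depends on r and linearity forces the value there. Otherwise the
   difference is orthogonal to r but not to phi, and a multiple of it corrects f at phi alone. *)
have [h0|h0] := eqVneq (phi - psi) 0.
  have phiE : phi = psi by apply/eqP; rewrite -subr_eq0 h0.
  exists f; first exact: sub.
  move=> g; rewrite inE => /orP[/eqP ->|]; last exact: fT.
  rewrite phiE; apply/eqP; rewrite -subr_eq0; apply/eqP.
  have lU : linear ((fun g => pairing f g - T g) : S -> R^o).
    move=> b u v; rewrite pairing_schwartz_linearr lT.
    by rewrite /GRing.scale/= mulrBr opprD addrACA.
  by apply: (spsi _ lU) => k kr; rewrite fT// subrr.
pose h := phi - psi.
have hh : pairing h phi != 0.
  apply: contra_neq h0 => hphi; apply: schwartz_eq0.
  have := pairing_schwartz_linearr (-1) psi phi h.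
  by rewrite scaleN1r addrC => ->; rewrite hr// hphi mulr0 addr0.
exists (((T phi - pairing f phi) / pairing h phi) *: h + f).
  apply: (spanP); last exact: sub.
  by rewrite /h addrC -scaleN1r; apply: spanP => //; exact: sub.
move=> g; rewrite pairing_schwartz_linearl inE => /orP[/eqP ->|gr].
  by rewrite divfK// subrK.
have -> : pairing h g = 0 by apply: hr; exact: memr.
by rewrite mulr0 add0r fT.
Qed.

(** A weak-* neighbourhood of T constrains finitely many values only, and interpolation matches
    these by a Schwartz function, which A represents. *)
Lemma dense_tempered (A : set S') :
  (forall f : S, exists2 T : S', A T & forall g : S, T g = pairing f g) -> dense A.
Proof.
move=> hA O [T OT] oO.
pose F : set_system S' := [set B | exists r : seq S,
  [set U | A U /\ forall g, g \in r -> U g = T g] `<=` B].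
have FF : Filter F.
  split; first by exists [::].
    move=> P Q [r rP] [s sQ]; exists (r ++ s) => U [AU UT]; split.
      by apply: rP; split => // g gr; apply: UT; rewrite mem_cat gr.
    by apply: sQ; split => // g gs; apply: UT; rewrite mem_cat gs orbT.
  by move=> P Q PQ [r rP]; exists r; exact: subset_trans PQ.
have FT : F --> T.
  apply: cvg_initial; apply/pointwise_cvgP => phi B /nbhs_singleton BT.
  by exists [:: phi] => U [_ /(_ phi (mem_head _ _)) UT] /=; rewrite UT.
have [r rO] : F O by apply: FT; exact: open_nbhs_nbhs.
have [f _ fT] := schwartz_interpolation r (cdual_linear T).
have [U AU Uf] := hA f.
by exists U; split => //; apply: rO; split => // g gr; rewrite Uf fT.
Qed.
End schwartz_topology.

(** * The pre-native space and its dual *)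

Lemma linear_fun_sum (R : realType) (V W : lmodType R) (T : V -> W) n (c : 'I_n -> R)
    (e : 'I_n -> V) : linear T ->
  T (\sum_(i < n) c i *: e i) = \sum_(i < n) c i *: T (e i).
Proof.
move=> lT; pose F : {linear V -> W} := HB.pack T (GRing.isLinear.Build _ _ _ _ _ lT).
by rewrite [LHS](linear_sum F); apply: eq_bigr => i _; rewrite linearZ.
Qed.

Lemma sum_delta (R : realType) n (c : 'I_n -> R) k :
  \sum_(i < n) c i * (i == k)%:R = c k.
Proof.
rewrite (bigD1 k)//= eqxx mulr1 big1 ?addr0// => i /negbTE ->.
by rewrite mulr0.
Qed.

Lemma span_of_linear (R : realType) (V : lmodType R) n (e : 'I_n -> V) (b : R) u v :
  span_of e u -> span_of e v -> span_of e (b *: u + v).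
Proof.
move=> [c _ <-] [c' _ <-]; exists (fun i => b * c i + c' i) => //.
rewrite scaler_sumr -big_split/=; apply: eq_bigr => i _.
by rewrite scalerA scalerDl.
Qed.

Lemma span_of_gen (R : realType) (V : lmodType R) n (e : 'I_n -> V) i : span_of e (e i).
Proof.
exists (fun k => (k == i)%:R) => //; rewrite (bigD1 i)//= eqxx scale1r big1 ?addr0//.
by move=> k /negbTE ->; rewrite scale0r.
Qed.

Lemma span_of0 (R : realType) (V : lmodType R) n (e : 'I_n -> V) : span_of e 0.
Proof. by exists (fun=> 0) => //; rewrite big1// => i _; rewrite scale0r. Qed.

Lemma norm2_ge0 (R : realType) n (c : 'I_n -> R) : 0 <= norm2 c.
Proof. exact: sqrtr_ge0. Qed.

Lemma norm20 (R : realType) n (c : 'I_n -> R) : (forall i, c i = 0) -> norm2 c = 0.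
Proof. by move=> c0; rewrite /norm2 big1 ?sqrtr0// => i _; rewrite c0 expr0n. Qed.

Lemma norm2_ge (R : realType) n (c : 'I_n -> R) i : `|c i| <= norm2 c.
Proof.
by rewrite -sqrtr_sqr ler_wsqrtr// (bigD1 i)//= lerDl sumr_ge0// => j _; exact: sqr_ge0.
Qed.

Lemma cauchy_schwarz (R : realType) n (b c : 'I_n -> R) :
  \sum_(i < n) b i * c i <= norm2 b * norm2 c.
Proof.
have s0 (e : 'I_n -> R) : 0 <= \sum_(i < n) e i ^+ 2 by apply: sumr_ge0 => i _; exact: sqr_ge0.
have sqn (e : 'I_n -> R) : norm2 e ^+ 2 = \sum_(i < n) e i ^+ 2 by rewrite sqr_sqrtr.
have [b0|b0] := eqVneq (norm2 b) 0.
  rewrite b0 mul0r big1// => i _.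
  by have := norm2_ge b i; rewrite b0 normr_le0 => /eqP ->; rewrite mul0r.
have [c0|c0] := eqVneq (norm2 c) 0.
  rewrite c0 mulr0 big1// => i _.
  by have := norm2_ge c i; rewrite c0 normr_le0 => /eqP ->; rewrite mulr0.
have nb : 0 < norm2 b by rewrite lt_neqAle eq_sym b0 norm2_ge0.
have nc : 0 < norm2 c by rewrite lt_neqAle eq_sym c0 norm2_ge0.
have : 0 <= \sum_(i < n) (norm2 c * b i - norm2 b * c i) ^+ 2.
  by apply: sumr_ge0 => i _; exact: sqr_ge0.
have -> : \sum_(i < n) (norm2 c * b i - norm2 b * c i) ^+ 2 =
    2 * (norm2 b * norm2 c) * (norm2 b * norm2 c - \sum_(i < n) b i * c i).
  transitivity (norm2 c ^+ 2 * \sum_(i < n) b i ^+ 2 + norm2 b ^+ 2 * \sum_(i < n) c i ^+ 2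
      - 2 * (norm2 b * norm2 c) * \sum_(i < n) b i * c i).
    rewrite !mulr_sumr -big_split/= -sumrB; apply: eq_bigr => i _; ring.
  by rewrite -!sqn; ring.
rewrite pmulr_rge0 ?subr_ge0//.
by rewrite !mulr_gt0.
Qed.

Lemma dense_eqlin (R : realType) (V W : normedModType R) (D : set V) (f g : V -> W) :
  dense D -> continuous f -> continuous g -> (forall u, D u -> f u = g u) -> f =1 g.
Proof.
move=> dD cf cg fg x; apply/eqP; rewrite -subr_eq0 -normr_eq0; apply/eqP.
apply: (@dense_eqfun R V D (fun x => `|f x - g x|) (fun=> 0)) => //.
- move=> y; apply: (@continuous_comp _ _ _ (fun x => f x - g x) Num.norm).
    by apply: continuousB; [exact: cf|exact: cg].
  exact: norm_continuous.
- by move=> y; exact: cst_continuous.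
- by move=> u /fg ->; rewrite subrr normr0.
Qed.

Lemma represents_inj (R : realType) (d : nat) (T T' : tempered R d) f :
  represents T f -> represents T' f -> T = T'.
Proof. by move=> Tf T'f; apply/val_inj/funext => phi /=; rewrite Tf T'f. Qed.

Lemma Loo_eq (R : realType) (d : nat) (a : R) (f g : 'Loo_(R, d, a)) :
  (forall phi : schwartz R d, pairing f phi = pairing g phi) -> f = g.
Proof.
move=> fg; apply/eqP; rewrite -subr_eq0; apply/eqP/Loo_eq0 => chi.
have -> : f - g = (-1) *: g + f by rewrite scaleN1r addrC.
by rewrite -pairing_toL1 pairing_linearl !pairing_toL1 fg mulN1r addNr.
Qed.

Section native.
Context (R : realType) (d : nat) (L : {linear schwartz R d -> tempered R d}) (a : R).
Context (X : schwartz_banach R d) (C : compatible L a X).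
Local Notation S := (schwartz R d).
Local Notation S' := (tempered R d).
Local Notation L1 := 'L1_(R, d, a).
Local Notation Loo := 'Loo_(R, d, a).
Local Notation H := (cp_sa C).
Local Notation N0 := (sa_dim H).
Local Notation p := (bs_p (cp_bs C)).
Local Notation phi := (bs_phi (cp_bs C)).
Local Notation j := (sb_in X).
Local Notation toL1 := (schwartz_toL1 a).

Lemma pairing_schwartz_linear (f : Loo) : linear ((fun psi : S => pairing f psi) : S -> R^o).
Proof. by move=> b u v; exact: pairing_schwartzP. Qed.

Lemma pairing_schwartz0 (f : Loo) : pairing f (0 : S) = 0.
Proof. by have := pairing_schwartzP f (-1) 0 0; rewrite scaler0 addr0 mulN1r addNr. Qed.

Lemma pairing_p_Lstar n psi : pairing (p n) (sa_Lstar1 H psi : L1) = 0.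
Proof.
have : span_of p (p n) by exact: span_of_gen.
by rewrite -(bs_p_basis (cp_bs C)).2.
Qed.

Lemma pairing_p_phi (c : 'I_N0 -> R) m :
  pairing (p m) (\sum_(n < N0) c n *: phi n : S) = c m.
Proof.
rewrite (linear_fun_sum c phi (pairing_schwartz_linear (p m))).
rewrite (bigD1 m)//= pairingC bs_biorth eqxx big1 ?addr0; first exact: mulr1.
by move=> n nm; rewrite pairingC bs_biorth (negbTE nm) scaler0.
Qed.

Lemma span_phiE u : span_of phi u -> \sum_(n < N0) pairing (p n) u *: phi n = u.
Proof. by move=> [c _ <-]; apply: eq_bigr => n _; rewrite pairing_p_phi. Qed.

Lemma pairing_p_PL n psi (u : S) :
  pairing (p n) (sa_Lstar1 H psi + toL1 u : L1) = pairing (p n) u.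
Proof.
rewrite -[sa_Lstar1 H psi]scale1r pairing_linearr.
by rewrite pairing_p_Lstar mulr0 add0r pairing_toL1.
Qed.

Lemma Proj_phi_PL psi u : span_of phi u ->
  Proj_phi (cp_bs C) (sa_Lstar1 H psi + toL1 u) = u.
Proof.
move=> su; rewrite -[RHS]span_phiE//; apply: eq_bigr => n _.
by rewrite pairing_p_PL.
Qed.

(** On P_L the projection removes exactly u, and L^{-1*} then inverts L^* on psi. Injectivity of the
    embedding of X turns this identity of distributions into one in X. *)
Lemma stable_PL psi u : span_of phi u ->
  cp_stable C (sa_Lstar1 H psi + toL1 u) = j psi.
Proof.
move=> su; apply: (@sb_emb_inj _ _ X).
apply: represents_inj (cp_stableE C _) _ => chi.
rewrite /Linvstar_phi Proj_phi_PL// addrK sa_LinvstarK sb_inK.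
by rewrite -/(schwartz_toLoo a psi) -[RHS]pairing_toL1 pairing_schwartz.
Qed.

Lemma prenative_norm_PL psi u : span_of phi u ->
  prenative_norm C (sa_Lstar1 H psi + toL1 u) =
  Num.max `|j psi| (norm2 (fun n => pairing (p n) u)).
Proof. by move=> su; rewrite /prenative_norm stable_PL// /pvec Proj_phi_PL. Qed.

Lemma P_L_intro psi u : span_of phi u -> P_L C (sa_Lstar1 H psi + toL1 u).
Proof. by move=> su; exists psi => //; exists u. Qed.

Lemma pairing_toL1_schwartz (u chi : S) : pairing (toL1 u) chi = pairing u chi.
Proof. by rewrite pairingC -pairing_toLoo pairing_schwartz pairingC. Qed.

Lemma pairing_PL psi (u chi : S) : pairing (sa_Lstar1 H psi + toL1 u : L1) chi =
  pairing (sa_Lstar1 H psi : L1) chi + pairing u chi.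
Proof.
rewrite -[sa_Lstar1 H psi]scale1r pairingC -(pairing_toLoo chi) pairing_linearr mul1r scale1r.
by rewrite pairing_schwartz pairing_toLoo ![pairing chi _]pairingC.
Qed.

Section with_XL.
Context (XL : schwartz_banach R d) (hXL : is_prenative C XL).
Local Notation emb := (sb_emb XL).
Local Notation j' := (sb_in XL).

(** Replaces a statement about integrals by an equation in S', to which linearity and injectivity of
    the embedding apply. *)
Lemma represents_PL (x : XL) psi u :
  represents (emb x) (sa_Lstar1 H psi + toL1 u : L1) <->
  emb (x - j' u) = cp_Lstar C (j psi).
Proof.
have e chi : cp_Lstar C (j psi) chi = pairing (sa_Lstar1 H psi : L1) chi.
  by rewrite cp_Lstar_ext sa_Lstar1E.
have sub chi : emb x chi = emb (x - j' u) chi + emb (j' u) chi.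
  by rewrite -[in LHS](subrK (j' u) x) linearD.
split=> [xg|xE chi]; last by rewrite sub xE sb_inK pairing_PL e.
apply/val_inj/funext => chi /=.
by apply: (addIr (emb (j' u) chi)); rewrite -sub xg sb_inK pairing_PL e.
Qed.

Lemma prenative_represents psi u : span_of phi u ->
  exists x : XL, emb (x - j' u) = cp_Lstar C (j psi) /\
    `|x| = Num.max `|j psi| (norm2 (fun n => pairing (p n) u)).
Proof.
move=> su; have [x [/represents_PL xg xn]] := hXL.1 _ (P_L_intro psi su).
by exists x; rewrite xn prenative_norm_PL.
Qed.

(** With u = 0 the norm of P_L reduces to |j psi|, so L^* is isometric on the image of S in X and
    extends to X. Its identity with [cp_Lstar] passes to the closure after evaluation at a test
    function. *)
Lemma Lstar_exists : exists T : {linear X -> XL}, continuous T /\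
  forall v, emb (T v) = cp_Lstar C v.
Proof.
have ex psi : exists x : XL, emb x = cp_Lstar C (j psi) /\ `|x| = `|j psi|.
  have [x [xE xn]] := prenative_represents psi (span_of0 _).
  exists x; rewrite -xE xn linear0 subr0; split => //.
  by rewrite norm20 ?max_l// => n; exact: pairing_schwartz0.
(* Only the values on the image of S are used, where the set is a singleton. *)
pose T0 (v : X) := xget (0 : XL) [set x : XL | emb x = cp_Lstar C v].
have T0E psi : emb (T0 (j psi)) = cp_Lstar C (j psi).
  rewrite /T0; case: xgetP => [x -> //|].
  by have [x [xE _]] := ex psi => /(_ x).
have T0n psi : `|T0 (j psi)| = `|j psi|.
  have [x [xE <-]] := ex psi; congr `|_|.
  by apply: (@sb_emb_inj _ _ XL); rewrite T0E.
have Dlin (b : R) u v : range j u -> range j v -> range j (b *: u + v).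
  by move=> [f _ <-] [g _ <-]; exists (b *: f + g) => //; rewrite linearP.
have [T [cT TE]] : exists T : {linear X -> XL}, continuous T /\
    forall u, range j u -> T u = T0 u.
  apply: (dense_extension (c := 1) (@sb_in_dense _ _ X) Dlin).
    move=> b _ _ [f _ <-] [g _ <-]; apply: (@sb_emb_inj _ _ XL).
    rewrite -linearP T0E [RHS](linearP emb) !T0E.
    by rewrite (linearP j) (linearP (cp_Lstar C)).
  by move=> _ [f _ <-]; rewrite T0n mul1r.
exists T; split => // v; apply/val_inj/funext => chi.
apply: (dense_eqfun (f := fun v => emb (T v) chi) (g := fun v => cp_Lstar C v chi)
  (@sb_in_dense _ _ X)) => [w|w|_ [psi _ <-]].
- apply: (@continuous_comp _ _ _ (emb \o T) (fun U : S' => U chi)).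
    by apply: continuous_comp; [exact: cT|exact: sb_emb_continuous].
  exact: tempered_eval_continuous.
- apply: (@continuous_comp _ _ _ (cp_Lstar C) (fun U : S' => U chi)).
    exact: cp_Lstar_continuous.
  exact: tempered_eval_continuous.
- by rewrite TE ?T0E//; exists psi.
Qed.

Section with_Lstar.
Context (T : {linear X -> XL}) (cT : continuous T).
Context (TE : forall v, emb (T v) = cp_Lstar C v).

Lemma Lstar_norm v u : span_of phi u ->
  `|T v + j' u| = Num.max `|v| (norm2 (fun n => pairing (p n) u)).
Proof.
move=> su; move: v; apply: (dense_eqfun (@sb_in_dense _ _ X)) => [v|v|_ [psi _ <-]].
- apply: (@continuous_comp _ _ _ (fun v => T v + j' u) Num.norm); last exact: norm_continuous.
  by apply: cvgD; [exact: cT|exact: cvg_cst].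
- apply: continuous_max; last exact: cst_continuous.
  exact: norm_continuous.
- have [x [xE <-]] := prenative_represents psi su; congr `|_|.
  by apply: (addIr (- j' u)); rewrite addrK; apply: (@sb_emb_inj _ _ XL); rewrite TE.
Qed.

Lemma dense_Lstar_span :
  dense [set x : XL | exists v u, span_of phi u /\ x = T v + j' u].
Proof.
apply/dense_normP => x e e0.
have /dense_normP/(_ x e e0)[y [g [psi _ [u su <-]]] yg xy] := hXL.2.
exists y => //; exists (j psi), u; split => //.
apply: (addIr (- j' u)); rewrite addrK; apply: (@sb_emb_inj _ _ XL).
by rewrite TE; exact/represents_PL.
Qed.

Lemma span_phiB u u' : span_of phi u -> span_of phi u' -> span_of phi (u - u').
Proof. by move=> su su'; rewrite addrC -scaleN1r; exact: span_of_linear. Qed.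

Lemma Lstar_span_inj v u v' u' : span_of phi u -> span_of phi u' ->
  T v + j' u = T v' + j' u' -> v = v' /\ u = u'.
Proof.
move=> su su' vu; have := Lstar_norm (v - v') (span_phiB su su').
rewrite !linearB addrACA -opprD vu subrr normr0 => /esym m0.
have /eqP : `|v - v'| = 0 by apply/eqP; rewrite eq_le normr_ge0 -m0 le_max lexx.
rewrite normr_eq0 subr_eq0 => /eqP vv; split => //.
apply/eqP; rewrite -subr_eq0 -(span_phiE (span_phiB su su')) big1// => n _.
have : `|pairing (p n) (u - u')| <= 0.
  by rewrite (le_trans (norm2_ge (fun n => pairing (p n) (u - u')) n))// -m0 le_max lexx orbT.
by rewrite normr_le0 => /eqP ->; rewrite scale0r.
Qed.

(** The norm identity makes the pair (v, u) unique, so f defines a contraction on a dense subspace.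
    The choice f = v gives L_phi^{-1*}, and the coordinates of u give the functionals p_n. *)
Lemma Lstar_span_extension (W : completeNormedModType R) (f : X -> S -> W) :
  (forall b v u v' u', f (b *: v + v') (b *: u + u') = b *: f v u + f v' u') ->
  (forall v u, span_of phi u -> `|f v u| <= `|T v + j' u|) ->
  exists F : {linear XL -> W}, continuous F /\
    forall v u, span_of phi u -> F (T v + j' u) = f v u.
Proof.
move=> lf nf; pose D := [set x : XL | exists v u, span_of phi u /\ x = T v + j' u].
pose F0 (x : XL) := xget 0 [set w | exists v u, [/\ span_of phi u, x = T v + j' u & w = f v u]].
have F0E v u : span_of phi u -> F0 (T v + j' u) = f v u.
  move=> su; rewrite /F0; case: xgetP => [_ -> [v' [u' [su' vu ->]]]|].
    by have [-> ->] := Lstar_span_inj su su' vu.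
  by move=> /(_ (f v u)) []; exists v, u.
have Tl b v u v' u' : b *: (T v + j' u) + (T v' + j' u') = T (b *: v + v') + j' (b *: u + u').
  by rewrite !linearP scalerDr addrACA.
have [||||F [cF FE]] := @dense_extension R XL W D F0 1.
- exact: dense_Lstar_span.
- move=> b _ _ [v [u [su ->]]] [v' [u' [su' ->]]].
  by exists (b *: v + v'), (b *: u + u'); rewrite Tl; split => //; exact: span_of_linear.
- move=> b _ _ [v [u [su ->]]] [v' [u' [su' ->]]].
  by rewrite Tl !F0E//; exact: span_of_linear.
- by move=> _ [v [u [su ->]]]; rewrite F0E// mul1r nf.
exists F; split => // v u su; rewrite FE ?F0E//.
by exists v, u.
Qed.

Lemma represents_PLE x g : P_L C g -> represents (emb x) g ->
  exists psi u, [/\ span_of phi u, g = sa_Lstar1 H psi + toL1 u & x = T (j psi) + j' u].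
Proof.
move=> [psi _ [u su <-]] xg; exists psi, u; split => //.
apply: (addIr (- j' u)); rewrite addrK; apply: (@sb_emb_inj _ _ XL).
by rewrite TE; exact/represents_PL.
Qed.

Lemma native_operators_of_Lstar : inhabited (native_operators C XL).
Proof.
have [||Li [cLi LiE]] := @Lstar_span_extension X (fun v _ => v).
- by [].
- by move=> v u su; rewrite Lstar_norm// le_max lexx.
have hp n : exists l : ndual XL, forall v u, span_of phi u -> l (T v + j' u) = pairing (p n) u.
  have [||l [cl lE]] := @Lstar_span_extension R^o (fun _ u => pairing (p n) u).
  - by move=> b _ u _ u'; exact: pairing_schwartzP.
  - move=> v u su; rewrite Lstar_norm// le_max.
    by rewrite (norm2_ge (fun n => pairing (p n) u) n) orbT.
  have [c _ lc] := continuous_linear_lipschitz cl.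
  have [l' l'E] := mk_ndual (fun b u v => linearP l b u v) lc.
  by exists l' => v u su; rewrite l'E lE.
have [pn pnE] := choice hp.
(* The projection is assembled from the extended p_n, so its continuity needs no further
   extension. *)
pose Pr (x : XL) := \sum_(n < N0) pn n x *: j' (phi n).
have Prl : linear Pr.
  move=> b u v; rewrite scaler_sumr -big_split/=; apply: eq_bigr => n _.
  by rewrite (cdual_linear (pn n)) scalerDl scalerA.
pose PrL : {linear XL -> XL} := HB.pack Pr (GRing.isLinear.Build _ _ _ _ _ Prl).
have PrE v u : span_of phi u -> Pr (T v + j' u) = j' u.
  move=> su; rewrite -[in RHS](span_phiE su) linear_sum; apply: eq_bigr => n _.
  by rewrite pnE// linearZ.
have cPr : continuous PrL.
  apply: (@linear_lipschitz_continuous _ _ _ PrL (\sum_(n < N0) `|pn n| * `|j' (phi n)|)) => x.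
  rewrite mulr_suml (le_trans (ler_norm_sum _ _ _))// ler_sum// => n _.
  by rewrite normrZ mulrAC ler_wpM2r// ndual_ler_norm.
split; refine (@NativeOperators _ _ _ _ _ _ _ T cT TE Li cLi _ PrL cPr _ pn _).
- move=> x g Pg xg; have [psi [u [su -> ->]]] := represents_PLE Pg xg.
  by rewrite LiE// stable_PL.
- move=> x g Pg xg; have [psi [u [su -> ->]]] := represents_PLE Pg xg.
  by rewrite [LHS]PrE// Proj_phi_PL.
- move=> n x g Pg xg; have [psi [u [su -> ->]]] := represents_PLE Pg xg.
  by rewrite pnE// pairing_p_PL.
Qed.

End with_Lstar.

Lemma native_operators_exist : inhabited (native_operators C XL).
Proof. by have [T [cT TE]] := Lstar_exists; exact: native_operators_of_Lstar cT TE. Qed.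

End with_XL.
End native.

(** * The embeddings of L_{oo,a} in S' and of S in the dual of a Schwartz-Banach space *)

Section embeddings.
Context (R : realType) (d : nat).
Local Notation S := (schwartz R d).
Local Notation S' := (tempered R d).

Lemma schwartz_base_le k ks (phi : S) x : (pickle ks <= k)%N -> schwartz_base k phi ->
  (1 + enorm x) ^+ ks.1 * `|pderiv ks.2 phi x| <= 1.
Proof.
move=> ksk /(_ ks ksk x).
rewrite /schwartz_jet normrM ger0_norm; last by rewrite exprn_ge0// addr_ge0// enorm_ge0.
by move=> /le_trans; apply; rewrite invf_le1// ler1n.
Qed.

Lemma toL1_bounded (a : R) : exists k (M : R), forall phi : S, schwartz_base k phi ->
  `|schwartz_toL1 a phi| <= M.
Proof.
have [N hN] := wt_decay d (- a).
(* Only the seminorm of weight exponent N without derivatives is needed, so k is its code. *)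
exists (pickle (N, [::] : seq 'I_d)), (fine (\int[lebesgue_rV R d]_x (rVbump x)%:E)) => phi bphi.
have le1 x : `|wt (- a) x * phi x| <= rVbump x.
  rewrite -[leRHS]mul1r; apply: hN => y.
  exact: (schwartz_base_le y (leqnn (pickle (N, [::] : seq 'I_d))) bphi).
rewrite -lee_fin L1_normE fineK; last first.
  by apply: integrable_fin_num => //; exact: integrable_rVbump.
apply: ae_ge0_le_integral => //.
- apply/measurable_EFinP; apply: (@measurableT_comp _ _ _ _ _ _ (@Num.norm R R)) => //.
  by apply: measurable_funM; [exact: measurable_wt|exact: measurable_wLp].
- by move=> x _; rewrite lee_fin ltW// rVbump_gt0.
- by apply/measurable_EFinP; exact: measurable_rVbump.
- by apply: filterS (schwartz_toL1E a phi) => x /[apply] ->; rewrite lee_fin.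
Qed.

Lemma Loo_embedding (a : R) : exists iLoo : {linear 'Loo_(R, d, a) -> S'},
  [/\ forall f, represents (iLoo f) (wLp_fun f),
      continuous iLoo, injective iLoo & dense (range iLoo)].
Proof.
have [k [M hM]] := toL1_bounded a.
have hf (f : 'Loo_(R, d, a)) : exists U : S', forall phi, U phi = pairing f phi.
  pose u (phi : S) : R^o := pairing f phi.
  have lu : linear u by move=> b phi psi; exact: pairing_schwartzP.
  pose U : {linear S -> R^o} := HB.pack u (GRing.isLinear.Build _ _ _ _ _ lu).
  have cU : continuous U.
    apply: (@schwartz_linear_continuous _ _ R^o U k (`|f| * M)) => phi bphi.
    have -> : U phi = pairing f (schwartz_toL1 a phi) by rewrite pairing_toL1.
    rewrite (le_trans (pairing_le _ _))//.
    by rewrite ler_wpM2l// hM.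
  have UP : u \in @cdual_pred R S by apply/asboolP.
  by exists (CDual UP).
have [i iE] := choice hf.
have il : linear i.
  move=> b f g; apply/val_inj/funext => phi /=.
  rewrite iE -pairing_toL1 pairing_linearl !pairing_toL1 -!iE.
  by [].
pose iL : {linear 'Loo_(R, d, a) -> S'} := HB.pack i (GRing.isLinear.Build _ _ _ _ _ il).
exists iL; split.
- by move=> f phi; exact: iE.
- apply: tempered_continuous => phi.
  pose u (f : 'Loo_(R, d, a)) : R^o := iL f phi.
  have lu : linear u by move=> b f g; rewrite /u linearP.
  pose U : {linear 'Loo_(R, d, a) -> R^o} := HB.pack u (GRing.isLinear.Build _ _ _ _ _ lu).
  apply: (@linear_lipschitz_continuous _ _ _ U `|schwartz_toL1 a phi|) => f.
  by rewrite [U f]iE -pairing_toL1 mulrC pairing_le.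
- move=> f g fg; apply: Loo_eq => phi; rewrite -!iE.
  by rewrite (fg : i f = i g).
- apply: dense_tempered => psi; exists (i (schwartz_toLoo a psi)); first by exists (schwartz_toLoo a psi).
  by move=> phi; rewrite iE -pairing_toL1 pairing_schwartz.
Qed.

(** A test function acts on X by evaluation of distributions. Continuity for the operator norm is
    where [schwartz_banach_equicontinuous] is needed: its bound is uniform on the unit ball of X. *)
Lemma schwartz_embedding (X : schwartz_banach R d) : exists iS : {linear S -> ndual X},
  [/\ forall phi (g : X), iS phi g = sb_emb X g phi,
      forall phi, represents (dual_restrict (iS phi)) phi,
      continuous iS & injective iS].
Proof.
have [k [c [c0 hc]]] := schwartz_banach_equicontinuous X.
have cE phi : continuous (fun g : X => sb_emb X g phi).
  move=> g; apply: (@continuous_comp _ _ _ (sb_emb X) (fun T : S' => T phi)).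
    exact: sb_emb_continuous.
  exact: tempered_eval_continuous.
have hf (phi : S) : exists w : ndual X, forall g, w g = sb_emb X g phi.
  pose u (g : X) : R^o := sb_emb X g phi.
  have lu : linear u by move=> b g h; rewrite /u linearP.
  pose U : {linear X -> R^o} := HB.pack u (GRing.isLinear.Build _ _ _ _ _ lu).
  have [b b0 Ub] := continuous_linear_lipschitz (cE phi : continuous U).
  exact: (mk_ndual lu Ub).
have [i iE] := choice hf.
have il : linear i.
  move=> b phi psi; apply/val_inj/funext => g /=.
  rewrite [LHS]iE.
  transitivity (b * i phi g + i psi g); last by [].
  by rewrite !iE; exact: cdual_linear.
pose iS : {linear S -> ndual X} := HB.pack i (GRing.isLinear.Build _ _ _ _ _ il).
have iSr phi : represents (dual_restrict (iS phi)) phi.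
  by move=> psi; rewrite [LHS](iE phi (sb_in X psi)) sb_inK pairingC.
exists iS; split => //.
- apply: (@schwartz_linear_continuous _ _ _ iS k c) => phi bphi.
  by apply: ndual_norm_le => // g; rewrite [iS phi g]iE; exact: hc.
- move=> phi psi ips; apply/eqP; rewrite -subr_eq0; apply/eqP; apply: schwartz_eq0.
  have := iSr (phi - psi) (phi - psi).
  have -> : iS (phi - psi) = 0 by rewrite linearB ips subrr.
  by move=> <-.
Qed.
End embeddings.

Lemma adjoint_norm_continuous (R : realType) (V W : normedModType R) (A : {linear V -> W})
    (cA : continuous A) : continuous (adjoint cA : ndual W -> ndual V).
Proof.
have [c c0 Ac] := continuous_linear_lipschitz cA.
apply: (@linear_lipschitz_continuous _ (ndual W) (ndual V) (adjoint cA) c) => w.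
apply: ndual_norm_le => [|x]; first by rewrite mulr_ge0// ltW.
rewrite (le_trans (ndual_ler_norm w (A x)))//.
by rewrite [c * _]mulrC -mulrA ler_wpM2l.
Qed.

(** Composing Theta with the canonical map of V into its bidual gives a functional w on V.
    Reflexivity says that every Phi is an evaluation, so Theta is evaluation at w. *)
Lemma reflexive_ndual (R : realType) (V : normedModType R) :
  reflexive_space V -> reflexive_space (ndual V).
Proof.
move=> rV Theta.
have hev (x : V) : exists ev : ndual (ndual V), forall w : ndual V, ev w = w x.
  apply: (mk_ndual (c := `|x|)) => [//|w].
  by rewrite mulrC ndual_ler_norm.
have [ev evE] := choice hev.
have evP b x y : ev (b *: x + y) = b *: ev x + ev y.
  apply/val_inj/funext => w /=.
  transitivity (b * ev x w + ev y w); last by [].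
  by rewrite !evE; exact: (cdual_linear w).
have evn x : `|ev x| <= `|x|.
  by apply: ndual_norm_le => // w; rewrite evE mulrC ndual_ler_norm.
have [||w wE] := @mk_ndual R V (fun x => Theta (ev x)) `|Theta|.
- by move=> b x y; rewrite evP; exact: (cdual_linear Theta).
- by move=> x; rewrite (le_trans (ndual_ler_norm Theta (ev x)))// ler_wpM2l.
exists w => Phi; have [x xE] := rV Phi.
have -> : Phi = ev x by apply/val_inj/funext => f; rewrite /= xE evE.
by rewrite evE wE.
Qed.

Lemma closure_dense (T : topologicalType) (D : set T) :
  (forall x, closure D x) -> dense D.
Proof.
move=> cD O [x Ox] oO; have [y [Dy Oy]] := cD x O (open_nbhs_nbhs (conj oO Ox)).
by exists y.
Qed.

(** * The decomposition of X_L and of its dual, for any choice of the native operators *)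

Section native_dual.
Context (R : realType) (d : nat) (L : {linear schwartz R d -> tempered R d}) (a : R).
Context (X : schwartz_banach R d) (C : compatible L a X).
Context (XL : schwartz_banach R d) (hXL : is_prenative C XL) (O : native_operators C XL).
Local Notation S := (schwartz R d).
Local Notation S' := (tempered R d).
Local Notation L1 := 'L1_(R, d, a).
Local Notation Loo := 'Loo_(R, d, a).
Local Notation H := (cp_sa C).
Local Notation N0 := (sa_dim H).
Local Notation p := (bs_p (cp_bs C)).
Local Notation phi := (bs_phi (cp_bs C)).
Local Notation j := (sb_in X).
Local Notation j' := (sb_in XL).
Local Notation emb := (sb_emb XL).
Local Notation toL1 := (schwartz_toL1 a).
Local Notation T := (no_Lstar O).
Local Notation Lis := (no_Linvstar O).
Local Notation Pr := (no_Proj O).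
Local Notation pn := (no_p O).
Local Notation LL := (native_L O).
Local Notation Linv := (native_Linv O).
Local Notation PrD := (native_Proj O).

Lemma native_operators_PL psi u : span_of phi u ->
  [/\ Lis (T (j psi) + j' u) = j psi,
      Pr (T (j psi) + j' u) = j' u
    & forall n, pn n (T (j psi) + j' u) = pairing (p n) u].
Proof.
move=> su; have Pg := P_L_intro psi su.
have xg : represents (emb (T (j psi) + j' u)) (sa_Lstar1 H psi + toL1 u : L1).
  by apply/represents_PL; rewrite addrK no_LstarE.
split=> [||n].
- by rewrite (no_LinvstarE O Pg xg) stable_PL.
- by rewrite (no_ProjE O Pg xg) Proj_phi_PL.
- by rewrite (no_pE O n Pg xg) pairing_p_PL.
Qed.

Lemma Lstar_translate_continuous u : continuous (fun v : X => T v + j' u).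
Proof. by move=> v; apply: cvgD; [exact: no_Lstar_continuous|exact: cvg_cst]. Qed.

Lemma Lis_Lstar v u : span_of phi u -> Lis (T v + j' u) = v.
Proof.
move=> su; move: v; apply: (dense_eqlin (@sb_in_dense _ _ X)) => [v|v|_ [psi _ <-]].
- apply: (@continuous_comp _ _ _ (fun v => T v + j' u) Lis); first exact: Lstar_translate_continuous.
  exact: no_Linvstar_continuous.
- exact: cvg_id.
- by have [] := native_operators_PL psi su.
Qed.

Lemma Pr_Lstar v u : span_of phi u -> Pr (T v + j' u) = j' u.
Proof.
move=> su; move: v; apply: (dense_eqlin (@sb_in_dense _ _ X)) => [v|v|_ [psi _ <-]].
- apply: (@continuous_comp _ _ _ (fun v => T v + j' u) Pr); first exact: Lstar_translate_continuous.
  exact: no_Proj_continuous.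
- exact: cvg_cst.
- by have [] := native_operators_PL psi su.
Qed.

Lemma pn_Lstar n v u : span_of phi u -> pn n (T v + j' u) = pairing (p n) u.
Proof.
move=> su; move: v; apply: (dense_eqfun (@sb_in_dense _ _ X)) => [v|v|_ [psi _ <-]].
- apply: (@continuous_comp _ _ _ (fun v => T v + j' u) (pn n)); first exact: Lstar_translate_continuous.
  exact: cdual_continuous.
- exact: cvg_cst.
- by have [_ _] := native_operators_PL psi su.
Qed.

(** The projection on N_phi with values in S, where pairing with p_n is an integral; [j'] carries it
    to X_L. *)
Definition nproj (x : XL) : S := \sum_(n < N0) pn n x *: phi n.

Lemma span_nproj x : span_of phi (nproj x). Proof. by exists (fun n => pn n x). Qed.

Lemma j'_nproj x : j' (nproj x) = \sum_(n < N0) pn n x *: j' (phi n).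
Proof. by rewrite linear_sum; apply: eq_bigr => n _; rewrite linearZ. Qed.

Lemma j'_nproj_continuous : continuous (fun x => j' (nproj x)).
Proof.
rewrite (_ : (fun _ => _) = \sum_(n < N0) (fun x => pn n x *: j' (phi n))); last first.
  by apply/funext => x; rewrite fct_sumE j'_nproj.
elim/big_ind: _ => [|f g cf cg|n _ x]; first exact: cst_continuous.
  by move=> x; apply: cvgD; [exact: cf|exact: cg].
by apply: cvgZl; exact: cdual_continuous.
Qed.

Lemma native_decomp x : x = T (Lis x) + j' (nproj x).
Proof.
move: x; apply: (dense_eqlin (dense_Lstar_span hXL (no_LstarE O))) => [x|x|_ [v [u [su ->]]]].
- exact: cvg_id.
- apply: cvgD; last exact: j'_nproj_continuous.
  by apply: (@continuous_comp _ _ _ Lis T); [exact: no_Linvstar_continuous|exact: no_Lstar_continuous].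
- rewrite Lis_Lstar// -[in LHS](span_phiE su); congr (_ + j' _).
  by apply: eq_bigr => n _; rewrite pn_Lstar.
Qed.

Lemma native_ProjE x : Pr x = j' (nproj x).
Proof. by rewrite [in LHS](native_decomp x) Pr_Lstar//; exact: span_nproj. Qed.

Lemma native_norm x : `|x| = Num.max `|Lis x| (norm2 (fun n => pn n x)).
Proof.
rewrite [in LHS](native_decomp x) (Lstar_norm hXL (@no_Lstar_continuous _ _ _ _ _ _ _ O) (no_LstarE O) _ (span_nproj x)).
by congr (Num.max _ (norm2 _)); apply/funext => n; rewrite pairing_p_phi.
Qed.

Lemma N_phiP g : N_phi C XL g <-> exists2 u, span_of phi u & g = j' u.
Proof.
split=> [[c _ <-]|[_ [c _ <-] ->]].
  exists (\sum_(n < N0) c n *: phi n); first by exists c.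
  by rewrite linear_sum; apply: eq_bigr => n _; rewrite linearZ.
by exists c => //; rewrite linear_sum; apply: eq_bigr => n _; rewrite linearZ.
Qed.

Lemma Lis_T v : Lis (T v) = v.
Proof. by have := Lis_Lstar v (span_of0 phi); rewrite linear0 addr0. Qed.

Lemma Lis_j' u : span_of phi u -> Lis (j' u) = 0.
Proof. by move=> su; have := Lis_Lstar 0 su; rewrite linear0 add0r. Qed.

Lemma pn_T n v : pn n (T v) = 0.
Proof.
have := pn_Lstar n v (span_of0 phi); rewrite linear0 addr0 => ->.
exact: pairing_schwartz0.
Qed.

Lemma pn_j' n u : span_of phi u -> pn n (j' u) = pairing (p n) u.
Proof. by move=> su; have := pn_Lstar n 0 su; rewrite linear0 add0r. Qed.

Lemma pn_phi m n : pn m (j' (phi n)) = (m == n)%:R.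
Proof.
rewrite pn_j'; last exact: span_of_gen.
by rewrite pairingC bs_biorth eq_sym.
Qed.

Lemma pairing_Loo_sum (c : 'I_N0 -> R) (e : 'I_N0 -> Loo) (g : L1) :
  pairing (\sum_(n < N0) c n *: e n : Loo) g = \sum_(n < N0) c n * pairing (e n) g.
Proof.
apply: (linear_fun_sum (T := fun h : Loo => pairing h g : R^o)).
by move=> b h h'; exact: pairing_linearl.
Qed.

Lemma P_L_total (h : Loo) :
  (forall psi u, span_of phi u -> pairing h (sa_Lstar1 H psi + toL1 u : L1) = 0) -> h = 0.
Proof.
move=> hPL.
have toL10 : toL1 (0 : S) = 0 by exact: to_wLp0.
have : null_space (sa_Lstar1 H) h.
  by move=> psi; have := hPL psi 0 (span_of0 _); rewrite toL10 addr0.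
rewrite (bs_p_basis (cp_bs C)).2 => -[c _ hc]; rewrite -hc; apply: big1 => n _.
have := hPL 0 (phi n) (span_of_gen _ n).
have -> : sa_Lstar1 H 0 + toL1 (phi n) = toL1 (phi n) by rewrite linear0 add0r.
rewrite -hc pairing_Loo_sum (eq_bigr (fun m => c m * (m == n)%:R)); last first.
  by move=> m _; rewrite pairing_toL1 pairingC bs_biorth eq_sym.
by rewrite (sum_delta c n) => ->; exact: scale0r.
Qed.

(** For fixed chi the left side is a bounded functional of g, given by some k in L_{oo,a}. With h
    the sum of the <phi_n, chi> p_n, the function k + h - chi annihilates P_L, hence vanishes by
    [P_L_total]. *)
Lemma Lstar_stable (g : L1) (chi : S) : cp_Lstar C (cp_stable C g) chi =
  pairing g chi - \sum_(n < N0) pairing (p n) g * pairing (phi n) chi.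
Proof.
have [c c0 cP] := continuous_linear_lipschitz (@cp_stable_continuous _ _ _ _ _ C).
pose f (v : X) : R^o := cp_Lstar C v chi.
have lf : linear f by move=> b v w; rewrite /f linearP.
pose F : {linear X -> R^o} := HB.pack f (GRing.isLinear.Build _ _ _ _ _ lf).
have cF : continuous F.
  move=> v; apply: (@continuous_comp _ _ _ (cp_Lstar C) (fun U : S' => U chi)).
    exact: cp_Lstar_continuous.
  exact: tempered_eval_continuous.
have [b b0 bP] := continuous_linear_lipschitz cF.
have [||l lE] := @mk_ndual R L1 (fun g => f (cp_stable C g)) (b * c).
- by move=> e g1 g2; rewrite linearP lf.
- move=> g1; rewrite (le_trans (bP _))// -mulrA ler_wpM2l//.
  exact: ltW.
have [k [kE _]] := L1_dual_Loo l.
pose h : Loo := \sum_(n < N0) pairing (phi n) chi *: p n.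
have hE (g1 : L1) : pairing (k + h - schwartz_toLoo a chi : Loo) g1 =
    f (cp_stable C g1) + \sum_(n < N0) pairing (phi n) chi * pairing (p n) g1 - pairing g1 chi.
  have -> : k + h - schwartz_toLoo a chi = (-1) *: schwartz_toLoo a chi + (1 *: k + h).
    by rewrite scaleN1r scale1r addrC.
  rewrite !pairing_linearl pairing_toLoo pairing_Loo_sum -kE lE mul1r mulN1r addrC.
  by rewrite [pairing chi _]pairingC.
have : k + h - schwartz_toLoo a chi = 0.
  apply: P_L_total => psi u su; rewrite hE /f stable_PL// cp_Lstar_ext.
  have -> : sa_Lstar H psi chi = pairing (sa_Lstar1 H psi : L1) chi by rewrite sa_Lstar1E.
  rewrite (eq_bigr (fun n => pairing (p n) u * pairing (phi n) chi)); last first.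
    by move=> n _; rewrite pairing_p_PL mulrC.
  have -> : \sum_(n < N0) pairing (p n) u * pairing (phi n) chi = pairing u chi.
    rewrite -[in RHS](span_phiE su).
    rewrite (linear_fun_sum (T := fun v : S => pairing v chi : R^o))//.
    by move=> e v w; exact: pairing_schwartz_linearl.
  by rewrite pairing_PL subrr.
move=> kh0; have := hE g; rewrite kh0 => fE.
have : pairing (0 : Loo) g = 0.
  by have := pairing_linearl (-1) 0 0 g; rewrite scaler0 addr0 mulN1r addNr.
rewrite fE => /eqP; rewrite subr_eq0 => /eqP <-.
rewrite [X in _ = _ - X](eq_bigr (fun n => pairing (phi n) chi * pairing (p n) g)).
  by rewrite addrK.
by move=> n _; rewrite mulrC.
Qed.

Definition L1_embed (g : L1) : XL :=
  T (cp_stable C g) + \sum_(n < N0) pairing (p n) g *: j' (phi n).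

Lemma L1_embed_linear : linear L1_embed.
Proof.
move=> b g h; rewrite /L1_embed !linearP scalerDr addrACA; congr (_ + _).
rewrite scaler_sumr -big_split/=; apply: eq_bigr => n _.
by rewrite pairing_linearr scalerDl scalerA.
Qed.

Lemma L1_embed_bounded : exists2 c : R, 0 < c & forall g, `|L1_embed g| <= c * `|g|.
Proof.
have [c c0 cP] := continuous_linear_lipschitz (@no_Lstar_continuous _ _ _ _ _ _ _ O).
have [b b0 bP] := continuous_linear_lipschitz (@cp_stable_continuous _ _ _ _ _ C).
exists (c * b + \sum_(n < N0) `|p n| * `|j' (phi n)|).
  by rewrite ltr_pwDl ?mulr_gt0// sumr_ge0.
move=> g; rewrite (le_trans (ler_normD _ _))// mulrDl lerD//.
  by rewrite (le_trans (cP _))// -mulrA ler_wpM2l// ltW.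
rewrite mulr_suml (le_trans (ler_norm_sum _ _ _))// ler_sum// => n _.
by rewrite normrZ mulrAC ler_wpM2r// pairing_le.
Qed.

Lemma L1_embedE (g : L1) (chi : S) : emb (L1_embed g) chi = pairing g chi.
Proof.
have -> : emb (L1_embed g) chi = emb (T (cp_stable C g)) chi +
    emb (\sum_(n < N0) pairing (p n) g *: j' (phi n)) chi by rewrite linearD.
rewrite no_LstarE Lstar_stable -[RHS]addr0 -addrA; congr (_ + _).
rewrite (linear_fun_sum (T := fun x : XL => emb x chi : R^o)); last first.
  by move=> b v w; rewrite linearP.
rewrite [X in _ + X](eq_bigr (fun n => pairing (p n) g * pairing (phi n) chi)) ?addNr//.
by move=> n _; rewrite sb_inK.
Qed.

Lemma L1_embed_schwartz psi : L1_embed (toL1 psi) = j' psi.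
Proof.
apply: (@sb_emb_inj _ _ XL); apply/val_inj/funext => chi /=.
by rewrite L1_embedE sb_inK pairing_toL1_schwartz.
Qed.

(** The extension of p_n is prescribed on P_L only, where psi need not lie; passing through
    [L1_embed] shows that it is still the distribution p_n. *)
Lemma pn_schwartz n psi : pn n (j' psi) = pairing (p n) psi.
Proof.
rewrite -L1_embed_schwartz /L1_embed.
have -> : \sum_(m < N0) pairing (p m) (toL1 psi) *: j' (phi m) =
    j' (\sum_(m < N0) pairing (p m) (toL1 psi) *: phi m).
  by rewrite linear_sum; apply: eq_bigr => m _; rewrite linearZ.
rewrite pn_Lstar ?pairing_p_phi ?pairing_toL1//.
by exists (fun m => pairing (p m) (toL1 psi)).
Qed.

Lemma native_embedding_Loo : exists iX : {linear ndual XL -> Loo},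
  [/\ forall f, represents (dual_restrict f) (wLp_fun (iX f)),
      continuous iX & injective iX].
Proof.
have [c c0 cP] := L1_embed_bounded.
have hh (f : ndual XL) : exists h : Loo,
    (forall g, f (L1_embed g) = pairing h g) /\ `|h| <= c * `|f|.
  have cf g : `|f (L1_embed g)| <= c * `|f| * `|g|.
    rewrite (le_trans (ndual_ler_norm f _))// [c * _]mulrC -mulrA ler_wpM2l//.
  have [||l lE] := @mk_ndual R L1 (fun g => f (L1_embed g)) (c * `|f|).
  - by move=> b g h; rewrite L1_embed_linear; exact: cdual_linear.
  - exact: cf.
  have [h [hE hl]] := L1_dual_Loo l.
  exists h; split => [g|]; first by rewrite -hE lE.
  rewrite (le_trans hl)//; apply: ndual_norm_le => [|g]; last by rewrite lE.
  by rewrite mulr_ge0// ltW.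
have [i iP] := choice hh.
have iE (f : ndual XL) (chi : S) : f (j' chi) = pairing (i f) chi.
  by rewrite -L1_embed_schwartz (iP f).1 pairing_toL1.
have il : linear i.
  move=> b f g; apply: Loo_eq => chi.
  by rewrite -[in RHS]pairing_toL1 pairing_linearl !pairing_toL1 -!iE.
pose iX : {linear ndual XL -> Loo} := HB.pack i (GRing.isLinear.Build _ _ _ _ _ il).
exists iX; split.
- by move=> f chi; exact: iE.
- by apply: (@linear_lipschitz_continuous _ _ _ iX c) => f; exact: (iP f).2.
- move=> f g fg; apply/val_inj/funext.
  apply: (dense_eqfun (@sb_in_dense _ _ XL)).
  + exact: cdual_continuous.
  + exact: cdual_continuous.
  + by move=> _ [chi _ <-]; rewrite [LHS]iE [RHS]iE (fg : i f = i g).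
Qed.

Lemma N_p_evalE (c : 'I_N0 -> R) x : (\sum_(n < N0) c n *: pn n : ndual XL) x =
  \sum_(n < N0) c n * pn n x.
Proof. by apply: (linear_fun_sum (T := fun f : ndual XL => f x : R^o)). Qed.

Lemma phivec_N_p (c : 'I_N0 -> R) m : phivec C (\sum_(n < N0) c n *: pn n : ndual XL) m = c m.
Proof.
rewrite /phivec N_p_evalE (eq_bigr (fun n => c n * (n == m)%:R)); first exact: sum_delta.
by move=> n _; rewrite pn_phi.
Qed.

Lemma N_pE q : N_p O q -> \sum_(n < N0) phivec C q n *: pn n = q.
Proof. by move=> [c _ <-]; apply: eq_bigr => n _; rewrite phivec_N_p. Qed.

Lemma native_ProjDE f : PrD f = \sum_(n < N0) phivec C f n *: pn n.
Proof.
apply/val_inj/funext => x /=; rewrite [RHS]N_p_evalE.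
rewrite [LHS](_ : _ = f (Pr x))// native_ProjE j'_nproj.
rewrite (linear_fun_sum _ _ (cdual_linear f)); apply: eq_bigr => n _.
by rewrite [LHS]mulrC.
Qed.

Lemma N_p_Proj f : N_p O (PrD f).
Proof. by rewrite native_ProjDE; exists (phivec C f). Qed.

Lemma native_Linv_LL f : Linv (LL f) = f - PrD f.
Proof.
apply/val_inj/funext => x /=.
transitivity (f x - f (Pr x)); last by [].
have xE : T (Lis x) = x - Pr x.
  apply/eqP; rewrite eq_sym subr_eq native_ProjE; apply/eqP; exact: native_decomp.
by rewrite [LHS](_ : _ = f (T (Lis x)))// xE linearB.
Qed.

Lemma native_dual_decomp f : f = Linv (LL f) + PrD f.
Proof. by rewrite native_Linv_LL subrK. Qed.

Lemma LL_Linv w : LL (Linv w) = w.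
Proof. by apply/val_inj/funext => v /=; rewrite Lis_T. Qed.

Lemma LL_N_p q : N_p O q -> LL q = 0.
Proof.
move=> [c _ <-]; apply/val_inj/funext => v /=.
rewrite [LHS]N_p_evalE big1// => n _.
by rewrite pn_T mulr0.
Qed.

Lemma PrD_Linv w : PrD (Linv w) = 0.
Proof.
rewrite native_ProjDE big1// => n _; rewrite /phivec.
have -> : Linv w (j' (phi n)) = w (Lis (j' (phi n))) by [].
by rewrite Lis_j' ?linear0 ?scale0r//; exact: span_of_gen.
Qed.

Lemma PrD_N_p q : N_p O q -> PrD q = q.
Proof. by move=> Nq; rewrite native_ProjDE N_pE. Qed.

Lemma native_dual_decompP f w q : N_p O q -> (f = Linv w + q <-> w = LL f /\ q = PrD f).
Proof.
move=> Nq; split=> [->|[-> ->]]; last exact: native_dual_decomp.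
rewrite !linearD LL_Linv LL_N_p// addr0; split => //.
by rewrite PrD_Linv PrD_N_p// add0r.
Qed.

(** Stated as an inequality to include c = 0, where division by 0 gives the zero vector. *)
Lemma norm2_normalized n (c : 'I_n -> R) : norm2 (fun i => c i / norm2 c) <= 1.
Proof.
have s0 (e : 'I_n -> R) : 0 <= \sum_(i < n) e i ^+ 2 by apply: sumr_ge0 => i _; exact: sqr_ge0.
rewrite -[leRHS]sqrtr1 ler_wsqrtr//.
rewrite (eq_bigr (fun i => c i ^+ 2 / norm2 c ^+ 2)); last by move=> i _; rewrite exprMn exprVn.
rewrite -mulr_suml sqr_sqrtr//.
have [->|h] := eqVneq (\sum_(i < n) c i ^+ 2) 0; first by rewrite mul0r.
by rewrite divff.
Qed.

Lemma sum_normalized n (c : 'I_n -> R) : \sum_(i < n) c i * (c i / norm2 c) = norm2 c.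
Proof.
have s0 (e : 'I_n -> R) : 0 <= \sum_(i < n) e i ^+ 2 by apply: sumr_ge0 => i _; exact: sqr_ge0.
rewrite (eq_bigr (fun i => c i ^+ 2 / norm2 c)); last by move=> i _; rewrite mulrA expr2.
rewrite -mulr_suml -[X in X / _]sqr_sqrtr// -/(norm2 c).
have [->|h] := eqVneq (norm2 c) 0; first by rewrite expr0n mul0r.
by rewrite expr2 mulfK.
Qed.

Lemma native_dual_norm w q : N_p O q -> `|Linv w + q| = `|w| + norm2 (phivec C q).
Proof.
move=> Nq; set c := phivec C q.
have fE x : (Linv w + q) x = w (Lis x) + \sum_(n < N0) c n * pn n x.
  by rewrite -N_p_evalE N_pE.
have c0 : 0 <= `|w| + norm2 c by rewrite addr_ge0// norm2_ge0.
apply/eqP; rewrite eq_le; apply/andP; split.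
  apply: ndual_norm_le => // x; rewrite fE mulrDl (le_trans (ler_normD _ _))// lerD//.
    rewrite (le_trans (ndual_ler_norm w _))// ler_wpM2l//.
    by rewrite (native_norm x) le_max lexx.
  apply: le_trans (_ : norm2 c * norm2 (fun n => pn n x) <= _); last first.
    by rewrite ler_wpM2l ?norm2_ge0// (native_norm x) le_max lexx orbT.
  rewrite ler_norml; apply/andP; split; last exact: cauchy_schwarz.
  rewrite lerNl.
  have := cauchy_schwarz (fun n => - c n) (fun n => pn n x).
  rewrite (eq_bigr (fun n => - (c n * pn n x))); last by move=> n _; rewrite mulNr.
  rewrite sumrN => /le_trans; apply; rewrite le_eqVlt; apply/orP; left; apply/eqP.
  by congr (Num.sqrt _ * _); apply: eq_bigr => n _; rewrite sqrrN.
apply/ler_addgt0Pr => e e0.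
have [v v1 wv] := ndual_norm_approx w e0.
(* The equality case of Cauchy-Schwarz: its pairing with the p_n component is exactly the norm of c.
   Since X_L carries a max norm, v and u can be taken in their unit balls independently. *)
pose u := \sum_(n < N0) (c n / norm2 c) *: phi n.
have su : span_of phi u by exists (fun n => c n / norm2 c).
have pu n : pairing (p n) u = c n / norm2 c by rewrite pairing_p_phi.
have x1 : `|T v + j' u| <= 1.
  rewrite (Lstar_norm hXL (@no_Lstar_continuous _ _ _ _ _ _ _ O) (no_LstarE O) _ su).
  rewrite ge_max v1/=.
  rewrite (_ : (fun n => _) = fun n => c n / norm2 c); first exact: norm2_normalized.
  by apply/funext => n; rewrite pu.
have : (Linv w + q) (T v + j' u) <= `|Linv w + q|.
  rewrite (le_trans (ler_norm _))// (le_trans (ndual_ler_norm _ _))//.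
  by rewrite ler_piMr.
rewrite fE Lis_Lstar// (eq_bigr (fun n => c n * (c n / norm2 c))); last first.
  by move=> n _; rewrite pn_Lstar// pu.
rewrite sum_normalized => h.
by rewrite -lerBlDr addrAC (le_trans _ h)// lerD2r ltW.
Qed.

Lemma U_dualE : U_dual C XL = range Linv.
Proof.
apply/seteqP; split=> [f f0|_ [w _ <-] u /N_phiP[v sv ->]].
  exists (LL f) => //; rewrite native_Linv_LL native_ProjDE big1 ?subr0// => n _.
  rewrite /phivec f0 ?scale0r//; apply/N_phiP; exists (phi n) => //; exact: span_of_gen.
have -> : Linv w (j' v) = w (Lis (j' v)) by [].
by rewrite Lis_j'// linear0.
Qed.

Lemma N_phi_annihilator : N_phi C XL = [set g : XL | forall w, Linv w g = 0].
Proof.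
apply/seteqP; split=> [g Ng w|g g0].
  by have : range Linv (Linv w) by [exists w]; rewrite -U_dualE; exact.
apply/N_phiP; exists (nproj g); first exact: span_nproj.
have [/eqP Lg|Lg] := boolP (Lis g == 0); first by rewrite [LHS](native_decomp g) Lg linear0 add0r.
(* A nonzero vector of X is separated from the closed subspace 0 by some w in X', which contradicts
   the vanishing of all <L_phi^{-1} w, g>. *)
have [|||f fg _] := @hahn_banach_separation R X [set 0] (Lis g).
- by [].
- by move=> b _ _ -> ->; rewrite scaler0 addr0.
- have /closure_id <- : closed [set (0 : X)].
    by apply: accessible_closed_set1; apply: hausdorff_accessible; exact: norm_hausdorff.
  by move=> /eqP; apply/negP.
by move: fg; rewrite [f _](g0 f) eqxx.
Qed.

Lemma ker_native_L : N_p O = [set f | LL f = 0].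
Proof.
apply/seteqP; split=> [q /LL_N_p//|f f0].
have {}f0 : LL f = 0 := f0.
by rewrite (native_dual_decomp f) f0 linear0 add0r; exact: N_p_Proj.
Qed.

Lemma native_L_continuous : continuous LL.
Proof. exact: (@adjoint_norm_continuous R X XL T (@no_Lstar_continuous _ _ _ _ _ _ _ O)). Qed.

Lemma native_Linv_continuous : continuous Linv.
Proof. exact: (@adjoint_norm_continuous R XL X Lis (@no_Linvstar_continuous _ _ _ _ _ _ _ O)). Qed.

(** On the summand L_phi^{-1}(X'), Phi is a functional on X', hence evaluation at some v in X. On
    the finite-dimensional N_p it is determined by the numbers Phi(p_n), which become the
    coefficients on the phi_n. *)
Lemma native_reflexive : reflexive_space X -> reflexive_space XL.
Proof.
move=> rX Phi.
have [v vE] := rX (adjoint native_Linv_continuous Phi).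
exists (T v + \sum_(n < N0) Phi (pn n) *: j' (phi n)) => f.
rewrite [in LHS](native_dual_decomp f) !linearD; congr (_ + _).
  by transitivity (LL f v); first by rewrite -vE.
rewrite native_ProjDE.
apply: etrans (linear_fun_sum (T := Phi : ndual XL -> R^o) _ _ (cdual_linear Phi)) _.
apply: etrans (esym (linear_fun_sum (T := f : XL -> R^o) _ _ (cdual_linear f))).
by apply: eq_bigr => n _; exact: mulrC.
Qed.

(** A functional vanishing on S is, by reflexivity, evaluation at some g of X_L. Then g is zero as a
    distribution, hence zero. *)
Lemma schwartz_embedding_dense (iS : {linear S -> ndual XL}) :
  (forall psi g, iS psi g = emb g psi) -> reflexive_space XL -> dense (range iS).
Proof.
move=> iSE rXL; apply: closure_dense => f; apply: contrapT => nf.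
have [||Phi Phif Phi0] := hahn_banach_separation _ _ nf.
- by exists 0 => //; rewrite linear0.
- by move=> b _ _ [u _ <-] [v _ <-]; exists (b *: u + v) => //; rewrite linearP.
have [g gE] := rXL Phi.
have g0 : g = 0.
  apply: (@sb_emb_inj _ _ XL); rewrite linear0; apply/val_inj/funext => psi.
  transitivity (Phi (iS psi)); first by rewrite gE iSE.
  by apply: Phi0; exists psi.
by move: Phif; rewrite gE g0 linear0 eqxx.
Qed.

End native_dual.

Theorem theorem4 (R : realType) (d : nat) (d_gt0 : (0 < d)%N)
    (L : {linear schwartz R d -> tempered R d}) (a : R)
    (X : schwartz_banach R d) (C : compatible L a X)
    (XL : schwartz_banach R d) (hXL : is_prenative C XL) :
  exists O : native_operators C XL,
  let N0 := sa_dim (cp_sa C) in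
  let U := range (no_Lstar O) in
  let Nphi := N_phi C XL in
  let U' := U_dual C XL in
  let Np := N_p O in
  let LL := native_L O in
  let Linv := native_Linv O in
  let Proj := native_Proj O in
  (* X_L = U (+) N_phi *)
  [/\ direct_sum U Nphi
    & forall v u, Nphi u ->
        `|no_Lstar O v + u| = Num.max `|v| (norm2 (fun n => no_p O n u))] /\
  (* X_L' is a Banach space, X_L' = U' (+) N_p = L_phi^-1(X') (+) N_p *)
  [/\ forall F : set_system (ndual XL), ProperFilter F -> cauchy F -> cvg F,
      direct_sum U' Np,
      direct_sum (range Linv) Np,
      [set: ndual XL] = [set Linv w + q | w in [set: ndual X] & q in Np]
    & forall n, represents (dual_restrict (no_p O n)) (bs_p (cp_bs C) n)] /\
  (* X_L' is isometric to X' x N_p *)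
  (forall w q, Np q -> `|Linv w + q| = `|w| + norm2 (phivec C q)) /\
  [/\ forall f, Np (Proj f),
      forall f, Proj f = \sum_(n < N0) phivec C f n *: no_p O n
    & forall f w q, Np q -> (f = Linv w + q <-> w = LL f /\ q = Proj f)] /\
  [/\ continuous LL, Np = [set f | LL f = 0] & continuous Linv] /\
  (* properties of L_phi^-1 *)
  [/\ U' = range Linv,
      Nphi = [set g : XL | forall w, Linv w g = 0],
      forall w, LL (Linv w) = w
    & forall f, Linv (LL f) = f - Proj f] /\
  (* S -> X_L' -> L_oo,a -> S' *)
  exists (iS : {linear schwartz R d -> ndual XL})
         (iX : {linear ndual XL -> 'Loo_(R, d, a)})
         (iLoo : {linear 'Loo_(R, d, a) -> tempered R d}),
  [/\ forall phi, represents (dual_restrict (iS phi)) phi,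
      continuous iS & injective iS] /\
  [/\ forall f, represents (dual_restrict f) (wLp_fun (iX f)),
      continuous iX & injective iX] /\
  [/\ forall f, represents (iLoo f) (wLp_fun f),
      continuous iLoo, injective iLoo & dense (range iLoo)] /\
  (reflexive_space X -> reflexive_space (ndual XL) /\ dense (range iS)).
Proof.
case: (native_operators_exist hXL) => O.
exists O; move=> N0 U Nphi U' Np LL Linv Proj.
have dec := native_dual_decomp hXL O.
have decP f w q : Np q -> (f = Linv w + q <-> w = LL f /\ q = Proj f).
  exact: native_dual_decompP.
(* Stated for any A equal to the range, to serve both U' and L_phi^{-1}(X'). *)
have sumP (A : set (ndual XL)) : A = range Linv -> direct_sum A Np.
  move=> -> f; exists (Linv (LL f), Proj f); split.
    by split; [exists (LL f)|exact: N_p_Proj|exact: dec].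
  move=> [_ q] [/= [w _ <-] Nq fE].
  by have [-> ->] := (decP f w q Nq).1 fE.
split; last split; last split; last split; last split; last split.
- split.
    move=> x; exists (no_Lstar O (no_Linvstar O x), sb_in XL (nproj O x)); split.
      split=> /=; [by exists (no_Linvstar O x)| |exact: native_decomp].
      by apply/N_phiP; exists (nproj O x) => //; exact: span_nproj.
    move=> [_ y] [/= [v _ <-] /N_phiP[u su ->] ->].
    by rewrite Lis_Lstar// -(native_ProjE hXL O) Pr_Lstar.
  move=> v _ /N_phiP[u su ->].
  rewrite (Lstar_norm hXL (@no_Lstar_continuous _ _ _ _ _ _ _ O) (no_LstarE O) _ su).
  by congr (Num.max _ (norm2 _)); apply/funext => n; rewrite pn_j'.
- split.
  + exact: ndual_complete.
  + by apply: sumP; exact: U_dualE.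
  + exact: sumP.
  + apply/seteqP; split=> // f _; exists (LL f) => //; exists (Proj f); first exact: N_p_Proj.
    by rewrite -dec.
  + by move=> n psi; exact: pn_schwartz.
- exact: native_dual_norm.
- split; [exact: N_p_Proj|exact: native_ProjDE|exact: decP].
- split; [exact: native_L_continuous|exact: ker_native_L|exact: native_Linv_continuous].
- split; [exact: U_dualE|exact: N_phi_annihilator|exact: LL_Linv|exact: native_Linv_LL].
have [iS [iSE iSr cS iSi]] := schwartz_embedding XL.
have [iX iXP] := native_embedding_Loo O.
have [iLoo iLooP] := Loo_embedding d a.
exists iS, iX, iLoo; split => //; split => //; split => // rX.
have rXL := native_reflexive hXL O rX.
by split; [exact: reflexive_ndual|exact: schwartz_embedding_dense iSE rXL].
Qed.
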